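(* Let $F$ be a field of odd prime characteristic $p$ and let $n\in\mathbf{N}$. The rings $F[C_2\wr S_n]$ and $\bigoplus_{i=0}^nFS_{(i,n-i)}$ are Morita equivalent. Moreover, the blocks of $F[C_2\wr S_n]$ are labelled by pairs $((\gamma,v),(\delta,w))$, where $\gamma$ and $\delta$ are $p$-core partitions and $v,w\in\mathbf{N}_0$ are such that $|\gamma|+vp+|\delta|+wp=n$. The hyperoctahedral Specht module $S^{(\lambda,\mu)}$ lies in the block labelled by $((\gamma,v),(\delta,w))$ if and only if $\lambda$ is a partition of $|\gamma|+vp$ with $p$-core $\gamma$, and $\mu$ is a partition of $|\delta|+wp$ with $p$-core $\delta$.
   Context: $C_2\wr S_n$ is the centraliser of $(1\ \bar1)(2\ \bar2)\cdots(n\ \bar n)$ in the symmetric group on $\{1,\ldots,n,\bar1,\ldots,\bar n\}$; its top group is $T_n=\langle(1\ 2)(\bar1\ \bar2),(1\ 2\ldots n)(\bar1\ \bar2\ldots\bar n)\rangle\cong S_n$. $S_{(i,n-i)}=S_i\times S_{n-i}$ is the Young subgroup. $\mathrm{Inf}_{S_m}^{C_2\wr S_m}$ is inflation along the natural surjection $C_2\wr S_m\to S_m$. $\widetilde N^{\otimes m}$ is the one-dimensional $F[C_2\wr S_m]$-module on which $T_m$ acts trivially and each $(i\ \bar i)$ acts as $-1$. For partitions $\lambda,\mu$ with $|\lambda|+|\mu|=n$, the hyperoctahedral Specht module is $$S^{(\lambda,\mu)}=\Big(\mathrm{Inf}_{S_{|\lambda|}}^{C_2\wr S_{|\lambda|}}S^\lambda\boxtimes\big(\widetilde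 N^{\otimes|\mu|}\otimes\mathrm{Inf}_{S_{|\mu|}}^{C_2\wr S_{|\mu|}}S^\mu\big)\Big)\big\uparrow_{C_2\wr S_{|\lambda|}\times C_2\wr S_{|\mu|}}^{C_2\wr S_n},$$ where $S^\lambda$ is the Specht module of $FS_{|\lambda|}$ labelled by $\lambda$. *)

(* Defs.v *)
From HB Require Import structures.
From mathcomp Require Import all_boot all_order all_algebra all_fingroup.
From mathcomp Require Import mxrepresentation character.

Set Implicit Arguments.
Unset Strict Implicit.
Unset Printing Implicit Defensive.

Import GRing.Theory.
Local Open Scope group_scope.
Local Open Scope ring_scope.

(* Functors between categories of left modules.  Linear maps are compared
   extensionally, hence the field fmap_eq. *)
Record functor (A B : pzRingType) := Functor {
  fobj :> lmodType A -> lmodType B;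
  fmap : forall U V : lmodType A,
    {linear U -> V} -> {linear fobj U -> fobj V};
  fmap_eq : forall (U V : lmodType A) (f g : {linear U -> V}),
    f =1 g -> fmap f =1 fmap g;
  fmap_id : forall (U : lmodType A) (f : {linear U -> U}),
    f =1 id -> fmap f =1 id;
  fmap_comp : forall (U V W : lmodType A)
      (f : {linear U -> V}) (g : {linear V -> W}) (h : {linear U -> W}),
    h =1 g \o f -> fmap h =1 fmap g \o fmap f }.

Definition comp_iso_id (A B : pzRingType) (F : functor A B) (G : functor B A)
    : Prop :=
  exists eta : forall U : lmodType A, {linear U -> G (F U)},
    (forall U : lmodType A, bijective (eta U)) /\
    (forall (U V : lmodType A) (f : {linear U -> V}) (u : U),
       eta V (f u) = fmap G (fmap F f) (eta U u)).

(* comp_iso_id F G says that G \o F is naturally isomorphic to the identity, so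
   F and G are mutually inverse equivalences of module categories. *)
Definition morita_equivalent (A B : pzRingType) : Prop :=
  exists (F : functor A B) (G : functor B A), comp_iso_id F G /\ comp_iso_id G F.

Definition central_idempotent (A : pzRingType) (e : A) : Prop :=
  (forall x : A, e * x = x * e) /\ e * e = e.

(* Blocks are represented by their idempotents, the primitive idempotents of
   the centre. *)
Definition block_idempotent (A : pzRingType) (e : A) : Prop :=
  [/\ central_idempotent e, e <> 0 &
      forall f g : A, central_idempotent f -> central_idempotent g ->
        f * g = 0 -> e = f + g -> f = 0 \/ g = 0].

Section DirectSum.

Variables (I : finType) (A : I -> pzRingType).

Definition direct_sum := {dffun forall i : I, A i}.
HB.instance Definition _ := Choice.on direct_sum.

Let ds (f : forall i, A i) : direct_sum := finfun f.
Let ds_zero := ds (fun=> 0).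
Let ds_one := ds (fun=> 1).
Let ds_opp (x : direct_sum) := ds (fun i => - x i).
Let ds_add (x y : direct_sum) := ds (fun i => x i + y i).
Let ds_mul (x y : direct_sum) := ds (fun i => x i * y i).

Local Ltac ds_solve ax :=
  repeat (let x := fresh in move=> x);
  by apply/ffunP=> i; rewrite /ds !ffunE ax.

Fact ds_addA : associative ds_add. Proof. ds_solve addrA. Qed.
Fact ds_addC : commutative ds_add.
Proof. by move=> x y; apply/ffunP=> i; rewrite !ffunE addrC. Qed.
Fact ds_add0 : left_id ds_zero ds_add. Proof. ds_solve add0r. Qed.
Fact ds_addN : left_inverse ds_zero ds_opp ds_add. Proof. ds_solve addNr. Qed.
Fact ds_mulA : associative ds_mul. Proof. ds_solve mulrA. Qed.
Fact ds_mul1 : left_id ds_one ds_mul. Proof. ds_solve mul1r. Qed.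
Fact ds_mulr1 : right_id ds_one ds_mul. Proof. ds_solve mulr1. Qed.
Fact ds_mulDl : left_distributive ds_mul ds_add. Proof. ds_solve mulrDl. Qed.
Fact ds_mulDr : right_distributive ds_mul ds_add. Proof. ds_solve mulrDr. Qed.

HB.instance Definition _ := GRing.isPzRing.Build direct_sum
  ds_addA ds_addC ds_add0 ds_addN ds_mulA ds_mul1 ds_mulr1 ds_mulDl ds_mulDr.

End DirectSum.

Section GroupAlgebra.

Variables (F : fieldType) (T : finGroupType).

(* The product is convolution; the pointwise product which {ffun T -> F} carries
   in MathComp is hidden by the new constant group_algebra. *)
Definition group_algebra := {ffun T -> F}.
HB.instance Definition _ := GRing.Zmodule.on group_algebra.

Definition ga_one : group_algebra := [ffun x => (x == 1%g)%:R].
Definition ga_mul (a b : group_algebra) : group_algebra :=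
  [ffun x => \sum_(y : T) a y * b (y^-1 * x)%g].

Fact ga_mulA : associative ga_mul.
Proof.
move=> a b c; apply/ffunP=> x; rewrite !ffunE.
under eq_bigr do rewrite ffunE big_distrr /=.
under [RHS]eq_bigr do rewrite ffunE big_distrl /=.
rewrite [RHS]exchange_big /=; apply: eq_bigr => y _.
rewrite [RHS](reindex_inj (mulgI y)) /=; apply: eq_bigr => z _.
by rewrite mulrA mulKg invMg mulgA.
Qed.

Fact ga_mul1 : left_id ga_one ga_mul.
Proof.
move=> a; apply/ffunP=> x; rewrite !ffunE (bigD1 1%g) //= ffunE eqxx mul1r.
rewrite invg1 mul1g big1 ?addr0 // => y /negPf y1.
by rewrite ffunE y1 mul0r.
Qed.

Fact ga_mulr1 : right_id ga_one ga_mul.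
Proof.
move=> a; apply/ffunP=> x; rewrite !ffunE (bigD1 x) //= ffunE mulVg eqxx mulr1.
rewrite big1 ?addr0 // => y /negPf yx.
by rewrite ffunE -eq_mulVg1 yx mulr0.
Qed.

Fact ga_mulDl : left_distributive ga_mul +%R.
Proof.
move=> a b c; apply/ffunP=> x; rewrite !ffunE -big_split /=.
by apply: eq_bigr => y _; rewrite ffunE mulrDl.
Qed.

Fact ga_mulDr : right_distributive ga_mul +%R.
Proof.
move=> a b c; apply/ffunP=> x; rewrite !ffunE -big_split /=.
by apply: eq_bigr => y _; rewrite ffunE mulrDr.
Qed.

HB.instance Definition _ := GRing.Zmodule_isPzRing.Build group_algebra
  ga_mulA ga_mul1 ga_mulr1 ga_mulDl ga_mulDr.

End GroupAlgebra.

(* The block idempotent e acts as the identity on the module afforded by rG. *)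
Definition lies_in_block (F : fieldType) (gT : finGroupType) (G : {group gT})
    (d : nat) (rG : mx_representation F G d)
    (e : group_algebra F (subg_of G)) : Prop :=
  \sum_(g : subg_of G) e g *: rG (sgval g) = 1%:M.

Section Representations.

Variable F : fieldType.

Definition pullback_repr (aT rT : finGroupType) (D : {group aT})
    (f : {morphism D >-> rT}) (K : {group rT}) (d : nat)
    (rK : mx_representation F K d) (G : {group aT})
    (sGK : G \subset (f @*^-1 K)%g) : mx_representation F G d :=
  subg_repr (morphpre_repr f rK) sGK.

Section Transport.

Variables (aT rT : finGroupType) (D : {group aT}) (f : {morphism D >-> rT}).
Hypothesis injf : 'injm f.
Variables (G : {group aT}) (d : nat) (rG : mx_representation F G d).

Fact transport_subproof : (f @* G \subset invm injf @*^-1 G)%g.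
Proof.
apply/subsetP=> _ /morphimP[x Dx Gx ->].
by rewrite !inE /= mem_morphim //= invmE.
Qed.

Definition transport_repr : mx_representation F (f @* G)%G d :=
  pullback_repr rG transport_subproof.

End Transport.

Section OuterTensor.

Variables (gT1 gT2 : finGroupType) (G1 : {group gT1}) (G2 : {group gT2}).
Variables (d1 d2 : nat).
Variables (r1 : mx_representation F G1 d1) (r2 : mx_representation F G2 d2).

Fact setX_fst : (setX G1 G2 \subset @fst gT1 gT2 @*^-1 G1)%g.
Proof. by apply/subsetP=> x; rewrite !inE => /andP[]. Qed.

Fact setX_snd : (setX G1 G2 \subset @snd gT1 gT2 @*^-1 G2)%g.
Proof. by apply/subsetP=> x; rewrite !inE => /andP[]. Qed.

Definition outer_tensor_repr :
    mx_representation F (setX_group G1 G2) (d1 * d2) :=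
  @prod_repr F _ (setX_group G1 G2) d1 d2
    (@pullback_repr _ _ _ _ G1 d1 r1 (setX_group G1 G2) setX_fst)
    (@pullback_repr _ _ _ _ G2 d2 r2 (setX_group G1 G2) setX_snd).

End OuterTensor.

(* In MathComp, matrices act on row vectors from the right.  If the t_i
   represent the right cosets of H in G, then the induced module is the direct
   sum of the V (x) t_i, with (v (x) t_i) g = v (t_i g t_j^-1) (x) t_j for the
   unique j such that t_i g t_j^-1 \in H. *)
Section Induction.

Variables (gT : finGroupType) (H G : {group gT}) (d : nat).
Variable rH : mx_representation F H d.

Definition coset_rep (i : 'I_#|G : H|) : gT := repr (enum_val i).

Definition induced_mx (g : gT) : 'M[F]_(\sum_(i < #|G : H|) d) :=
  \mxblock_(i < #|G : H|, j < #|G : H|)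
     (let h := (coset_rep i * g * (coset_rep j)^-1)%g in
      if h \in H then rH h else 0).

Fact coset_repP i : enum_val i = (H :* coset_rep i)%g.
Proof.
have /rcosetsP[x Gx Ei] := enum_valP i.
by rewrite /coset_rep Ei; apply/rcoset_eqP; rewrite rcoset_sym mem_repr_rcoset.
Qed.

Fact coset_rep_inj i j :
  (coset_rep i * (coset_rep j)^-1)%g \in H -> i = j.
Proof.
by rewrite -mem_rcoset => /rcoset_eqP Eij; apply: enum_val_inj; rewrite !coset_repP.
Qed.

Fact coset_rep_ex x : x \in G -> exists i, (x * (coset_rep i)^-1)%g \in H.
Proof.
move=> Gx; have Hx : (H :* x)%g \in rcosets H G by apply/rcosetsP; exists x.
exists (enum_rank_in Hx (H :* x)%g); rewrite -mem_rcoset -coset_repP.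
by rewrite enum_rankK_in // rcoset_refl.
Qed.

Hypothesis sHG : H \subset G.

Fact coset_rep_in i : coset_rep i \in G.
Proof.
have /rcosetsP[x Gx Ei] := enum_valP i; rewrite /coset_rep Ei.
have /rcosetP[h Hh ->] := mem_repr_rcoset H x.
by rewrite groupM // (subsetP sHG).
Qed.

Fact induced_mx_repr : mx_repr G induced_mx.
Proof.
split=> [|x y Gx Gy].
  rewrite /induced_mx -mxdiagZ; apply: eq_mxblock => i j; rewrite mulg1.
  have [-> | neq_ij] := eqVneq i j.
    by rewrite mulgV group1 repr_mx1 conform_mx_id.
  by case: ifP => // /coset_rep_inj Eij; rewrite Eij eqxx in neq_ij.
rewrite /induced_mx mul_mxblock; apply: eq_mxblock => i k.
have [j Hj] := coset_rep_ex (groupM (coset_rep_in i) Gx).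
rewrite (bigD1 j) //= Hj big1 ?addr0 => [|j' neq_j]; last first.
  case: ifP => [Hj'|_]; last by rewrite mul0mx.
  case/negP: neq_j; apply/eqP/coset_rep_inj.
  by move: (groupM (groupVr Hj') Hj); rewrite !invMg invgK -!mulgA mulKg mulKg.
have -> : (coset_rep i * (x * y) * (coset_rep k)^-1 =
  coset_rep i * x * (coset_rep j)^-1
    * (coset_rep j * y * (coset_rep k)^-1))%g by rewrite !mulgA mulgKV.
rewrite groupMl //; case: ifP => Hk; last by rewrite mulmx0.
by rewrite repr_mxM.
Qed.

Definition induced_repr := MxRepresentation induced_mx_repr.

End Induction.

End Representations.

Definition is_partition (la : seq nat) : bool :=
  sorted geq la && (0%N \notin la).

(* A node is a pair (row, column), both counted from 0. *)
Definition in_diagram (la : seq nat) (x : nat * nat) : bool :=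
  (x.2 < nth 0%N la x.1)%N.

Definition in_rim (la : seq nat) (x : nat * nat) : bool :=
  in_diagram la x && ~~ in_diagram la (x.1.+1, x.2.+1).

(* One step along the rim from north-east to south-west. *)
Definition rim_step (x y : nat * nat) : bool :=
  (y == (x.1.+1, x.2)) || (x == (y.1, y.2.+1)).

(* mu is obtained from la by removing a rim p-hook, i.e. a connected piece s of
   p nodes of the rim (listed from north-east to south-west) such that what is
   left is the diagram of a partition. *)
Definition removes_rim_hook (p : nat) (la mu : seq nat) : Prop :=
  is_partition mu /\
  exists s : seq (nat * nat),
    [/\ size s = p, sorted rim_step s, all (in_rim la) s &
        forall x, in_diagram mu x = in_diagram la x && (x \notin s)].

Inductive rim_hooks_reduce (p : nat) (la : seq nat) : seq nat -> Prop :=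
| rim_hooks_refl : rim_hooks_reduce p la la
| rim_hooks_step (mu nu : seq nat) :
    rim_hooks_reduce p la mu -> removes_rim_hook p mu nu ->
    rim_hooks_reduce p la nu.

Definition is_core (p : nat) (ga : seq nat) : Prop :=
  is_partition ga /\ forall mu, ~ removes_rim_hook p ga mu.

Definition has_core (p : nat) (la ga : seq nat) : Prop :=
  rim_hooks_reduce p la ga /\ is_core p ga.

Section Specht.

Variables (F : fieldType) (la : seq nat).
Local Notation m := (sumn la).

(* The nodes of the diagram of la are numbered 0, ..., m-1 in reading order, so
   that node k lies in row [reshape_index la k] and column
   [reshape_offset la k].  A la-tableau is a permutation t : 'S_m, having the
   entry t k in node k; as (t * g) k = g (t k), the group 'S_m acts on entries
   by right multiplication. *)

(* A tabloid is encoded as the function sending each entry to its row. *)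
Definition is_tabloid (r : {ffun 'I_m -> 'I_m}) : bool :=
  [forall i : 'I_m, #|[set x | r x == i]| == nth 0%N la i].

Definition tabloid := {r : {ffun 'I_m -> 'I_m} | is_tabloid r}.

Definition tabloid_fun (r : tabloid) (g : 'S_m) : {ffun 'I_m -> 'I_m} :=
  [ffun x => val r (g^-1%g x)].

Fact tabloid_act_subproof r g : is_tabloid (tabloid_fun r g).
Proof.
apply/forallP=> i; rewrite -(eqP (forallP (valP r) i)).
rewrite -(card_imset (mem [set x | val r x == i]) (@perm_inj _ g)).
apply/eqP; apply: eq_card => x; rewrite inE ffunE.
rewrite -{2}[x](permKV g) mem_imset ?inE //; exact: perm_inj.
Qed.

Definition tabloid_act (r : tabloid) (g : 'S_m) : tabloid :=
  Sub (tabloid_fun r g) (tabloid_act_subproof r g).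

Definition tabloid_mx (g : 'S_m) : 'M[F]_#|{: tabloid}| :=
  \matrix_(i, j) (tabloid_act (enum_val i) g == enum_val j)%:R.

Fact tabloid_act1 r : tabloid_act r 1%g = r.
Proof. by apply/val_inj/ffunP=> x; rewrite ffunE invg1 perm1. Qed.

Fact tabloid_actM r g h :
  tabloid_act r (g * h)%g = tabloid_act (tabloid_act r g) h.
Proof. by apply/val_inj/ffunP=> x; rewrite !ffunE invMg permM. Qed.

Fact tabloid_mx_repr : mx_repr [set: 'S_m] tabloid_mx.
Proof.
split=> [|g h _ _].
  by apply/matrixP=> i j; rewrite !mxE tabloid_act1 (inj_eq enum_val_inj).
apply/matrixP=> i j; rewrite !mxE tabloid_actM.
rewrite (bigD1 (enum_rank (tabloid_act (enum_val i) g))) //= !mxE enum_rankK.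
rewrite eqxx mul1r big1 ?addr0 // => k /negPf neq_k.
rewrite !mxE -(inj_eq enum_rank_inj) enum_valK eq_sym neq_k.
by rewrite mul0r.
Qed.

Definition tabloid_repr : mx_representation F [set: 'S_m]%G #|{: tabloid}| :=
  MxRepresentation tabloid_mx_repr.

(* r is the tabloid {t}. *)
Definition tabloid_of (t : 'S_m) (r : tabloid) : bool :=
  [forall k : 'I_m, val r (t k) == reshape_index la k :> nat].

Definition column_stab (t : 'S_m) : {set 'S_m} :=
  [set s : 'S_m | [forall k : 'I_m,
     reshape_offset la (t^-1%g (s (t k))) == reshape_offset la k]].

(* Coordinates of e_t = \sum_(s in C_t) (sgn s) {t s} in the basis of
   tabloids. *)
Definition polytabloid (t : 'S_m) : 'rV[F]_#|{: tabloid}| :=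
  \row_j \sum_(s in column_stab t)
    (-1) ^+ s * (tabloid_of (t * s)%g (enum_val j))%:R.

Definition specht_space : 'M[F]_#|{: tabloid}| :=
  (\sum_(t : 'S_m) <<polytabloid t>>)%MS.

Fact tabloid_ofM t g r :
  tabloid_of (t * g)%g r = tabloid_of t (tabloid_act r g^-1%g).
Proof.
apply: eq_forallb => k; rewrite /= ffunE invgK permM //.
Qed.

Fact column_stabJ t g s :
  ((s ^ g)%g \in column_stab (t * g)%g) = (s \in column_stab t).
Proof.
rewrite !inE; apply: eq_forallb => k.
by rewrite conjgE invMg !permM !permK.
Qed.

Fact polytabloidM t g : polytabloid t *m tabloid_mx g = polytabloid (t * g)%g.
Proof.
apply/rowP=> j; rewrite !mxE.
rewrite (bigD1 (enum_rank (tabloid_act (enum_val j) g^-1%g))) //= big1 ?addr0.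
  rewrite !mxE enum_rankK -tabloid_actM mulVg tabloid_act1 eqxx mulr1.
  rewrite [RHS](reindex_inj (conjg_inj g)) /=.
  apply: eq_big => [s|s _]; first by rewrite column_stabJ.
  rewrite odd_permJ -tabloid_ofM; congr (_ * (tabloid_of _ _)%:R).
  by rewrite conjgE !mulgA mulgK.
move=> k /negPf neq_k; rewrite !mxE.
case: eqP => [Ej|_]; last by rewrite mulr0.
by rewrite -Ej -tabloid_actM mulgV tabloid_act1 enum_valK eqxx in neq_k.
Qed.

Fact specht_module : mxmodule tabloid_repr specht_space.
Proof.
apply/mxmoduleP=> g _; rewrite sumsmxMr; apply/sumsmx_subP=> t _.
apply: (sumsmx_sup (t * g)%g) => //.
by rewrite (eqmxMr _ (genmxE _)) genmxE polytabloidM.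
Qed.

Definition specht_repr :
    mx_representation F [set: 'S_m]%G (\rank specht_space) :=
  submod_repr specht_module.

End Specht.

(* The points i and \bar i are encoded as inl i and inr i. *)
Section Hyperoctahedral.

Variable n : nat.
Local Notation points := ('I_n + 'I_n)%type.

Definition bar_fun (x : points) : points :=
  match x with inl i => inr i | inr i => inl i end.

Fact bar_funK : involutive bar_fun. Proof. by case. Qed.

Definition bar : {perm points} := perm (inv_inj bar_funK).

Definition hyperoctahedral : {group {perm points}} := 'C[bar]%G.

Fact hyp_bar (s : {perm points}) x :
  s \in hyperoctahedral -> s (bar_fun x) = bar_fun (s x).
Proof.
move=> /cent1P/permP/(_ x); rewrite !permM !permE; by move=> ->.
Qed.

Definition index_of (x : points) : 'I_n :=
  match x with inl i => i | inr i => i end.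

Definition is_barred (x : points) : bool :=
  match x with inl _ => false | inr _ => true end.

Fact hyp_index (s : {perm points}) x :
  s \in hyperoctahedral -> index_of (s x) = index_of (s (inl (index_of x))).
Proof.
case: x => // i Gs; rewrite -/(bar_fun (inl i)) hyp_bar //=.
by case: (s (inl i)).
Qed.

(* The natural surjection onto S_n; the default value 1 is never used on the
   hyperoctahedral group. *)
Definition top_perm_fun (s : {perm points}) : {ffun 'I_n -> 'I_n} :=
  [ffun i => index_of (s (inl i))].

Definition top_perm (s : {perm points}) : 'S_n := insubd (1%g : 'S_n) (top_perm_fun s).

Fact topE s i : s \in hyperoctahedral -> top_perm s i = index_of (s (inl i)).
Proof.
move=> Gs; have inj_s : injectiveb (top_perm_fun s).
  apply/injectiveP=> j k; rewrite !ffunE.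
  have [[] // |] := eqVneq (s (inl j)) (s (inl k)); first by move/perm_inj=> [].
  have [E _|] := eqVneq (s (inl j)) (s (inr k)); first by move/perm_inj: E.
  rewrite -/(bar_fun (inl k)) hyp_bar //.
  by case: (s (inl j)) (s (inl k)) => [a|a] [b|b] //= + + E; rewrite E eqxx.
by rewrite -pvalE -[pval _]/(val (top_perm s)) insubdK ?ffunE.
Qed.

Fact topM : {in hyperoctahedral &, {morph top_perm : s t / (s * t)%g}}.
Proof.
move=> s t Gs Gt; apply/permP=> i.
by rewrite permM !topE ?groupM // permM hyp_index.
Qed.

Canonical top_morphism := Morphism topM.

(* The one-dimensional module on which the top group acts trivially and every
   transposition (i \bar i) acts as -1: the sign of s is given by the number of
   unbarred points that it sends to barred points. *)
Definition bar_sign (s : {perm points}) : nat :=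
  \sum_(i < n) is_barred (s (inl i)).

Definition ntilde_mx (F : fieldType) (s : {perm points}) : 'M[F]_1 :=
  ((-1) ^+ bar_sign s)%:M.

Fact ntilde_mx_repr F : mx_repr hyperoctahedral (ntilde_mx F).
Proof.
split=> [|s t Gs Gt].
  by rewrite /ntilde_mx /bar_sign big1 // => i _; rewrite perm1.
rewrite /ntilde_mx -scalar_mxM -exprD -signr_odd -[in RHS]signr_odd.
congr ((_ ^+ (nat_of_bool _))%:M); rewrite oddD /bar_sign.
have -> : (\sum_(i < n) is_barred (t (inl i)))%N
        = (\sum_(i < n) is_barred (t (inl (top_perm s i))))%N.
  by rewrite (reindex_inj (@perm_inj _ (top_perm s))).
rewrite !(big_morph odd oddD (erefl : odd 0 = false)) -big_split /=.
apply: eq_bigr => i _; rewrite !oddb permM topE //.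
case: (s (inl i)) => j //=.
by rewrite -/(bar_fun (inl j)) hyp_bar //; case: (t (inl j)).
Qed.

Definition ntilde_repr (F : fieldType) : mx_representation F hyperoctahedral 1 :=
  MxRepresentation (ntilde_mx_repr F).

Fact ntilde_swap F (i : 'I_n) :
  ntilde_repr F (tperm (inl i) (inr i)) = (-1)%:M.
Proof.
rewrite /= /ntilde_mx /bar_sign (bigD1 i) //= tpermL big1 ?addn0 ?expr1 //.
by move=> j ne_j; rewrite tpermD //; apply: contra ne_j => /eqP[->].
Qed.

Fact ntilde_top F (s : {perm points}) :
  (forall i, ~~ is_barred (s (inl i))) -> ntilde_repr F s = 1%:M.
Proof.
move=> s_top; rewrite /= /ntilde_mx /bar_sign big1 // => i _.
by rewrite (negPf (s_top i)).
Qed.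

Fact hyp_sub_top : hyperoctahedral \subset (top_perm @*^-1 [set: 'S_n])%g.
Proof. by apply/subsetP=> s Gs; apply/morphpreP; split; rewrite ?in_setT. Qed.

Definition inflation_repr (F : fieldType) (d : nat)
    (r : mx_representation F [set: 'S_n]%G d) :
    mx_representation F hyperoctahedral d :=
  pullback_repr r hyp_sub_top.

End Hyperoctahedral.

Section Young.

Variables (a b n : nat) (En : (a + b)%N = n).

(* The first factor acts on the points with index < a, the second one on the
   points with index >= a. *)
Definition low (i : 'I_a) : 'I_n := cast_ord En (lshift b i).
Definition high (j : 'I_b) : 'I_n := cast_ord En (rshift a j).

Definition merge (x : ('I_a + 'I_a) + ('I_b + 'I_b)) : 'I_n + 'I_n :=
  match x with
  | inl (inl i) => inl (low i)
  | inl (inr i) => inr (low i)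
  | inr (inl j) => inl (high j)
  | inr (inr j) => inr (high j)
  end.

Definition unmerge (x : 'I_n + 'I_n) : ('I_a + 'I_a) + ('I_b + 'I_b) :=
  match x with
  | inl k => match split (cast_ord (esym En) k) with
             | inl i => inl (inl i) | inr j => inr (inl j) end
  | inr k => match split (cast_ord (esym En) k) with
             | inl i => inl (inr i) | inr j => inr (inr j) end
  end.

Fact mergeK : cancel merge unmerge.
Proof.
have lowK i : split (cast_ord (esym En) (low i)) = inl i.
  by rewrite cast_ordK -[lshift b i]/(unsplit (inl i)) unsplitK.
have highK j : split (cast_ord (esym En) (high j)) = inr j.
  by rewrite cast_ordK -[rshift a j]/(unsplit (inr j)) unsplitK.
by case=> [[]|[]] i /=; rewrite ?lowK ?highK.
Qed.

Fact unmergeK : cancel unmerge merge.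
Proof.
have H (k : 'I_n) (i : 'I_a + 'I_b) : split (cast_ord (esym En) k) = i ->
    match i with inl i => low i | inr j => high j end = k.
  move=> E; apply: (can_inj (cast_ordK (esym En))).
  have /= := splitK (cast_ord (esym En) k); rewrite E => <-.
  by case: (i) => j; rewrite cast_ordK.
by case=> k /=; have:= H k; case: split => i /(_ _ erefl) /= ->.
Qed.

Definition join_fun (st : {perm 'I_a + 'I_a} * {perm 'I_b + 'I_b})
    (x : 'I_n + 'I_n) : 'I_n + 'I_n :=
  merge (match unmerge x with inl y => inl (st.1 y) | inr y => inr (st.2 y) end).

Fact join_fun_inj st : injective (join_fun st).
Proof.
move=> x y /(can_inj mergeK) E; apply: (can_inj unmergeK); move: E.
by case: (unmerge x) (unmerge y) => [u|u] [v|v] // [] /perm_inj ->.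
Qed.

Definition join_perm st : {perm 'I_n + 'I_n} := perm (@join_fun_inj st).

Fact join_permM : {in setT &, {morph join_perm : s t / (s * t)%g}}.
Proof.
move=> s t _ _; apply/permP=> x; rewrite permM !permE /join_fun mergeK.
by case: (unmerge x) => y; rewrite permM.
Qed.

Canonical join_morphism := Morphism join_permM.

Fact join_injm : 'injm join_perm.
Proof.
apply/injmP=> -[s1 s2] [t1 t2] _ _ /permP E.
have E' x : (match x with inl y => inl (s1 y) | inr y => inr (s2 y) end)
          = (match x with inl y => inl (t1 y) | inr y => inr (t2 y) end
             : _ + _).
  by have:= E (merge x); rewrite !permE /join_fun mergeK => /(can_inj mergeK).
congr (_, _); apply/permP=> y; first by have [] := E' (inl y).
by have [] := E' (inr y).
Qed.

Definition hyp_young : {group {perm 'I_n + 'I_n}} :=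
  (join_perm @* setX (hyperoctahedral a) (hyperoctahedral b))%G.

Fact hyp_young_sub : hyp_young \subset hyperoctahedral n.
Proof.
apply/subsetP=> _ /morphimP[[s t] _ /setXP[/= Gs Gt] ->].
apply/cent1P/permP=> x; rewrite !permM !permE /join_fun.
have merge_bar u : bar_fun (merge u) =
    merge (match u with inl y => inl (bar_fun y) | inr y => inr (bar_fun y) end).
  by case: u => [[]|[]].
rewrite merge_bar -[in RHS](unmergeK x) merge_bar mergeK.
by case: (unmerge x) => y /=; rewrite hyp_bar.
Qed.

End Young.

Definition hyp_specht_repr (F : fieldType) (la mu : seq nat) (n : nat)
    (En : (sumn la + sumn mu)%N = n) :=
  induced_repr
    (transport_repr (join_injm En)
       (outer_tensor_repr
          (inflation_repr (specht_repr F la))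
          (prod_repr (ntilde_repr (sumn mu) F)
                     (inflation_repr (specht_repr F mu)))))
    (hyp_young_sub En).

(* A label ((gamma, v), (delta, w)) consists of two p-cores and two weights. *)
Definition block_label := ((seq nat * nat) * (seq nat * nat))%type.

Definition is_block_label (p n : nat) (l : block_label) : Prop :=
  [/\ is_core p l.1.1, is_core p l.2.1 &
      (sumn l.1.1 + l.1.2 * p + sumn l.2.1 + l.2.2 * p)%N = n].

(* Main.v *)
Require Import Defs.
From HB Require Import structures.
From mathcomp Require Import all_boot all_order all_algebra all_fingroup.
From mathcomp Require Import mxrepresentation character.
From mathcomp Require Import zify ring.
From Stdlib Require Classical_Prop ClassicalEpsilon.

Set Implicit Arguments.
Unset Strict Implicit.
Unset Printing Implicit Defensive.

Import GRing.Theory.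
Local Open Scope group_scope.
Local Open Scope ring_scope.

(** Write [G] for the hyperoctahedral group of degree [n], [e_i] for the
    idempotent of the character of its base group that is -1 exactly on the
    coordinates [i, ..., n - 1], and [e] for the sum of all [e_i].

    The top group acts on the characters of the base group with the [e_i]
    representing the orbits, so [e] generates the whole group algebra as an
    ideal; and as only Young permutations fix the character of [e_i], compressing
    to [e] gives the direct sum of the group algebras of the Young subgroups.
    A ring is Morita equivalent to such a full corner ([hyp_full_corner],
    [full_corner_morita]).

    For the blocks, modules are replaced by single vectors.  A weight vector
    ([is_weight]) affords the character of some [e_i] and is a common eigenvector
    of the Jucys-Murphy elements of the two symmetric groups.  Since every
    central element of a symmetric group algebra is a symmetric polynomial in the
    Jucys-Murphy elements, in every characteristic ([centre_jm]), a central
    element of the group algebra of [G] acts on a weight vector by a scalar that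
    depends only on the multisets of eigenvalues ([central_scalar]).  Conversely,
    central elements of the corner lift through the Morita equivalence
    ([central_lift]), and the elementary symmetric polynomials separate
    multisets; as a central element takes one value on each block
    ([block_scalar]), weight vectors of one block have the same index [i] and
    the same eigenvalues ([block_partitions]).

    It remains to produce weight vectors.  A nonzero vector that is antisymmetric
    along columns of points and is annihilated by the Garnir elements is an
    eigenvector whose eigenvalues are the contents of the diagram with these
    columns ([weight_of_garnir]).  This applies to polytabloids, as 2 is invertible
    ([polytabloid_garnir]), and gives a generating weight vector of every
    hyperoctahedral Specht module ([hyp_specht_weight]).
    It also applies to a vector in a right ideal for which the columns are as
    unequal as possible, whence each block contains such a Specht module
    ([ideal_weight]).

    Thus two hyperoctahedral Specht modules lie in one block if and only if the
    sizes and the multisets of residues of the two partitions agree.  For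
    partitions of the same size the latter means that the [p]-cores agree: a
    removed rim hook contains each residue once ([same_core_residues]), and
    residues count the beads on the runners of the abacus, which determine the
    core ([residues_same_core]). *)

(** * Group algebras and right actions *)

Section GroupAlgebra.
Variables (F : fieldType) (T : finGroupType).
Local Notation A := (group_algebra F T).

Fact ga_one_neq0 : (1 : A) != 0.
Proof.
by apply/eqP=> /ffunP/(_ 1%g)/eqP; rewrite !ffunE eqxx oner_eq0.
Qed.

HB.instance Definition _ := GRing.PzSemiRing_isNonZero.Build A ga_one_neq0.
HB.instance Definition _ := GRing.Lmodule.copy A {ffun T -> F^o}.

Lemma ga_scaleE (c : F) (a : A) x : (c *: a) x = c * a x.
Proof. by rewrite ffunE. Qed.

Lemma ga_mulE (a b : A) x : (a * b) x = \sum_y a y * b (y^-1 * x)%g.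
Proof. by rewrite ffunE. Qed.

Fact ga_scalerAl (c : F) (a b : A) : c *: (a * b) = c *: a * b.
Proof.
apply/ffunP=> x; rewrite ga_scaleE !ga_mulE mulr_sumr.
by apply: eq_bigr => y _; rewrite ga_scaleE mulrA.
Qed.

Fact ga_scalerAr (c : F) (a b : A) : c *: (a * b) = a * (c *: b).
Proof.
apply/ffunP=> x; rewrite ga_scaleE !ga_mulE mulr_sumr.
by apply: eq_bigr => y _; rewrite ga_scaleE mulrCA.
Qed.

HB.instance Definition _ := GRing.Lmodule_isLalgebra.Build F A ga_scalerAl.
HB.instance Definition _ := GRing.Lalgebra_isAlgebra.Build F A ga_scalerAr.

Definition delta (g : T) : A := [ffun x => (x == g)%:R].

Lemma mul_delta (a : A) g x : (a * delta g) x = a (x * g^-1)%g.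
Proof.
rewrite ga_mulE (bigD1 (x * g^-1)%g) //= ffunE invMg invgK mulgKV eqxx mulr1.
rewrite big1 ?addr0 // => y neq_y; rewrite ffunE; case: eqP => [Eg|]; last by rewrite mulr0.
by rewrite -Eg invMg invgK mulKVg eqxx in neq_y.
Qed.

Lemma delta_mul (a : A) g x : (delta g * a) x = a (g^-1 * x)%g.
Proof.
rewrite ga_mulE (bigD1 g) //= ffunE eqxx mul1r big1 ?addr0 // => y /negPf yg.
by rewrite ffunE yg mul0r.
Qed.

Lemma deltaM g h : delta (g * h)%g = delta g * delta h.
Proof.
apply/ffunP=> x; rewrite mul_delta !ffunE; congr (nat_of_bool _)%:R.
by apply/eqP/eqP=> [->|<-]; rewrite ?mulgK ?mulgKV.
Qed.

Lemma delta1 : delta 1%g = 1.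
Proof. by apply/ffunP=> x; rewrite !ffunE. Qed.

Lemma ga_sum (a : A) : a = \sum_g a g *: delta g.
Proof.
apply/ffunP=> x; rewrite sum_ffunE (bigD1 x) //= ffunE ffunE eqxx.
rewrite big1 ?addr0 ?[_ *: _]mulr1 // => y /negPf yx.
by rewrite ffunE ffunE eq_sym yx [_ *: _]mulr0.
Qed.

Definition central (z : A) := forall x, z * x = x * z.

(** Commuting with the group elements suffices, and it says that [z] is a class
    function. *)
Lemma centralP (z : A) : central z <-> forall g h, z (g ^ h)%g = z g.
Proof.
split=> [cz g h|cz x].
  have /ffunP/(_ (g * h)%g) := cz (delta h).
  by rewrite mul_delta delta_mul mulgK conjgE.
suff cd g : z * delta g = delta g * z.
  rewrite [x]ga_sum mulr_sumr mulr_suml; apply: eq_bigr => g _.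
  by rewrite -scalerAr cd scalerAl.
apply/ffunP=> y; rewrite mul_delta delta_mul -(cz (y * g^-1)%g g) conjgE.
by rewrite mulgKV.
Qed.

End GroupAlgebra.

Arguments delta {F T} g.

(** Right actions are kept as plain families of linear maps, so that the same
    vectors can be acted upon by several groups. *)
Record right_action (F : fieldType) (T : finGroupType) (V : lmodType F) :=
  RightAction {
    ract :> T -> V -> V;
    ract_linear : forall g, linear (ract g);
    ract1 : forall v, ract 1%g v = v;
    ractM : forall g h v, ract (g * h)%g v = ract h (ract g v) }.

Section RightAction.
Variables (F : fieldType) (T : finGroupType) (V : lmodType F).
Variable r : right_action T V.

HB.instance Definition _ g :=
  GRing.isLinear.Build F V V *:%R (r g) (ract_linear r g).

Lemma ractN g v : r g (- v) = - r g v.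
Proof. exact: linearN. Qed.

Definition ract_ga (a : group_algebra F T) (v : V) : V := \sum_g a g *: r g v.

Fact ract_ga_linear a : linear (ract_ga a).
Proof.
move=> c u v; rewrite /ract_ga scaler_sumr -big_split /=.
by apply: eq_bigr => g _; rewrite linearP scalerDr !scalerA mulrC.
Qed.

HB.instance Definition _ a :=
  GRing.isLinear.Build F V V *:%R (ract_ga a) (ract_ga_linear a).

Lemma ract_gaD a b v : ract_ga (a + b) v = ract_ga a v + ract_ga b v.
Proof.
rewrite -big_split; apply: eq_bigr => g _ /=.
by rewrite ffunE scalerDl.
Qed.

Lemma ract_gaZ c a v : ract_ga (c *: a) v = c *: ract_ga a v.
Proof.
rewrite scaler_sumr; apply: eq_bigr => g _ /=.
by rewrite ga_scaleE scalerA.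
Qed.

Lemma ract_ga0 v : ract_ga 0 v = 0.
Proof. by rewrite -(scale0r (0 : group_algebra F T)) ract_gaZ scale0r. Qed.

Lemma ract_ga_sum I s (P : pred I) (f : I -> group_algebra F T) v :
  ract_ga (\sum_(i <- s | P i) f i) v = \sum_(i <- s | P i) ract_ga (f i) v.
Proof. by apply: (big_morph (ract_ga^~ v) (fun a b => ract_gaD a b v)); apply: ract_ga0. Qed.

Lemma ract_delta g v : ract_ga (delta g) v = r g v.
Proof.
rewrite /ract_ga (bigD1 g) //= ffunE eqxx scale1r big1 ?addr0 // => h /negPf hg.
by rewrite ffunE hg scale0r.
Qed.

Lemma ract_ga1 v : ract_ga 1 v = v.
Proof. by rewrite -delta1 ract_delta ract1. Qed.

Lemma ract_gaM a b v : ract_ga (a * b) v = ract_ga b (ract_ga a v).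
Proof.
rewrite [a]ga_sum mulr_suml !ract_ga_sum linear_sum; apply: eq_bigr => g _.
rewrite -scalerAl !ract_gaZ linearZ; congr (_ *: _).
rewrite ract_delta /ract_ga (reindex_inj (mulgI g)); apply: eq_bigr => h _ /=.
by rewrite delta_mul mulKg ractM.
Qed.

End RightAction.

(** * The centre of the group algebra of a symmetric group *)

Section CycleMaxima.
Variable n : nat.
Implicit Types (s t : 'S_n) (i j k x y : 'I_n).

Definition supp s : {set 'I_n} := [set x | s x != x].

(** Every nontrivial cycle is represented by its largest point, because the
    Jucys-Murphy element of [k] involves the points up to [k] only. *)
Definition orbit_max s k := [forall y in porbit s k, (y <= k)%N].

(** The multiset of the nonzero exponents is the multiset of cycle lengths minus
    one; they are the exponents of the monomial in the Jucys-Murphy elements of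
    which [s] is a leading term, see [jm_word_coef]. *)
Definition expo s k : nat := if orbit_max s k then #|porbit s k|.-1 else 0%N.

Lemma porbit_sub s (S : {set 'I_n}) x :
  (forall y, y \in S -> s y \in S) -> x \in S -> porbit s x \subset S.
Proof.
move=> sS Sx; apply/subsetP=> y /porbitP[i ->]; elim: i => [|i IH].
  by rewrite expg0 perm1.
by rewrite expgSr permM sS.
Qed.

Lemma porbit_step s x : s x \in porbit s x.
Proof. exact: (mem_porbit s 1). Qed.

Lemma porbit_closed s x y : y \in porbit s x -> s y \in porbit s x.
Proof. by move=> xy; rewrite -(eqP (etrans (eq_porbit_mem _ _ _) xy)) porbit_step. Qed.

Lemma porbit_fix s x : s x = x -> porbit s x = [set x].
Proof.
move=> sx; apply/eqP; rewrite eqEsubset sub1set porbit_id andbT.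
by apply: porbit_sub; rewrite ?inE // => y /set1P->; rewrite sx inE.
Qed.

Lemma card_porbit_gt1 s x : (1 < #|porbit s x|)%N = (x \in supp s).
Proof.
rewrite inE; have [sx|sx] := eqVneq (s x) x; first by rewrite porbit_fix ?cards1.
by rewrite (cardsD1 x) porbit_id ltnS card_gt0; apply/set0Pn; exists (s x);
  rewrite !inE sx porbit_step.
Qed.

Lemma supp_porbit s x y : y \in porbit s x -> (y \in supp s) = (x \in supp s).
Proof. by rewrite -!card_porbit_gt1 -eq_porbit_mem => /eqP->. Qed.

Lemma orbit_max_ex s x : exists2 m, m \in porbit s x & orbit_max s m.
Proof.
case: (arg_maxnP (fun y : 'I_n => val y) (porbit_id s x)) => m xm max_m.
exists m => //; apply/forall_inP=> y my; apply: max_m.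
by rewrite /= -(eqP (etrans (eq_porbit_mem _ _ _) xm)).
Qed.

Lemma orbit_max_uniq s x y :
  orbit_max s x -> orbit_max s y -> x \in porbit s y -> x = y.
Proof.
move=> /forall_inP mx /forall_inP my xy; apply/val_inj/eqP.
by rewrite eqn_leq my //= mx // porbit_sym.
Qed.

Lemma expo_gt0 s k : (0 < expo s k)%N = orbit_max s k && (k \in supp s).
Proof.
rewrite -card_porbit_gt1 /expo; case: ifP => //= _.
by case: #|_| => [|[]].
Qed.

(** The moved points are counted cycle by cycle, each cycle at its maximum. *)
Lemma card_supp s : #|supp s| = (\sum_k (expo s k + (0 < expo s k)))%N.
Proof.
transitivity (\sum_(x in supp s) \sum_(k | orbit_max s k && (x \in porbit s k)) 1)%N.
  rewrite -sum1_card; apply: eq_bigr => x _; have [m xm max_m] := orbit_max_ex s x.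
  rewrite (big_pred1 m) // => k; apply/andP/eqP=> [[max_k xk]|->].
    apply: (orbit_max_uniq max_k max_m).
    by rewrite porbit_sym -(eqP (etrans (eq_porbit_mem _ _ _) xk)).
  by rewrite porbit_sym.
rewrite (exchange_big_dep (orbit_max s)) /= => [|x k _ /andP[] //].
rewrite big_mkcond; apply: eq_bigr => k _; rewrite expo_gt0 /expo.
case: ifP => [max_k|//]; rewrite sum1dep_card /=.
have [sk|sk] := boolP (k \in supp s).
  transitivity #|porbit s k|; last by rewrite addn1 prednK // lt0n card_porbit_neq0.
  apply: eq_card => x; rewrite inE max_k /=.
  by apply: andb_idl => /supp_porbit->.
move: sk; rewrite -card_porbit_gt1 -leqNgt => le1.
transitivity 0%N; last by case: #|_| le1 => [|[]].
apply: eq_card0 => x; rewrite inE max_k /=; apply/andP=> -[sx xk].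
by move: sx; rewrite (supp_porbit xk) -card_porbit_gt1 ltnNge le1.
Qed.

(** Inserting a new point [j] just before the largest moved point [k] of [t]
    lengthens the cycle of [k] by one and keeps its maximum. *)
Lemma expo_insert t j k x :
  t j = j -> (j < k)%N -> (forall y, y \in supp t -> (y <= k)%N) ->
  expo (t * tperm j k) x = (expo t x + (x == k))%N.
Proof.
move=> tj lt_jk le_k; set s := (t * tperm j k)%g.
have neq_jk : j != k by rewrite neq_ltn lt_jk.
have sE y : s y = tperm j k (t y) by rewrite permM.
have nj : j \notin porbit t k.
  by rewrite porbit_sym porbit_fix // inE eq_sym.
have le_pk y : y \in porbit t k -> (y <= k)%N.
  have [ky|nky] := boolP (k \in supp t).
    by move=> yk; apply: le_k; rewrite (supp_porbit yk).
  by move: nky; rewrite inE negbK => /eqP/porbit_fix-> /set1P->.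
have st y : t y != j -> t y != k -> s y = t y.
  by move=> ? ?; rewrite sE tpermD // eq_sym.
have sk : porbit s k = j |: porbit t k.
  apply/eqP; rewrite eqEsubset; apply/andP; split.
    apply: porbit_sub; last by rewrite !inE porbit_id orbT.
    move=> y; rewrite !in_setU1 sE => /predU1P[->|yk].
      by rewrite tj tpermL porbit_id orbT.
    by case: tpermP => _; rewrite ?porbit_id ?orbT ?eqxx // => _; rewrite porbit_closed ?orbT.
  have jk : j \in porbit s k.
    rewrite porbit_sym; apply/porbitP; exists 1%N.
    by rewrite expg1 sE tj tpermL.
  rewrite subUset sub1set jk /=; apply/subsetP=> y yk.
  suff : porbit t k \subset porbit s k :&: porbit t k by move/subsetP/(_ y yk)/setIP=> [].
  apply: porbit_sub; last by rewrite inE !porbit_id.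
  move=> z /setIP[zs zt]; rewrite inE porbit_closed // andbT.
  have [->|ntk] := eqVneq (t z) k; first exact: porbit_id.
  by rewrite -st ?porbit_closed //; apply: contraNneq nj => <-; apply: porbit_closed.
have [xS|xS] := boolP (x \in j |: porbit t k); last first.
  have -> : x == k = false by apply: contraNF xS => /eqP->; rewrite !inE porbit_id orbT.
  have Ex : porbit s x = porbit t x.
    have pnot y : y \in porbit t x -> (t y != j) && (t y != k).
      move=> xy; rewrite -negb_or; apply: contra xS => /pred2P ty.
      have : t y \in porbit t x by apply: porbit_closed.
      rewrite !inE porbit_sym; case: ty => ->; last by move->; rewrite orbT.
      by rewrite porbit_fix // => /set1P->; rewrite eqxx.
    apply/eqP; rewrite eqEsubset; apply/andP; split.
      apply: porbit_sub; last exact: porbit_id.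
      by move=> y xy; have/andP[? ?] := pnot y xy; rewrite st // porbit_closed.
    suff /subset_trans-> : porbit t x \subset porbit s x :&: porbit t x by rewrite ?subsetIl.
    apply: porbit_sub; last by rewrite inE !porbit_id.
    move=> y /setIP[ys yt]; have/andP[? ?] := pnot y yt.
    by rewrite inE -{1}st // !porbit_closed.
  by rewrite addn0 /expo /orbit_max Ex.
have Esx : porbit s x = porbit s k by apply/eqP; rewrite eq_porbit_mem sk.
have max_sk : orbit_max s k.
  by apply/forall_inP=> y; rewrite sk => /setU1P[->|/le_pk//]; apply: ltnW.
have [->|neq_xk] := eqVneq x k.
  rewrite /expo max_sk; have -> : orbit_max t k by apply/forall_inP.
  by rewrite sk cardsU1 nj /= addn1 prednK // lt0n card_porbit_neq0.
have -> : expo s x = 0%N.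
  rewrite /expo; case: ifP => // max_x; case/eqP: neq_xk.
  by apply: orbit_max_uniq max_x max_sk _; rewrite -eq_porbit_mem Esx.
rewrite addn0 /expo; case: ifP => // max_x.
move: xS; rewrite in_setU1 => /predU1P[->|xk]; first by rewrite porbit_fix ?cards1.
case/eqP: neq_xk; apply: orbit_max_uniq max_x _ xk.
by apply/forall_inP.
Qed.
End CycleMaxima.

Section JucysMurphy.
Variables (F : fieldType) (n : nat).
Local Notation A := (group_algebra F 'S_n).
Implicit Types (s t : 'S_n) (i j k x y : 'I_n) (ks : seq 'I_n).

(** The Jucys-Murphy elements; in particular the first one is zero. *)
Definition jm k : A := \sum_(j < n | (j < k)%N) delta (tperm j k).

Lemma jmE k : jm k = \sum_(j < n | (j < k)%N) delta (tperm j k).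
Proof. by []. Qed.

(** An upper bound for the number of points moved by a product of
    transpositions [(j k)] with [j < k] and [k] running through [ks]: the
    distinct [k], and one further point [j] for each factor. *)
Definition word_support ks := (size ks + size (undup ks))%N.

Lemma word_supportE ks :
  word_support ks = (\sum_k (count_mem k ks + (0 < count_mem k ks)))%N.
Proof.
rewrite big_split /=; congr (_ + _)%N.
  elim: ks => [|k ks IH] /=; first by rewrite big1.
  rewrite big_split /= -IH (bigD1 k) //= eqxx big1 // => i /negPf.
  by rewrite eq_sym => ->.
rewrite -(card_uniqP (undup_uniq ks)) -sum1_card big_mkcond /=.
by apply: eq_bigr => k _; rewrite mem_undup -has_count has_pred1; case: ifP.
Qed.

Lemma word_support_card ks : word_support ks = (size ks + #|[set x in ks]|)%N.
Proof.
rewrite /word_support -(card_uniqP (undup_uniq ks)); congr (_ + _)%N.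
by apply: eq_card => x; rewrite inE mem_undup.
Qed.

Lemma word_expo_support ks s :
  (forall k, count_mem k ks = expo s k) ->
  word_support ks = #|supp s| /\ {subset ks <= supp s}.
Proof.
move=> E; split.
  by rewrite word_supportE card_supp; apply: eq_bigr => k _; rewrite E.
by move=> k; rewrite -has_pred1 has_count E expo_gt0 => /andP[].
Qed.

Lemma word_expo_card ks s :
  (forall k, count_mem k ks = expo s k) ->
  #|supp s :|: [set x in ks]| = word_support ks.
Proof.
move=> /word_expo_support[-> ks_s]; congr #|pred_of_set _|; apply/setUidPl.
by apply/subsetP=> x; rewrite inE => /ks_s.
Qed.

Lemma supp_tperm s j k : supp (s * tperm j k)%g \subset supp s :|: [set j; k].
Proof.
apply/subsetP=> x; rewrite !inE permM; case: (eqVneq (s x) x) => //= ->.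
by apply: contraNT; rewrite negb_or => /andP[xj xk]; rewrite tpermD // eq_sym.
Qed.

(** Multiplying out a product of Jucys-Murphy elements gives products of
    transpositions [(j k)] with [j < k].  At most [word_support ks] points are
    moved or listed in [ks], and equality forces the points [j] to be new each
    time, so that [s] is determined by [expo_insert]. *)
Lemma jm_word_coef ks s :
  sorted leq (map val ks) ->
  (word_support ks <= #|supp s :|: [set x in ks]|)%N ->
  (\prod_(k <- ks) jm k) s = ([forall k, count_mem k ks == expo s k])%:R.
Proof.
elim/last_ind: ks s => [|ks k IH] s.
  move=> _ _; rewrite big_nil ffunE; congr (nat_of_bool _)%:R.
  apply/eqP/forallP=> [-> x|E].
    by rewrite /expo porbit_fix ?perm1 // cards1 if_same.
  have := @word_expo_support [::] s (fun k => eqP (E k)) => -[/esym/eqP].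
  rewrite cards_eq0 => /eqP/setP E0 _; apply/permP=> x; rewrite perm1.
  by have := E0 x; rewrite !inE => /negbFE/eqP.
move=> sorted_ks big_s.
have [/allP le_k srt] : all (fun x : 'I_n => (x <= k)%N) ks /\ sorted leq (map val ks).
  move: sorted_ks; rewrite map_rcons !sorted_pairwise; try exact: leq_trans.
  by rewrite pairwise_rcons all_map => /andP[].
rewrite -cats1 big_cat big_seq1 /=.
set P := \prod_(i <- ks) jm i; rewrite /jm mulr_sumr sum_ffunE.
have new j : P (s * tperm j k)%g != 0 ->
    [/\ j \notin supp (s * tperm j k)%g :|: [set x in ks],
        #|supp (s * tperm j k)%g :|: [set x in ks]| = word_support ks &
        forall x, count_mem x ks = expo (s * tperm j k)%g x].
  { set t := (s * tperm j k)%g; set U := supp t :|: _ => nz.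
  have leU : (#|U| <= word_support ks)%N.
    rewrite leqNgt; apply: contraNN nz => big_t; rewrite IH ?(ltnW big_t) //.
    case: forallP => [E|//].
    by move: big_t; rewrite -/U (word_expo_card (fun x => eqP (E x))) ltnn.
  have sU : supp s :|: [set x in rcons ks k] \subset j |: (k |: U).
    have Es : s = (t * tperm j k)%g by rewrite -mulgA tperm2 mulg1.
    apply/subsetP=> x /setUP[|].
      by rewrite {1}Es => /(subsetP (supp_tperm _ _ _)); rewrite !inE; case/or3P=> ->; rewrite ?orbT.
    by rewrite !inE mem_rcons inE => /orP[] ->; rewrite ?orbT.
  have big_U := leq_trans big_s (subset_leq_card sU); move: big_U; rewrite word_support_card.
  rewrite size_rcons (_ : [set x in rcons ks k] = k |: [set x in ks]); last first.
    by apply/setP=> x; rewrite !inE mem_rcons.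
  move=> big_U.
  have ksU : k \in ks -> k \in U by rewrite !inE => ->; rewrite orbT.
  have [jU cardU] : j \notin U /\ #|U| = word_support ks.
    move: leU big_U ksU; rewrite !cardsU1 inE word_support_card in_setU1.
    by case: (j \in U); case: (j == k); case: (k \in U); case: (k \in ks) => //= + + ksU;
      try (by have := ksU isT); split=> //; lia.
  split=> // x.
  move: nz; rewrite IH ?cardU //.
  by case: forallP => [E _|_]; rewrite ?eqxx //; apply/eqP/E. }
have le_supp t : (forall x, count_mem x ks = expo t x) -> forall y, y \in supp t -> (y <= k)%N.
  move=> E y ty; have [m ym max_m] := orbit_max_ex t y.
  have : (0 < expo t m)%N by rewrite expo_gt0 max_m (supp_porbit ym).
  rewrite -E -has_count has_pred1 => /le_k; apply: leq_trans.
  by move/forall_inP: max_m; apply; rewrite porbit_sym.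
have insert j : (j < k)%N -> P (s * tperm j k)%g != 0 ->
    s j = k /\ forall x, count_mem x (ks ++ [:: k]) = expo s x.
  move=> lt_jk /new[]; set t := (s * tperm j k)%g; rewrite !inE => /norP[/negbNE/eqP tj _] _ E.
  have Es : s = (t * tperm j k)%g by rewrite -mulgA tperm2 mulg1.
  split=> [|x]; first by rewrite Es permM tj tpermL.
  rewrite Es expo_insert //; last exact: le_supp.
  by rewrite count_cat E /= addn0 eq_sym.
have termE j : (P * delta (tperm j k)) s = P (s * tperm j k)%g.
  by rewrite mul_delta tpermV.
under eq_bigr do rewrite termE.
case: forallP => [E|nE]; last first.
  apply: big1 => j lt_jk; apply/eqP/negPn/negP => /(insert _ lt_jk)[_ E].
  by case: nE => x; apply/eqP.
have max_k : orbit_max s k && (k \in supp s).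
  by rewrite -expo_gt0 -(eqP (E k)) count_cat /= eqxx addn1.
have /andP[max_k' sk] := max_k; pose j := (s^-1)%g k.
have sj : s j = k by rewrite permKV.
have neq_jk : j != k by apply: contraTneq sk => Ejk; rewrite inE -{1}Ejk sj eqxx.
have lt_jk : (j < k)%N.
  rewrite ltn_neqAle neq_jk; move/forall_inP: max_k'; apply.
  by rewrite porbit_sym -{1}sj porbit_step.
rewrite (bigD1 j) //= big1 ?addr0; last first.
  move=> i /andP[lt_ik neq_ij]; apply/eqP/negPn/negP => /(insert _ lt_ik)[si _].
  by case/eqP: neq_ij; apply: (@perm_inj _ s); rewrite si sj.
set t := (s * tperm j k)%g.
have tj : t j = j by rewrite permM sj tpermR.
have Es : s = (t * tperm j k)%g by rewrite -mulgA tperm2 mulg1.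
have le_t y : y \in supp t -> (y <= k)%N.
  move=> ty; have : y \in supp s :|: [set j; k] by apply: (subsetP (supp_tperm s j k)).
  case/setUP=> [sy|/set2P[]->//]; last exact: ltnW.
  have [m ym max_m] := orbit_max_ex s y.
  have : (0 < expo s m)%N by rewrite expo_gt0 max_m (supp_porbit ym).
  rewrite -(eqP (E m)) -has_count has_pred1 mem_cat inE => mks.
  have le_mk : (m <= k)%N by case/orP: mks => [/le_k//|/eqP->].
  by apply: leq_trans le_mk; move/forall_inP: max_m; apply; rewrite porbit_sym.
have Et x : count_mem x ks = expo t x.
  move: (eqP (E x)); rewrite Es expo_insert // count_cat /= addn0 eq_sym.
  by move/addIn.
rewrite IH ?(word_expo_card Et) //.
by case: forallP => // -[] x; apply/eqP.
Qed.
End JucysMurphy.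

Section ConjugacyByExponents.
Variable n : nat.
Implicit Types (s t g p : 'S_n).

(** A power of a permutation acts on a cycle through its exponent modulo the
    length of the cycle. *)
Lemma eq_permX s x i j :
  ((s ^+ i)%g x == (s ^+ j)%g x) = (i == j %[mod #|porbit s x|]).
Proof.
set N := #|porbit s x|; have N_gt0 : (0 < N)%N by rewrite lt0n card_porbit_neq0.
have redN k : (s ^+ k)%g x = nth x (traject s x N) (k %% N).
  rewrite nth_traject ?ltn_pmod // permX {1}(divn_eq k N) addnC iterD.
  congr (iter _ _ _); elim: (k %/ N)%N => // m IH.
  by rewrite mulSn iterD IH iter_porbit.
by rewrite !redN nth_uniq ?size_traject ?ltn_pmod ?uniq_traject_porbit.
Qed.

Lemma perm_extend (D : {set 'I_n}) (h : 'I_n -> 'I_n) :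
  {in D &, injective h} -> exists g, {in D, g =1 h}.
Proof.
move=> inj_h; pose e := enum (~: D); pose e' := enum (~: (h @: D)).
have sz : size e = size e'.
  by rewrite -!cardE; apply/(@addnI #|D|); rewrite cardsC -(card_in_imset inj_h) cardsC.
pose g x := if x \in D then h x else nth x e' (index x e).
have gD x : x \notin D -> g x \in ~: (h @: D).
  move=> xD; rewrite /g (negPf xD) -mem_enum mem_nth // -sz index_mem mem_enum.
  by rewrite inE.
have inj_g : injective g.
  move=> x y; case: (boolP (x \in D)) (boolP (y \in D)) => [xD|xD] [yD|yD].
  - by rewrite /g xD yD; apply: inj_h.
  - by move=> E; have := gD _ yD; rewrite -E /g xD inE imset_f.
  - by move=> E; have := gD _ xD; rewrite E /g yD inE imset_f.
  have ie z : z \notin D -> (index z e < size e')%N by rewrite -sz index_mem mem_enum inE.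
  rewrite /g (negPf xD) (negPf yD) (set_nth_default x y) ?ie // => /eqP.
  rewrite nth_uniq ?ie ?enum_uniq // => /eqP E.
  by rewrite -[x](@nth_index _ x _ e) ?E ?nth_index // mem_enum inE.
by exists (perm inj_g) => x xD; rewrite permE /g xD.
Qed.

(** The exponents record the cycle lengths, and permutations with the same
    cycle lengths are conjugate. *)
Lemma expo_conj s t p :
  (forall k, expo t (p k) = expo s k) -> exists g, t = (s ^ g)%g.
Proof.
move=> Ep; pose D := supp s.
have max_p m : m \in D -> orbit_max s m ->
    orbit_max t (p m) /\ #|porbit t (p m)| = #|porbit s m|.
  move=> Dm max_m; have : (0 < expo t (p m))%N by rewrite Ep expo_gt0 max_m.
  rewrite expo_gt0 => /andP[max_pm _]; split=> //.
  move: (Ep m); rewrite /expo max_m max_pm => /(congr1 succn).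
  by rewrite !prednK // lt0n card_porbit_neq0.
have /fin_all_exists[h hP] x : exists y, x \in D -> exists m i,
    [/\ orbit_max s m, m \in D, x = (s ^+ i)%g m & y = (t ^+ i)%g (p m)].
  have [m xm max_m] := orbit_max_ex s x; have /porbitP[i Ei] : x \in porbit s m.
    by rewrite porbit_sym.
  exists ((t ^+ i)%g (p m)) => Dx; exists m, i; split=> //.
  by rewrite /D (supp_porbit xm).
have inj_h : {in D &, injective h}.
  move=> x y /hP[m [i [max_m Dm Ex ->]]] /hP[m' [i' [max_m' Dm' Ey ->]]] E.
  have [[max_pm cm] [max_pm' _]] := (max_p m Dm max_m, max_p m' Dm' max_m').
  have Em : m = m'.
    apply: (@perm_inj _ p); apply: orbit_max_uniq max_pm max_pm' _.
    rewrite -eq_porbit_mem -(porbit_perm t i (p m)) E porbit_perm //.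
  subst m'; apply/eqP; rewrite Ex Ey eq_permX -cm -eq_permX; exact/eqP.
have h_comm : {in D, forall x, h (s x) = t (h x)}.
  move=> x Dx; have Dsx : s x \in D by rewrite /D (supp_porbit (porbit_step s x)).
  have [m [i [max_m Dm Ex ->]]] := hP _ Dx.
  have [m' [i' [max_m' Dm' Ey ->]]] := hP _ Dsx.
  have Em : m = m'.
    apply: orbit_max_uniq max_m max_m' _; rewrite -eq_porbit_mem.
    by rewrite -(porbit_perm s i' m') -Ey -(porbit_perm s i m) -Ex (porbit_perm s 1).
  subst m'; rewrite -permM -expgSr; apply/eqP.
  have [_ cm] := max_p m Dm max_m; rewrite eq_permX cm -eq_permX expgSr permM.
  by rewrite -Ex Ey.
have [g gD] := perm_extend inj_h.
have hD : h @: D = supp t.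
  apply/eqP; rewrite eqEcard; apply/andP; split.
    apply/subsetP=> _ /imsetP[x Dx ->]; rewrite inE -h_comm //.
    move: (Dx); rewrite inE; apply: contraNneq => /inj_h -> //.
    by rewrite /D (supp_porbit (porbit_step s x)).
  rewrite card_in_imset // /D !card_supp (reindex_inj (@perm_inj _ p)) leq_eqVlt.
  by apply/orP; left; apply/eqP; apply: eq_bigr => k _; rewrite Ep.
exists g; apply/permP=> y; rewrite -[y](permKV g); set x := (g^-1)%g y.
rewrite permJ; have [Dx|nDx] := boolP (x \in D).
  by rewrite !gD // ?h_comm // /D (supp_porbit (porbit_step s x)).
have : g x \notin supp t.
  rewrite -hD; apply: contra nDx => /imsetP[z Dz]; rewrite -gD //.
  by move/perm_inj->.
by move: nDx; rewrite !inE !negbK => /eqP-> /eqP->.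
Qed.
End ConjugacyByExponents.

Section SymmetricPolynomials.
Variables (F : fieldType) (n : nat).
Local Notation A := (group_algebra F 'S_n).
Local Notation jm := (@jm F n).
Implicit Types (s t g p : 'S_n) (i j k : 'I_n).

(** Exponents below [n] suffice, as a cycle has at most [n] points. *)
Definition expts := {ffun 'I_n -> 'I_n}.

Definition sympoly (f : {ffun expts -> F}) :=
  forall p (E : expts), f [ffun k => E (p k)] = f E.

Definition jm_monomial (E : expts) : A := \prod_(k <- enum 'I_n) jm k ^+ E k.

Definition jm_eval (f : {ffun expts -> F}) : A := \sum_E f E *: jm_monomial E.

Lemma delta_comm_jm g k :
  g k = k -> (forall i, (g i < k)%N = (i < k)%N) -> GRing.comm (delta g) (jm k).
Proof.
move=> gk ltg; rewrite /GRing.comm /jm mulr_sumr mulr_suml.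
rewrite [LHS](reindex_inj (@perm_inj _ g)) /=.
apply: eq_big => [i|i _]; first by rewrite ltg.
rewrite -!deltaM -{1}gk; congr (delta _); apply/permP=> x; rewrite !permM.
by rewrite (inj_tperm i k x (@perm_inj _ g)).
Qed.

Lemma jm_comm j k : GRing.comm (jm j) (jm k).
Proof.
suff lt_comm (i l : 'I_n) : (i < l)%N -> GRing.comm (jm i) (jm l).
  case: (ltngtP j k) => [/lt_comm//|/lt_comm/commr_sym//|/val_inj->] //.
move=> lt_il; rewrite [jm i]jmE; apply/commr_sym/commr_sum => a lt_ai.
apply/commr_sym/delta_comm_jm => [|b].
  by rewrite tpermD // neq_ltn ?(ltn_trans lt_ai lt_il) ?lt_il.
by case: tpermP => [->|->|//]; rewrite lt_il ?(ltn_trans lt_ai lt_il).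
Qed.

(** Adjacent transpositions and Jucys-Murphy elements satisfy the relations of
    the degenerate affine Hecke algebra. *)
Lemma jm_adjacent i i' : val i' = (val i).+1 ->
  jm i * delta (tperm i i') = delta (tperm i i') * jm i' - 1 /\
  jm i' * delta (tperm i i') = delta (tperm i i') * jm i + 1.
Proof.
move=> Ei'; set s := delta _.
have ss : s * s = 1 by rewrite -deltaM tperm2 delta1.
have lt_ii' : (i < i')%N by rewrite Ei'.
have Es : jm i' = s * jm i * s + s.
  rewrite {1}jmE (bigD1 i) //= addrC; congr (_ + _).
  rewrite jmE mulr_sumr mulr_suml; apply: eq_big => j.
    by rewrite Ei' ltnS ltn_neqAle andbC.
  move=> /andP[]; rewrite Ei' ltnS => le_ji neq_ji.
  rewrite -!deltaM; congr delta.
  rewrite -{1}(tpermV i i') -mulgA -conjgE tpermJ tpermL tpermD //; first by rewrite eq_sym.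
  by rewrite neq_ltn Ei' ltnS le_ji orbT.
split; rewrite {}Es.
  by rewrite mulrDr ss !mulrA ss mul1r addrK.
by rewrite mulrDl ss -(mulrA _ s s) ss mulr1.
Qed.

Lemma adjacent_comm_diag i i' a : val i' = (val i).+1 ->
  GRing.comm (delta (tperm i i')) (jm i ^+ a * jm i' ^+ a).
Proof.
move=> Ei'; have [xs ys] := jm_adjacent Ei'; have xy := jm_comm i i'.
rewrite -exprMn_comm //; apply: commrX; rewrite /GRing.comm.
rewrite -mulrA ys mulrDr mulrA xs mulrBl mulr1 mul1r subrK.
by rewrite -!mulrA xy.
Qed.

(** With [x] and [y] the two Jucys-Murphy elements, [x + y] and [x * y] commute
    with the transposition, hence so do the power sums by the recursion
    [x^(m+2) + y^(m+2) = (x + y) (x^(m+1) + y^(m+1)) - x y (x^m + y^m)]; the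
    monomials in question are a power of [x * y] times a power sum. *)
Lemma adjacent_comm_sym i i' a b : val i' = (val i).+1 ->
  GRing.comm (delta (tperm i i')) (jm i ^+ a * jm i' ^+ b + jm i ^+ b * jm i' ^+ a).
Proof.
move=> Ei'; have [xs ys] := jm_adjacent Ei'; have xy := jm_comm i i'.
set s := delta _ in xs ys *; set x := jm i in xs ys xy *; set y := jm i' in xs ys xy *.
have sD : GRing.comm s (x + y).
  by rewrite /GRing.comm mulrDl mulrDr xs ys addrACA addNr addr0 addrC.
have sM : GRing.comm s (x * y) by have := adjacent_comm_diag 1 Ei'; rewrite !expr1.
have xyn m : GRing.comm s (x ^+ m * y ^+ m).
  exact: adjacent_comm_diag.
have sP m : GRing.comm s (x ^+ m + y ^+ m) /\ GRing.comm s (x ^+ m.+1 + y ^+ m.+1).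
  elim: m => [|m [IH1 IH2]]; first by rewrite !expr0 !expr1; split=> //; apply: commrD; apply: commr1.
  split=> //; have -> : x ^+ m.+2 + y ^+ m.+2 =
      (x + y) * (x ^+ m.+1 + y ^+ m.+1) - x * y * (x ^+ m + y ^+ m).
    have yx : y * x = x * y by rewrite xy.
    have E1 : x * y * x ^+ m = y * x ^+ m.+1 by rewrite exprS mulrA yx.
    have E2 : x * y * y ^+ m = x * y ^+ m.+1 by rewrite exprS mulrA.
    rewrite mulrDl !mulrDr E1 E2 -!exprS.
    by rewrite [y * _ + y ^+ _]addrC addrACA [y * _ + _]addrC addrK.
  by apply: commrB; apply: commrM.
wlog le_ab : a b / (a <= b)%N => [H|].
  by case: (leqP a b) => [/H//|/ltnW/H]; rewrite addrC.
have -> : x ^+ a * y ^+ b + x ^+ b * y ^+ a = x ^+ a * y ^+ a * (x ^+ (b - a) + y ^+ (b - a)).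
  rewrite -{1 2}(subnKC le_ab) !exprD mulrDr addrC !mulrA; congr (_ + _).
  rewrite -!mulrA; congr (_ * _).
  exact/commrX/commr_sym/commrX/commr_sym.
by apply: commrM; [apply: xyn | case: (sP (b - a)%N)].
Qed.

Lemma enum_ord_adjacent i i' : val i' = (val i).+1 -> exists r1 r2,
  enum 'I_n = r1 ++ i :: i' :: r2 /\
  forall k, k \in r1 ++ r2 -> k != i /\ k != i'.
Proof.
move=> Ei'; exists (take i (enum 'I_n)), (drop i'.+1 (enum 'I_n)).
have E : enum 'I_n = take i (enum 'I_n) ++ i :: i' :: drop i'.+1 (enum 'I_n).
  rewrite -{1}(cat_take_drop i (enum 'I_n)); congr (_ ++ _).
  have sz k : (k < n)%N -> (k < size (enum 'I_n))%N by rewrite size_enum_ord.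
  rewrite (drop_nth i) ?sz // nth_ord_enum; congr (_ :: _).
  by rewrite -Ei' (drop_nth i) ?sz // nth_ord_enum.
split=> // k; have := enum_uniq 'I_n; rewrite {1}E.
set r1 := take _ _; set r2 := drop _ _ => U kr.
have : uniq (i :: i' :: r1 ++ r2).
  move: U; congr is_true; apply: perm_uniq.
  by rewrite (perm_catCA r1 [:: i; i'] r2).
rewrite /= inE negb_or => /and3P[/andP[_ ni] ni' _].
by split; [apply: contraNneq ni | apply: contraNneq ni'] => <-.
Qed.

Lemma commZ (x y : A) (c : F) : GRing.comm x y -> GRing.comm x (c *: y).
Proof. by rewrite /GRing.comm -scalerAr -scalerAl => ->. Qed.

(** The other Jucys-Murphy elements commute with the transposition, so pairing
    each exponent vector with the one where the two exponents are swapped leaves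
    sums treated in [adjacent_comm_sym]. *)
Lemma sympoly_adjacent f i i' : sympoly f -> val i' = (val i).+1 ->
  GRing.comm (delta (tperm i i')) (jm_eval f).
Proof.
move=> sym_f Ei'; set g := tperm i i'.
pose sw (E : expts) : expts := [ffun k => E (g k)].
have swK : involutive sw by move=> E; apply/ffunP=> k; rewrite !ffunE tpermK.
have [r1 [r2 [Er r12]]] := enum_ord_adjacent Ei'.
pose G (r : seq 'I_n) (E : expts) : A := \prod_(k <- r) jm k ^+ E k.
have GE E : jm_monomial E = G r1 E * (jm i ^+ E i * jm i' ^+ E i') * G r2 E.
  by rewrite /jm_monomial Er big_cat !big_cons /= !mulrA.
have Gsw r E : {subset r <= r1 ++ r2} -> G r (sw E) = G r E.
  move=> sr; apply: eq_big_seq => k /sr/r12[ki ki'].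
  by rewrite ffunE tpermD // eq_sym.
have commG r E : {subset r <= r1 ++ r2} -> GRing.comm (delta g) (G r E).
  move=> sr; rewrite /G big_seq_cond; apply: commr_prod => k; rewrite andbT => /sr/r12[ki ki'].
  apply/commrX/delta_comm_jm => [|a]; first by rewrite tpermD // eq_sym.
  have ne (x : 'I_n) : k != x -> nat_of_ord k <> x by move=> + /val_inj Ex; rewrite Ex eqxx.
  have Ei'n : nat_of_ord i' = i.+1 := Ei'.
  move: (ne _ ki) (ne _ ki') => nei nei'.
  by rewrite /g; case: tpermP => [->|->|//]; apply/idP/idP; lia.
have s1 : {subset r1 <= r1 ++ r2} by move=> k; rewrite mem_cat => ->.
have s2 : {subset r2 <= r1 ++ r2} by move=> k; rewrite mem_cat => ->; rewrite orbT.
have swi E : (sw E i = E i') * (sw E i' = E i) by rewrite !ffunE tpermL tpermR.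
rewrite /jm_eval (bigID (fun E : expts => (E i < E i')%N)) /=.
rewrite [X in _ + X](bigID (fun E : expts => E i == E i')) /= addrCA.
have -> : \sum_(E : expts | ~~ (E i < E i')%N && (E i != E i')) f E *: jm_monomial E =
    \sum_(E : expts | (E i < E i')%N) f E *: jm_monomial (sw E).
  rewrite (reindex_inj (inv_inj swK)) /=; apply: eq_big => [E|E _].
    by rewrite !swi -leqNgt (ltn_neqAle (E i)) andbC eq_sym -val_eqE.
  by rewrite sym_f.
apply: commrD.
  apply: commr_sum => E /andP[_ /eqP Ei]; apply: commZ; rewrite GE Ei.
  by apply: commrM (commG _ _ s2); apply: commrM (commG _ _ s1) _; apply: adjacent_comm_diag.
rewrite -big_split /=; apply: commr_sum => E _; rewrite -scalerDr; apply: commZ.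
rewrite !GE !swi !Gsw // -mulrDl -mulrDr.
by apply: commrM (commG _ _ s2); apply: commrM (commG _ _ s1) _; apply: adjacent_comm_sym.
Qed.

(** The general transposition reduces to adjacent ones by conjugation, and
    transpositions generate the group. *)
Lemma sympoly_central f : sympoly f -> central (jm_eval f).
Proof.
move=> sym_f; suff comm_t i j : GRing.comm (delta (tperm i j)) (jm_eval f).
  move=> x; rewrite [x]ga_sum mulr_sumr mulr_suml; apply: eq_bigr => g _.
  rewrite -scalerAr -scalerAl; congr (_ *: _); apply/commr_sym.
  have [ts -> _] := prod_tpermP g; elim: ts => [|t ts IH].
    by rewrite big_nil delta1; apply/commr_sym/commr1.
  by rewrite big_cons deltaM; apply/commr_sym/commrM; apply/commr_sym.
wlog lt_ij : i j / (i < j)%N => [H|].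
  case: (ltngtP i j) => [/H//|/H|/val_inj->]; first by rewrite tpermC.
  by rewrite tperm1 delta1; apply/commr_sym/commr1.
move: {-1}(j - i)%N (leqnn (j - i)%N) lt_ij => m; elim: m i j => [|m IH] i j.
  by rewrite leqn0 subn_eq0 leqNgt => /negP.
move=> le_m lt_ij; have lt_i : (i.+1 < n)%N by apply: leq_ltn_trans lt_ij (ltn_ord j).
pose i' := Ordinal lt_i; have [Ej|neq_ji'] := eqVneq (val j) i.+1.
  exact: sympoly_adjacent.
have lt_i'j : (i' < j)%N by rewrite ltn_neqAle eq_sym neq_ji'.
have -> : tperm i j = (tperm i i' * tperm i' j * tperm i i')%g.
  rewrite -{1}(tpermV i i') -mulgA -conjgE tpermJ tpermR tpermD //.
    by rewrite neq_ltn lt_ij.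
  by rewrite neq_ltn lt_i'j.
have ci : GRing.comm (jm_eval f) (delta (tperm i i')) by apply/commr_sym/sympoly_adjacent.
rewrite !deltaM; apply/commr_sym/commrM => //; apply/commrM => //.
by apply/commr_sym/IH => //=; lia.
Qed.

End SymmetricPolynomials.

Section CentreOfSymmetricGroupAlgebra.
Variables (F : fieldType) (n : nat).
Local Notation A := (group_algebra F 'S_n).
Implicit Types (s t g p : 'S_n) (i j k : 'I_n) (E : expts n).

(** This rewrites [jm_word_coef] for the weakly increasing word in which the
    letter [k] occurs [E k] times. *)
Lemma jm_monomial_coef E s :
  (\sum_k (E k + (0 < E k)) <= #|supp s|)%N ->
  jm_monomial F E s = ([forall k, expo s k == E k :> nat])%:R.
Proof.
pose w := flatten [seq nseq (E k) k | k <- enum 'I_n].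
have count_w k : count_mem k w = E k.
  rewrite count_flatten -map_comp sumnE big_map (bigD1_seq k) ?mem_enum ?enum_uniq //=.
  rewrite count_nseq /= eqxx mul1n big1 ?addn0 // => i neq_ik.
  by rewrite count_nseq /= (negPf neq_ik).
have srt : sorted leq (map val w).
  rewrite (sorted_pairwise leq_trans) /w.
  have : pairwise leq (map val (enum 'I_n)).
    by rewrite val_enum_ord -(sorted_pairwise leq_trans) iota_sorted.
  elim: (enum 'I_n) => //= k r IHr /andP[/allP le_k /IHr]; rewrite map_cat pairwise_cat => ->.
  rewrite andbT map_nseq; apply/andP; split; last first.
    by elim: (nat_of_ord (E k)) => //= m ->; rewrite andbT; apply/allP=> x /nseqP[->].
  apply/allrelP=> x y /nseqP[-> _] /mapP[l /flattenP[_ /mapP[l' rl' ->] /nseqP[-> _]] ->].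
  by apply: le_k; apply: map_f.
have wE : word_support w = (\sum_k (E k + (0 < E k)))%N.
  by rewrite word_supportE; apply: eq_bigr => k _; rewrite count_w.
rewrite -wE => le_w; have -> : jm_monomial F E = \prod_(k <- w) jm F k.
  rewrite /jm_monomial /w big_flatten big_map; apply: eq_bigr => k _.
  by rewrite big_nseq; elim: (nat_of_ord (E k)) => //= m <-; rewrite exprS.
rewrite jm_word_coef //; last exact/(leq_trans le_w)/subset_leq_card/subsetUl.
by congr (nat_of_bool _)%:R; apply: eq_forallb => k; rewrite count_w eq_sym.
Qed.

Lemma expo_ltn s k : (expo s k < n)%N.
Proof.
rewrite /expo; case: ifP => _; last exact: leq_ltn_trans (leq0n k) (ltn_ord k).
by rewrite prednK ?lt0n ?card_porbit_neq0 // -[X in (_ <= X)%N](card_ord n) max_card.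
Qed.

(** The class function [z] is recovered from its values on permutations with
    the largest number of moved points, where only the monomial recording the
    cycle lengths contributes; the remainder moves fewer points. *)
Theorem centre_jm (z : A) : central z -> exists2 f, sympoly f & z = jm_eval f.
Proof.
have [m] : exists m, forall s, z s != 0 -> (#|supp s| < m)%N.
  by exists n.+1 => s _; rewrite ltnS -[X in (_ <= X)%N](card_ord n) max_card.
elim: m z => [|m IH] z small_z cz.
  exists 0; first by move=> p E; rewrite !ffunE.
  rewrite /jm_eval big1 => [|E _]; last by rewrite ffunE scale0r.
  by apply/ffunP=> s; rewrite ffunE; apply/eqP/negPn/negP => /small_z.
pose same E s := (#|supp s| == m) &&
  [exists p : 'S_n, [forall k, expo s (p k) == E k :> nat]].
pose f : {ffun expts n -> F} :=
  [ffun E => if [pick s | same E s] is Some s then z s else 0].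
have sym_f : sympoly f.
  move=> p E; rewrite !ffunE; congr (if _ is Some s then _ else _).
  apply: eq_pick => s; congr (_ && _); apply/existsP/existsP => -[q /forallP qE].
    exists (p^-1 * q)%g; apply/forallP=> k; move: (qE (p^-1 k)%g).
    by rewrite ffunE permKV permM.
  by exists (p * q)%g; apply/forallP=> k; rewrite ffunE permM; apply: qE.
have [||g sym_g Eg] := IH (z - jm_eval f).
- move=> s; rewrite ltn_neqAle; apply: contraNT; rewrite negb_and negbK -ltnNge => big_s.
  have {big_s} le_ms : (m <= #|supp s|)%N by case/orP: big_s => [/eqP->|/ltnW].
  pose Es : expts n := [ffun k => Ordinal (expo_ltn s k)].
  have termE E : f E * jm_monomial F E s = f E * (E == Es)%:R.
    rewrite ffunE; case: pickP => [t /andP[/eqP st /existsP[p /forallP Ep]]|_]; last by rewrite !mul0r.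
    rewrite jm_monomial_coef.
      congr (_ * (nat_of_bool _)%:R); apply/forallP/eqP => [sE|-> k]; last by rewrite ffunE.
      by apply/ffunP=> k; rewrite ffunE; apply/val_inj/esym/eqP/sE.
    suff <- : #|supp t| = (\sum_k (E k + (0 < E k)))%N by rewrite st.
    rewrite card_supp (reindex_inj (@perm_inj _ p)); apply: eq_bigr => k _.
    by rewrite (eqP (Ep k)).
  have fs : jm_eval f s = f Es.
    rewrite sum_ffunE (bigD1 Es) //= big1 => [|E neE]; rewrite ga_scaleE termE.
      by rewrite eqxx mulr1 addr0.
    by rewrite (negPf neE) mulr0.
  rewrite !ffunE fs ffunE subr_eq0; case: pickP => [t /andP[/eqP st /existsP[p /forallP Ep]]|no_t].
    have [|h ->] := @expo_conj n t s p^-1; last by rewrite (proj1 (centralP z) cz).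
    by move=> k; apply/esym; rewrite -{1}(permKV p k) (eqP (Ep _)) ffunE.
  apply: contraFT (no_t s) => zs; rewrite /same eqn_leq le_ms -ltnS small_z // andbT.
  by apply/existsP; exists 1%g; apply/forallP=> k; rewrite perm1 ffunE.
- move=> x; rewrite mulrBl mulrBr cz; congr (_ - _); exact: sympoly_central.
exists (f + g); first by move=> p E; rewrite !ffunE; congr (_ + _); [have := sym_f p E; rewrite !ffunE | apply: sym_g].
have -> : jm_eval (f + g) = jm_eval f + jm_eval g.
  by rewrite /jm_eval -big_split; apply: eq_bigr => E _; rewrite ffunE scalerDl.
by rewrite -Eg addrC subrK.
Qed.
End CentreOfSymmetricGroupAlgebra.

(** * Simultaneous eigenvectors of the Jucys-Murphy elements *)

Section SymmetricEvaluation.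
Variables (F : fieldType) (n : nat) (V : lmodType F).
Variable r : right_action 'S_n V.

Definition weight_vector (a : 'I_n -> F) (v : V) :=
  forall k, ract_ga r (jm F k) v = a k *: v.

Definition poly_eval (f : {ffun expts n -> F}) (a : 'I_n -> F) : F :=
  \sum_E f E * \prod_k a k ^+ E k.

Lemma weight_jm_eval a v f :
  weight_vector a v -> ract_ga r (jm_eval f) v = poly_eval f a *: v.
Proof.
move=> av; rewrite /jm_eval ract_ga_sum scaler_suml; apply: eq_bigr => E _.
rewrite ract_gaZ -scalerA; congr (_ *: _).
rewrite [in RHS](perm_big (enum 'I_n)) /=; last first.
  by apply: uniq_perm; rewrite ?index_enum_uniq ?enum_uniq // => k; rewrite mem_enum mem_index_enum.
rewrite /jm_monomial; elim: (enum 'I_n) => [|k s IH].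
  by rewrite !big_nil scale1r ract_ga1.
rewrite !big_cons ract_gaM mulrC -scalerA.
have -> : ract_ga r (jm F k ^+ E k) v = a k ^+ E k *: v.
  elim: (nat_of_ord (E k)) => [|m IHm]; first by rewrite !expr0 ract_ga1 scale1r.
  by rewrite exprS ract_gaM av linearZ /= IHm scalerA exprS.
by rewrite linearZ /= IH scalerA mulrC -scalerA.
Qed.

End SymmetricEvaluation.

Lemma poly_eval_sym (F : fieldType) n (f : {ffun expts n -> F}) (a b : 'I_n -> F) :
  sympoly f -> perm_eq (codom a) (codom b) -> poly_eval f a = poly_eval f b.
Proof.
move=> sym_f ab; have [p Ep] : exists p : 'S_n, a =1 b \o p.
  have /tuple_permP[p Ep] : perm_eq [tuple a i | i < n] [tuple b i | i < n] := ab.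
  exists p => i; move/val_inj: Ep => /(congr1 (fun t => tnth t i)).
  by rewrite !tnth_mktuple.
rewrite /poly_eval [RHS](reindex_inj (h := fun E : expts n => [ffun k => E (p^-1 k)%g])) /=.
  apply: eq_bigr => E _; rewrite sym_f; congr (_ * _).
  rewrite [RHS](reindex_inj (@perm_inj _ p)); apply: eq_bigr => k _.
  by rewrite ffunE permK Ep.
move=> E E' /ffunP EE'; apply/ffunP=> k; move: (EE' (p k)).
by rewrite !ffunE permK.
Qed.

Section Antisymmetric.
Variables (F : fieldType) (n : nat) (V : lmodType F).
Variable r : right_action 'S_n V.
Implicit Types (c : {ffun 'I_n -> 'I_n}) (i j k D : 'I_n) (v w : V).

(** A vector of this kind behaves like the polytabloid of a filling with point
    [i] in column [c i]. *)
Definition antisym c v := forall i j, i != j -> c i = c j -> r (tperm i j) v = - v.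

Definition colsize c D := #|[set x | c x == D]|.

Definition move_to c k D : {ffun 'I_n -> 'I_n} :=
  [ffun x => if x == k then D else c x].

(** The signed sum over coset representatives of the symmetric group of column
    [D] in that of column [D] with [k] adjoined. *)
Definition garnir c k D v := v - \sum_(j | c j == D) r (tperm j k) v.

Lemma antisym_garnir c k D v :
  antisym c v -> c k != D -> antisym (move_to c k D) (garnir c k D v).
Proof.
move=> av ckD.
have nkD j : c j == D -> j != k by move=> /eqP cj; apply: contraNneq ckD => <-; apply/eqP.
have main i l : i != l -> l != k -> move_to c k D i = move_to c k D l ->
    r (tperm i l) (garnir c k D v) = - garnir c k D v.
  move=> il lk; rewrite !ffunE (negPf lk); have [Eik /esym/eqP cl|ik cil] := eqVneq i k.
    rewrite {i}Eik in il *; rewrite /garnir linearB linear_sum /=.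
    rewrite (bigD1 l) ?cl //= [in RHS](bigD1 l) ?cl //= -ractM (tpermC k l) tperm2 ract1.
    have -> : \sum_(i | (c i == D) && (i != l)) r (tperm l k) (r (tperm i k) v) =
        - \sum_(i | (c i == D) && (i != l)) r (tperm i k) v.
      rewrite -sumrN; apply: eq_bigr => i /andP[ci il'].
      rewrite -ractM conjgCV tpermV tpermJ tpermR tpermD ?(eq_sym k) ?nkD // 1?eq_sym //.
      by rewrite ractM (av l i) ?linearN 1?eq_sym // (eqP cl) (eqP ci).
    by rewrite !opprB addrA.
  have cperm j : c (tperm i l j) = c j by case: tpermP => [->|->|//].
  rewrite /garnir linearB /= av // linear_sum opprB [RHS]addrC; congr (_ + _).
  rewrite -sumrN [LHS](reindex_inj (@perm_inj _ (tperm i l))) /=.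
  apply: eq_big => [j|j _]; first by rewrite cperm.
  by rewrite -ractM conjgC tpermJ tpermK tpermD // ractM (av i l) // linearN opprK.
move=> i l il; have [lk|lk] := eqVneq l k; last exact: main.
rewrite {l}lk in il *; move=> E; rewrite tpermC; apply: main; rewrite // eq_sym //.
Qed.

(** The quantity that increases when a point moves to a column at least as
    long as its own. *)
Definition square_sum c := (\sum_D colsize c D ^ 2)%N.

Lemma square_sum_move c k D :
  c k != D -> (colsize c (c k) <= colsize c D)%N ->
  (square_sum c < square_sum (move_to c k D))%N.
Proof.
move=> ckD le_kD; rewrite /square_sum.
rewrite (bigD1 D) // [X in (_ < X)%N](bigD1 D) //= (bigD1 (c k)) //=.
rewrite [X in (_ < _ + X)%N](bigD1 (c k)) //=.
have -> : colsize (move_to c k D) D = (colsize c D).+1.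
  rewrite /colsize [RHS](_ : _ = #|k |: [set x | c x == D]|); last by rewrite cardsU1 inE ckD.
  by apply: eq_card => x; rewrite !inE !ffunE; case: (eqVneq x k) => //= _; rewrite eqxx.
have Eck : colsize c (c k) = (colsize (move_to c k D) (c k)).+1.
  rewrite /colsize (cardsD1 k) inE eqxx add1n; congr _.+1; apply: eq_card => x.
  by rewrite !inE !ffunE; case: (eqVneq x k) => //= _; rewrite eq_sym (negPf ckD).
have -> : (\sum_(i < n | (i != D) && (i != c k)) colsize (move_to c k D) i ^ 2 =
           \sum_(i < n | (i != D) && (i != c k)) colsize c i ^ 2)%N.
  apply: eq_bigr => i /andP[iD ik]; congr (_ ^ _)%N; apply: eq_card => x.
  rewrite !inE ffunE; case: (eqVneq x k) => // ->.
  by rewrite [RHS]eq_sym (negPf ik) eq_sym (negPf iD).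
rewrite Eck in le_kD *; move: le_kD.
move: (colsize (move_to _ _ _) _) (colsize c D) (\sum_(_ < n | _) _)%N => a b m; nia.
Qed.

(** Columns are intervals of points, and their sizes weakly decrease. *)
Definition sorted_columns c := forall i j, (i <= j)%N -> c i != c j ->
  (colsize c (c j) <= colsize c (c i))%N /\ forall l, c l = c i -> (l < j)%N.

(** In the diagram with columns as prescribed by [sorted_columns], this is the
    content of the node of [k]: the number of columns to its left minus the
    number of nodes above it. *)
Definition content_weight c k : F :=
  #|[set c j | j : 'I_n in [pred j : 'I_n | (j < k)%N && (c j != c k)]]|%:R
  - #|[set j : 'I_n | (j < k)%N && (c j == c k)]|%:R.

(** Among the transpositions of [k] with an earlier point, those within the
    column of [k] contribute -1 each by antisymmetry, and those with the points
    of one earlier column, which is full and at least as long, add up to the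
    identity by the Garnir relation. *)
Lemma weight_of_garnir c v : sorted_columns c -> antisym c v ->
  (forall k D, c k != D -> (colsize c (c k) <= colsize c D)%N -> garnir c k D v = 0) ->
  weight_vector r (content_weight c) v.
Proof.
move=> sc av gv k; rewrite /jm ract_ga_sum.
under eq_bigr do rewrite ract_delta.
rewrite (bigID (fun j => c j == c k)) /= addrC scalerBl; congr (_ + _).
  pose S := [set c j | j : 'I_n in [pred j : 'I_n | (j < k)%N && (c j != c k)]].
  rewrite (partition_big c (mem S)) /=; last by move=> j jk; apply/imsetP; exists j.
  transitivity (\sum_(D in S) v); last by rewrite sumr_const scaler_nat.
  apply: eq_bigr => D /imsetP[i]; rewrite inE => /andP[lt_ik cik] ED.
  have [le_ki cols] := sc i k (ltnW lt_ik) cik.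
  have Dk : c k != D by rewrite ED eq_sym.
  have := gv k D Dk; rewrite ED => /(_ le_ki)/subr0_eq; rewrite -ED => {2}->.
  apply: eq_bigl => j; apply/andP/idP => [[]//|cj]; rewrite cj (eqP cj) eq_sym Dk.
  by rewrite cols // -ED; apply/eqP.
rewrite scaler_nat -mulNrn -sumr_const; apply: eq_big => [j|j /andP[lt_jk /eqP cj]].
  by rewrite inE.
by apply: av => //; rewrite neq_ltn lt_jk.
Qed.

Lemma sort_columns c : exists p : 'S_n, sorted_columns [ffun k => c (p k)].
Proof.
have [n0|n_gt0] := posnP n; first by exists 1%g => -[i lt_i]; case: notF; rewrite n0 in lt_i.
pose x0 := Ordinal n_gt0.
(* Sorting by this key puts longer columns first and keeps the points of one
   column together. *)
pose key (x : 'I_n) := ((n - colsize c (c x)) * n + c x)%N.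
pose le_key := relpre key leq; pose s := sort le_key (enum 'I_n).
have sz : size s = n by rewrite size_sort size_enum_ord.
have Us : uniq s by rewrite sort_uniq enum_uniq.
have inj_p : injective (fun k : 'I_n => nth x0 s k).
  by move=> i j /eqP; rewrite nth_uniq ?sz // => /eqP/val_inj.
pose p := perm inj_p; exists p; set c' := finfun _.
have c'E k : c' k = c (p k) by rewrite ffunE.
have csz D : colsize c' D = colsize c D.
  rewrite /colsize -(card_imset _ (@perm_inj _ p)); apply: eq_card => x.
  rewrite inE; apply/imsetP/idP => [[y]|cx]; first by rewrite inE c'E => ? ->.
  by exists (p^-1 x)%g; rewrite ?permKV // inE c'E permKV.
have key_le i j : (i <= j)%N -> (key (p i) <= key (p j))%N.
  move=> le_ij; rewrite !permE; have tr : transitive le_key by move=> x y z; apply: leq_trans.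
  have srt : sorted le_key s by apply: sort_sorted => x y; apply: leq_total.
  have := sorted_leq_nth tr (fun x => leqnn _) x0 srt.
  by move/(_ i j); rewrite !inE sz; apply.
have key_inj x y : key x = key y -> c x = c y.
  move=> /(congr1 (modn^~ n)); rewrite /key !modnMDl !modn_small ?ltn_ord //.
  exact: val_inj.
move=> i j le_ij neq_c; have le_k := key_le _ _ le_ij; split.
  rewrite !csz !c'E; move: le_k; rewrite /key.
  move/(leq_div2r n); rewrite !divnMDl // !divn_small ?ltn_ord // !addn0.
  have szle x : (colsize c x <= n)%N by rewrite -[X in (_ <= X)%N](card_ord n) max_card.
  by have := szle (c (p i)); have := szle (c (p j)); lia.
move=> l cl; rewrite ltnNge; apply/negP => /key_le le_jl; case/eqP: neq_c.
rewrite c'E [in RHS]c'E; apply: key_inj; apply/eqP; rewrite eqn_leq le_k /=.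
by apply: leq_trans le_jl _; rewrite /key -!c'E cl.
Qed.

(** Among the nonzero column-antisymmetric vectors one with maximal sum of
    squares of column sizes is annihilated by the Garnir elements, as these
    would produce an antisymmetric vector with a larger column. *)
Lemma antisym_weight_ex (P : V -> Prop) :
  (forall a u v, P u -> P v -> P (a *: u + v)) -> (forall g v, P v -> P (r g v)) ->
  (exists2 v, P v & v != 0) ->
  exists c, [/\ sorted_columns c, exists2 v, P v /\ antisym c v & v != 0 &
    forall v, P v -> antisym c v -> weight_vector r (content_weight c) v].
Proof.
move=> Plin Pr [v0 Pv0 nz0].
have P0 : P 0 by have := Plin (-1) v0 v0 Pv0 Pv0; rewrite scaleN1r addNr.
pose good c := exists2 v, P v /\ antisym c v & v != 0.
have [c gc max_c] : exists2 c, good c & forall c', (square_sum c < square_sum c')%N -> ~ good c'.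
  have : exists c, good c.
    exists [ffun k => k]; exists v0 => //; split=> // i j ij.
    by rewrite !ffunE => Eij; rewrite Eij eqxx in ij.
  case=> c gc; pose B := (\max_(c : {ffun 'I_n -> 'I_n}) square_sum c)%N.
  move: {-1}(B - square_sum c)%N (leqnn (B - square_sum c)%N) gc => m.
  elim: m c => [|m IH] c le_m gc.
    exists c => // c' lt_c _; have : (square_sum c' <= B)%N by apply: leq_bigmax_cond.
    by lia.
  have [[c' [lt_c gc']]|no_c] := Classical_Prop.classic (exists c', (square_sum c < square_sum c')%N /\ good c').
    by apply: IH gc'; have : (square_sum c' <= B)%N by [apply: leq_bigmax_cond]; lia.
  by exists c => // c' lt_c gc'; apply: no_c; exists c'.
have [p sp] := sort_columns c; set cp := finfun _ in sp.
have csz D : colsize cp D = colsize c D.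
  rewrite /colsize -(card_imset _ (@perm_inj _ p)); apply: eq_card => x.
  rewrite inE; apply/imsetP/idP => [[y]|cx]; first by rewrite inE ffunE => ? ->.
  by exists (p^-1 x)%g; rewrite ?permKV // inE ffunE permKV.
have ssz : square_sum cp = square_sum c by apply: eq_bigr => D _; rewrite csz.
exists cp; split=> //.
  case: gc => v [Pv av] nz; exists (r p^-1 v)%g; last first.
    by apply: contraNneq nz => E; rewrite -(ract1 r v) -(mulVg p) ractM E linear0.
  split=> [|i j ij]; first exact: Pr.
  rewrite !ffunE => Eij; rewrite -ractM conjgCV invgK tpermJ ractM av ?linearN //.
  by rewrite (inj_eq (@perm_inj _ p)).
move=> v Pv av; apply: weight_of_garnir => // k D ckD le_kD; apply/eqP/negPn/negP => nz.
apply: (max_c (move_to cp k D)); first by rewrite -ssz square_sum_move.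
exists (garnir cp k D v) => //; split; last exact: antisym_garnir.
rewrite /garnir -scaleN1r addrC; apply: (Plin _ _ _ _ Pv).
apply: (big_ind P) => // [x y Px Py|j _]; last exact: Pr.
by rewrite -[x]scale1r; apply: Plin.
Qed.
End Antisymmetric.

(** * Residues and cores of partitions *)

Notation part la i := (nth 0%N la i).

Lemma part_anti la : is_partition la -> forall i j, (i <= j)%N -> (part la j <= part la i)%N.
Proof.
case/andP=> srt _ i j le_ij; have [lt_j|le_j] := ltnP j (size la); last by rewrite nth_default.
have tr : transitive geq by move=> x y z le1 le2; apply: leq_trans le2 le1.
have := sorted_leq_nth tr (fun x => leqnn x) 0%N srt.
by move/(_ i j); rewrite !inE lt_j (leq_ltn_trans le_ij lt_j); apply.
Qed.

Lemma partition_ext la mu : is_partition la -> is_partition mu ->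
  (forall i, part la i = part mu i) -> la = mu.
Proof.
have le_size s t : is_partition s -> (forall i, part s i = part t i) -> (size s <= size t)%N.
  move=> /andP[_ s0] E; rewrite leqNgt; apply: contra s0 => lt_ts.
  by rewrite -(nth_default 0%N (leqnn (size t))) -E mem_nth.
move=> pl pm E; apply: (@eq_from_nth _ 0%N) => //.
by apply/eqP; rewrite eqn_leq !le_size // => i; rewrite E.
Qed.

(** The partition with parts [f 0, ..., f (N - 1)], for decreasing [f]. *)
Definition mkpart (f : nat -> nat) N := [seq x <- mkseq f N | x != 0%N].

Section MkPart.
Variables (f : nat -> nat) (N : nat).
Hypothesis f_anti : forall i, (f i.+1 <= f i)%N.

Lemma mkpart_partition : is_partition (mkpart f N).
Proof.
rewrite /is_partition mem_filter eqxx andbT.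
have tr : transitive geq by move=> x y z le1 le2; apply: leq_trans le2 le1.
apply: sorted_filter => //; rewrite /mkseq sorted_map.
by elim: N 0%N => [|[|m] IH] k //=; rewrite f_anti; apply: (IH k.+1).
Qed.

Lemma sumn_mkpart : sumn (mkpart f N) = (\sum_(i < N) f i)%N.
Proof.
transitivity (sumn (mkseq f N)); last by rewrite sumnE big_map -(big_mkord xpredT) /index_iota subn0.
by rewrite /mkpart; elim: (mkseq f N) => //= x s IH; case: eqVneq => [->|_] /=; rewrite IH.
Qed.

Hypothesis f0 : forall i, (N <= i)%N -> f i = 0%N.

Lemma part_mkpart i : part (mkpart f N) i = f i.
Proof.
have E : part (mkseq f N) i = f i.
  by have [lt_i|le_i] := ltnP i N; [rewrite nth_mkseq | rewrite nth_default ?size_mkseq ?f0].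
suff gen m k j : part [seq x <- map f (iota k m) | x != 0%N] j = part (map f (iota k m)) j.
  by rewrite -{}E; apply: gen.
elim: m k j => //= m IH k {E}i.
case: eqVneq => [fk|nz] /=; last by case: i => //= i; apply: IH.
have z l : (k <= l)%N -> f l = 0%N.
  move=> /subnK <-; elim: (l - k)%N => // d IHd; apply/eqP; rewrite -leqn0.
  by rewrite addSn -IHd f_anti.
have -> : [seq x <- [seq f i | i <- iota k.+1 m] | x != 0%N] = [::].
  apply/eqP; rewrite -size_eq0 size_filter -leqn0 leqNgt -has_count; apply/hasPn => x /mapP[l].
  by rewrite mem_iota => /andP[lt_kl _] ->; rewrite z // ltnW.
rewrite nth_nil; case: i => //= i; have [lt_i|le_i] := ltnP i m.
  by rewrite (nth_map 0%N) ?size_iota // nth_iota // z //; lia.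
by rewrite nth_default // size_map size_iota.
Qed.
End MkPart.

Definition nodes la := [seq (i, j) | i <- iota 0 (size la), j <- iota 0 (part la i)].

Lemma mem_nodes la x : (x \in nodes la) = in_diagram la x.
Proof.
case: x => i j; apply/allpairsPdep/idP => [[a [b [_ + [-> ->]]]]|lt_j].
  by rewrite mem_iota.
exists i, j; rewrite !mem_iota; split=> //=.
by rewrite ltnNge; apply/negP => le_i; rewrite /in_diagram /= nth_default in lt_j.
Qed.

Lemma nodes_uniq la : uniq (nodes la).
Proof.
apply: allpairs_uniq_dep => [|i _|]; rewrite ?iota_uniq //.
by move=> [i j] [i' j'] _ _ /= [-> ->].
Qed.

Lemma size_nodes la : size (nodes la) = sumn la.
Proof.
rewrite size_allpairs_dep; congr sumn; rewrite -[RHS](mkseq_nth 0%N).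
by apply: eq_map => i; rewrite size_iota.
Qed.

Section Residues.
Variables (F : fieldType) (p : nat).
Hypothesis charFp : p \in [pchar F].

Definition content (x : nat * nat) : F := x.2%:R - x.1%:R.

Definition residues la : seq F := [seq content x | x <- nodes la].

Definition prime_field : seq F := [seq i%:R | i <- iota 0 p].

Let p_gt0 : (0 < p)%N. Proof. exact/prime_gt0/(pcharf_prime charFp). Qed.

Lemma natr_eq_mod a b : (a%:R == b%:R :> F) = (a == b %[mod p]).
Proof.
wlog le_ab : a b / (a <= b)%N => [H|].
  by case: (leqP a b) => [/H//|/ltnW/H]; rewrite eq_sym => ->; rewrite eq_sym.
rewrite eq_sym -subr_eq0 -natrB // -(dvdn_pcharf charFp).
by rewrite eq_sym (eqn_mod_dvd p le_ab).
Qed.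

Lemma prime_field_uniq : uniq prime_field.
Proof.
rewrite map_inj_in_uniq ?iota_uniq // => a b; rewrite !mem_iota /= => lt_a lt_b /eqP.
by rewrite natr_eq_mod !modn_small // => /eqP.
Qed.

Lemma mem_prime_field a : a%:R \in prime_field.
Proof.
have -> : a%:R = (a %% p)%:R :> F by apply/eqP; rewrite natr_eq_mod modn_mod.
by apply: map_f; rewrite mem_iota ltn_mod.
Qed.

Lemma perm_prime_field (t : seq F) :
  uniq t -> size t = p -> (forall x, x \in t -> exists a, x = a%:R) ->
  perm_eq t prime_field.
Proof.
move=> Ut szt tP; apply: uniq_perm => //; first exact: prime_field_uniq.
have sub_t : {subset t <= prime_field} by move=> x /tP[a ->]; apply: mem_prime_field.
by have [|//] := uniq_min_size Ut sub_t; rewrite size_map size_iota szt.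
Qed.

(** Negative contents are covered since [p - 1] represents -1. *)
Lemma content_nat x : exists a, content x = a%:R.
Proof.
exists (x.2 + p.-1 * x.1)%N; rewrite /content natrD natrM.
have -> : p.-1%:R = -1 :> F.
  by rewrite -subn1 natrB // (pcharf0 charFp) sub0r.
by rewrite mulN1r.
Qed.

(** The contents of a connected rim strip of length [p] are [p] consecutive
    integers, hence represent every residue once. *)
Lemma strip_contents s : sorted rim_step s -> size s = p ->
  uniq s /\ perm_eq [seq content x | x <- s] prime_field.
Proof.
move=> srt szs; have Us : uniq s.
  pose lt (x y : nat * nat) := (x.1 + y.2 < y.1 + x.2)%N.
  apply: (@sorted_uniq _ lt) => [x y z|x|]; rewrite /lt; try lia.
  by apply: sub_sorted srt => -[a b] [c d] /orP[/eqP[-> ->]|/eqP[-> ->]] /=; lia.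
split=> //; have Es : [seq content x | x <- s] = [seq content (head (0, 0)%N s) - i%:R | i <- iota 0 p].
  rewrite -szs; case: s srt {szs Us} => //= x s xs; rewrite subr0; congr (_ :: _).
  rewrite (iotaDl 1 0) -map_comp; elim: s x xs => //= y s IH x /andP[xy ys].
  have -> : content y = content x - 1.
    by case/orP: xy => /eqP->; rewrite /content /= mulrS; ring.
  congr (_ :: _); rewrite (iotaDl 1 0) -map_comp (IH y ys).
  apply: eq_map => i /=; rewrite /comp /=.
  have -> : content y = content x - 1.
    by case/orP: xy => /eqP->; rewrite /content /= mulrS; ring.
  by rewrite !natrD; ring.
apply: perm_prime_field => [||_ /mapP[x _ ->]]; [|by rewrite size_map|exact: content_nat].
rewrite Es map_inj_in_uniq ?iota_uniq // => a b; rewrite !mem_iota /= => lt_a lt_b.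
by move/addrI/oppr_inj/eqP; rewrite natr_eq_mod !modn_small // => /eqP.
Qed.

(** A removed rim hook contributes each residue once by [strip_contents]. *)
Lemma rim_hook_residues la mu : removes_rim_hook p la mu ->
  perm_eq (residues la) (residues mu ++ prime_field).
Proof.
case=> _ [s [szs srt /allP rim_s Emu]]; have [Us Hs] := strip_contents srt szs.
suff perm_n : perm_eq (nodes la) (nodes mu ++ s).
  by rewrite (perm_trans (perm_map content perm_n)) // map_cat perm_cat2l.
apply: uniq_perm; rewrite ?nodes_uniq //.
  rewrite cat_uniq nodes_uniq Us andbT /=; apply/hasPn => x xs.
  by rewrite mem_nodes Emu xs andbF.
move=> x; rewrite mem_cat !mem_nodes Emu; have [xs|] := boolP (x \in s); last by rewrite andbT orbF.
by have /andP[->] := rim_s x xs; rewrite orbT.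
Qed.

End Residues.

(** The nodes of row [i] in columns [lo + d - 1, ..., lo]. *)
Fixpoint row_strip (i lo d : nat) : seq (nat * nat) :=
  if d is d'.+1 then (i, (lo + d')%N) :: row_strip i lo d' else [::].

(** The rim of the rows [i, ..., i + m] of [la], ending in column [e]. *)
Fixpoint rim_strip la (i m e : nat) : seq (nat * nat) :=
  if m is m'.+1 then
    row_strip i (part la i.+1).-1 (part la i - (part la i.+1).-1) ++ rim_strip la i.+1 m' e
  else row_strip i e (part la i - e).

Lemma size_row_strip i lo d : size (row_strip i lo d) = d.
Proof. by elim: d => //= d ->. Qed.

Lemma mem_row_strip i lo d x :
  (x \in row_strip i lo d) = [&& x.1 == i, (lo <= x.2)%N & (x.2 < lo + d)%N].
Proof.
elim: d => [|d IH] /=; first by rewrite in_nil addn0; case: leqP; rewrite ?andbF.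
by rewrite inE IH; case: x {IH} => a b; rewrite xpair_eqE /=; case: (a == i) => //=; lia.
Qed.

Lemma path_row_strip i lo d x : rim_step x (i, (lo + d)%N) ->
  path rim_step x (row_strip i lo d.+1) && (last x (row_strip i lo d.+1) == (i, lo)).
Proof.
elim: d x => [|d IH] x xi; first by move: xi; rewrite /= addn0 andbT => ->; rewrite eqxx.
have := IH (i, (lo + d.+1)%N); rewrite /= xi /=; apply.
by rewrite /rim_step /= addnS eqxx orbT.
Qed.

Section Strip.
Variables (la : seq nat) (e : nat).
Hypothesis part_la : is_partition la.

Lemma size_rim_strip i m : (0 < part la (i + m))%N -> (e < part la (i + m))%N ->
  size (rim_strip la i m e) = (part la i + m - e)%N.
Proof.
elim: m i => [|m IH] i /=; first by rewrite addn0 size_row_strip addn0.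
rewrite -addSnnS => gt0 lt_e; rewrite size_cat size_row_strip IH //.
have := part_anti part_la (leqnSn i); have := part_anti part_la (leq_addr m i.+1).
lia.
Qed.

Lemma path_rim_strip i m x : (0 < part la (i + m))%N -> (e < part la (i + m))%N ->
  rim_step x (i, (part la i).-1) -> path rim_step x (rim_strip la i m e).
Proof.
elim: m i x => [|m IH] i x /=.
  rewrite addn0 => gt0 lt_e xi.
  have [|+ _] := andP (@path_row_strip i e (part la i - e).-1 x _).
    by rewrite (_ : e + _ = (part la i).-1)%N //; lia.
  by rewrite prednK // subn_gt0.
rewrite -addSnnS => gt0 lt_e xi; rewrite cat_path.
have le1 := part_anti part_la (leqnSn i); have le2 := part_anti part_la (leq_addr m i.+1).
set d := (part la i - _)%N; have d_gt0 : (0 < d)%N by rewrite /d; lia.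
have [] := andP (@path_row_strip i (part la i.+1).-1 d.-1 x _).
  by rewrite (_ : _ + _ = (part la i).-1)%N // /d; lia.
rewrite prednK // => -> /eqP->; apply: IH => //.
by rewrite /rim_step /= eqxx.
Qed.

Lemma mem_rim_strip i m r c : (0 < part la (i + m))%N -> (e < part la (i + m))%N ->
  ((r, c) \in rim_strip la i m e) =
  [&& (i <= r <= i + m)%N, (if r == (i + m)%N then e else (part la r.+1).-1) <= c
    & c < part la r]%N.
Proof.
elim: m i => [|m IH] i /=.
  rewrite addn0 => gt0 lt_e; rewrite mem_row_strip /= subnKC ?(ltnW lt_e) // -eqn_leq eq_sym.
  by case: eqVneq => // ->.
rewrite -addSnnS => gt0 lt_e; rewrite mem_cat mem_row_strip IH //=.
have le1 := part_anti part_la (leqnSn i); have le2 := part_anti part_la (leq_addr m i.+1).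
rewrite subnKC; last by lia.
have [-> | ri] := eqVneq r i.
  rewrite ltnn /= orbF leqnn (leq_trans (leqnSn i) (leq_addr _ _)) /=.
  by rewrite ltn_eqF // leq_addr.
by rewrite /= [(i < r)%N]ltn_neqAle [i == r :> nat]eq_sym ri.
Qed.

End Strip.

Section BetaNumbers.
Variables (F : fieldType) (p : nat).
Hypothesis charFp : p \in [pchar F].
Local Notation content := (content F).
Local Notation residues := (residues F).
Local Notation prime_field := (prime_field F p).

Let p_gt0 : (0 < p)%N. Proof. exact/prime_gt0/(pcharf_prime charFp). Qed.

(** The residue of the last node of a row, which is that of its beta number up
    to a shift; for an empty row this is the residue of column -1. *)
Definition row_end la i : F := (part la i)%:R - i%:R - 1.

(** Along a row the contents increase by one, so that passing from [x] to [x + 1]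
    the counts of residues change by the row ends and the row beginnings. *)
Lemma count_residues la N x : (size la <= N)%N ->
  (count_mem x (residues la) + count (fun i : nat => (- i%:R - 1 == x :> F)%R) (iota 0 N))%N =
  (count_mem (x + 1)%R (residues la) + count (fun i => row_end la i == x) (iota 0 N))%N.
Proof.
move=> le_N.
have countE y : count_mem y (residues la) =
    (\sum_(i <- iota 0 N) count (fun c => content (i, c) == y) (iota 0 (part la i)))%N.
  rewrite count_map count_flatten -map_comp sumnE big_map.
  rewrite -(subnKC le_N) iotaD big_cat /= [X in (_ = _ + X)%N]big1_seq; last first.
    by move=> i /andP[_]; rewrite mem_iota => /andP[le_i _]; rewrite nth_default.
  by rewrite addn0; apply: eq_bigr => i _; rewrite /= count_map.
rewrite !countE -!sum1_count !(big_mkcond (fun i => _ == x)) /= -!big_split /=.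
apply: eq_bigr => i _; rewrite /row_end.
elim: (part la i) => [|l IH]; first by rewrite !add0n sub0r.
rewrite -addn1 iotaD !count_cat !add0n /= !addn0.
have -> : ((l + 1)%:R - i%:R - 1 == x) = (content (i, l) == x).
  by rewrite /content /= natrD; congr (_ == x); ring.
have E : (content (i, l) == x + 1) = (l%:R - i%:R - 1 == x).
  by rewrite [RHS]subr_eq.
rewrite E; move: IH; case: (l%:R - i%:R - 1 == x); case: (- i%:R - 1 == x);
  case: (content (i, l) == x) => /=; lia.
Qed.

Lemma count_prime_field x : count_mem x prime_field = count_mem (x + 1) prime_field.
Proof.
have /seq.permP/(_ (pred1 (x + 1))) <- : perm_eq [seq y + 1 | y <- prime_field] prime_field.
  apply: (perm_prime_field charFp); last first.
  - move=> _ /mapP[_ /mapP[a _ ->] ->]; exists a.+1; by rewrite mulrS addrC.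
  - by rewrite !size_map size_iota.
  by rewrite (map_inj_uniq (addIr 1)) (prime_field_uniq charFp).
by rewrite [RHS]count_map; apply: eq_count => y /=; rewrite (inj_eq (addIr 1)).
Qed.

(** The number of beads on the runner belonging to [x] in the abacus of [la]
    with [N] beads. *)
Definition runner la N x := count (fun i => row_end la i == x) (iota 0 N).

Lemma runner_residues la mu N : (size la <= N)%N -> (size mu <= N)%N ->
  perm_eq (residues la) (residues mu) -> runner la N =1 runner mu N.
Proof.
move=> lN mN /seq.permP E x; apply: (@addnI (count_mem (x + 1) (residues mu))).
by rewrite -(count_residues x mN) -!E; apply/esym/count_residues.
Qed.

(** All residues occur once in a rim hook, which does not affect the differences
    in [count_residues]. *)
Lemma runner_hook la mu N : (size la <= N)%N -> (size mu <= N)%N ->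
  removes_rim_hook p la mu -> runner la N =1 runner mu N.
Proof.
move=> lN mN /(rim_hook_residues charFp)/seq.permP E x.
set c := (count_mem (x + 1)%R (residues mu) + count_mem (x + 1)%R prime_field)%N.
suff : (c + runner la N x = c + runner mu N x)%N by move/addnI.
rewrite /c [RHS]addnAC -(count_residues x mN) -count_cat -E -(count_residues x lN).
by rewrite E count_cat addnAC -count_prime_field.
Qed.

Definition beta la N i := (part la i + (N - i.+1))%N.

End BetaNumbers.

Section Cores.
Variables (F : fieldType) (p : nat).
Hypothesis charFp : p \in [pchar F].
Local Notation residues := (residues F).

Let p_gt0 : (0 < p)%N. Proof. exact/prime_gt0/(pcharf_prime charFp). Qed.

Lemma beta_lt la N i j : is_partition la -> (i < j)%N -> (j < N)%N ->
  (beta la N j < beta la N i)%N.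
Proof.
by move=> pl lt_ij lt_jN; have := part_anti pl (ltnW lt_ij); rewrite /beta; lia.
Qed.

(** Lowering a beta number by [p] removes a rim hook of [p] nodes, so that the
    beta numbers of a core are closed under subtracting [p]. *)
Lemma core_beta_closed ga N i : is_core p ga -> (size ga <= N)%N -> (i < N)%N ->
  (p <= beta ga N i)%N -> exists2 j, (j < N)%N & (beta ga N j + p)%N = beta ga N i.
Proof.
move=> [part_ga no_hook] le_N lt_iN le_p; set x := beta ga N i in le_p *.
have [/hasP[j]|/hasPn no_j] := boolP (has (fun j => beta ga N j + p == x)%N (iota 0 N)).
  by rewrite mem_iota => lt_j /eqP Ej; exists j.
pose y := (x - p)%N; pose P j := [&& (i <= j)%N, (j < N)%N & (y < beta ga N j)%N].
have exP : exists j, P j by exists i; rewrite /P leqnn lt_iN /y -/x; lia.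
have leP j : P j -> (j <= N)%N by case/and3P => _ /ltnW.
case: (ex_maxnP exP leP) => j /and3P[le_ij lt_jN lt_yj] max_j.
have lt_y k : (j < k)%N -> (k < N)%N -> (beta ga N k < y)%N.
  move=> lt_jk lt_kN; rewrite ltnNge leq_eqVlt; apply/norP; split.
    by have := no_j k; rewrite mem_iota lt_kN => /(_ isT); rewrite /y; lia.
  apply: contraTN (lt_jk) => lt_k; rewrite -leqNgt; apply: max_j.
  by apply/and3P; split=> //; apply: leq_trans le_ij (ltnW lt_jk).
(* The new beta number [y] belongs to row [j], so the hook occupies the rows from
   [i] to [j]: it leaves [e] nodes in row [j], and in each row above one node
   less than there are in the next row. *)
pose e := (y + j.+1 - N)%N.
have ge_y : (N - j.+1 <= y)%N.
  have [lt_j1|] := ltnP j.+1 N; last by lia.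
  by have := lt_y _ (ltnSn j) lt_j1; rewrite /beta; lia.
have lt_e : (e < part ga j)%N by move: lt_yj; rewrite /beta /e; lia.
have gt0 : (0 < part ga j)%N by apply: leq_ltn_trans lt_e.
have le_e : (part ga j.+1 <= e)%N.
  have [lt_j1|le_N1] := ltnP j.+1 N; last by rewrite nth_default // (leq_trans le_N).
  by have := lt_y _ (ltnSn j) lt_j1; rewrite /beta /e; lia.
pose f r := if (r < i)%N then part ga r else if (r < j)%N then (part ga r.+1).-1
            else if r == j then e else part ga r.
have anti r : (part ga r.+1 <= part ga r)%N by apply: part_anti.
have f_anti r : (f r.+1 <= f r)%N.
  rewrite /f; have := anti r; have := anti r.+1.
  have [lt1|ge1] := ltnP r.+1 i; first by rewrite (ltnW lt1).
  have [lt2|ge2] := ltnP r.+1 j.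
    by rewrite (ltnW lt2); case: ifP; lia.
  have [E|neq] := eqVneq r.+1 j.
    rewrite -E ltnSn; have := part_anti part_ga le_ij; move: lt_e gt0; rewrite -E; case: ifP; lia.
  case: ifP; first by lia.
  case: ifP; first by lia.
  by case: eqVneq => // -> _ _; move: le_e; lia.
have f0 r : (N <= r)%N -> f r = 0%N.
  by move=> le_Nr; rewrite /f; do 3?[case: ifP; try lia] => *; rewrite nth_default // (leq_trans le_N).
case: (no_hook (mkpart f N)); split; first exact: mkpart_partition.
have lt_e' : (e < part ga (i + (j - i)))%N by rewrite subnKC.
have gt0' : (0 < part ga (i + (j - i)))%N by rewrite subnKC.
have memS r c := mem_rim_strip part_ga r c gt0' lt_e'; rewrite subnKC // in memS.
exists (rim_strip ga i (j - i) e); split.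
- rewrite size_rim_strip // /e; move: le_p ge_y lt_e; rewrite /e /y /x /beta; lia.
- apply: (@path_sorted _ _ (i, part ga i)); apply: path_rim_strip => //.
  rewrite /rim_step /= prednK ?eqxx ?orbT //.
  exact: leq_trans gt0 (part_anti part_ga le_ij).
- apply/allP => -[r c]; rewrite memS => /and3P[/andP[le_ir le_rj] le_c lt_c].
  rewrite /in_rim /in_diagram /= lt_c -leqNgt; move: le_c; case: eqVneq => [->|_]; lia.
case=> r c; rewrite /in_diagram /= part_mkpart // memS /f.
have := anti r; case: (ltnP r i) => [lt_ri|le_ir] /=; first by rewrite andbT.
case: (ltngtP r j) => [lt_rj|lt_jr|->] /=; last 1 first.
- by move: lt_e => /=; case: leqP; case: ltnP => //=; lia.
- have := part_anti part_ga lt_rj; case: leqP; case: (ltnP c (part ga r)) => //=; lia.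
by rewrite andbT.
Qed.

Lemma core_beta_sub ga N x m : is_core p ga -> (size ga <= N)%N ->
  (x + p * m)%N \in map (beta ga N) (iota 0 N) -> x \in map (beta ga N) (iota 0 N).
Proof.
move=> cg le_N; elim: m => [|m IH]; first by rewrite muln0 addn0.
case/mapP=> i; rewrite mem_iota => /= lt_i Ei; apply: IH.
have [|j lt_j Ej] := core_beta_closed cg le_N lt_i; first by rewrite -Ei; lia.
apply/mapP; exists j; first by rewrite mem_iota.
by apply: (@addIn p); rewrite Ej -Ei mulnS; lia.
Qed.

(** The beta number of row [i] exceeds the content of its end by [N]. *)
Lemma count_beta ga N z :
  count (fun y => y%:R == z :> F) (map (beta ga N) (iota 0 N)) = runner ga N (z - N%:R).
Proof.
rewrite count_map; apply: eq_in_count => i; rewrite mem_iota => /= lt_i.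
rewrite /row_end /beta natrD natrB // mulrSr [RHS]eq_sym subr_eq [RHS]eq_sym.
by congr (_ == _); ring.
Qed.

Lemma beta_sorted ga N : is_partition ga -> sorted gtn (map (beta ga N) (iota 0 N)).
Proof.
move=> pg; apply/(sortedP 0%N) => i; rewrite size_map size_iota => lt_i.
by rewrite !(nth_map 0%N) ?size_iota ?(ltnW lt_i) // !nth_iota ?(ltnW lt_i) //= beta_lt.
Qed.

(** On each runner of the abacus the beads of a core are pushed to the top, so
    that a core is known once the number of beads on each runner is. *)
Lemma core_runner ga de N : is_core p ga -> is_core p de ->
  (size ga <= N)%N -> (size de <= N)%N ->
  (forall x : F, runner ga N x = runner de N x) -> ga = de.
Proof.
move=> cg cd gN dN E; have [[pg _] [pd _]] := (cg, cd).
have count_class la x : count (fun y => y == x %[mod p]) (map (beta la N) (iota 0 N)) =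
    runner la N (x%:R - N%:R : F).
  by rewrite -count_beta; apply: eq_count => y /=; rewrite (natr_eq_mod charFp).
have tr : transitive gtn by move=> x y z lt1 lt2; apply: ltn_trans lt2 lt1.
have irr : irreflexive gtn by move=> x; apply: ltnn.
have Ub la : is_partition la -> uniq (map (beta la N) (iota 0 N)).
  by move=> /(beta_sorted N); apply: sorted_uniq.
have sub a b : is_core p a -> is_core p b -> (size a <= N)%N -> (size b <= N)%N ->
    (forall x : F, runner a N x = runner b N x) ->
    {subset map (beta a N) (iota 0 N) <= map (beta b N) (iota 0 N)}.
  move=> ca cb aN bN Eab x xa; apply/negPn/negP => xb.
  (* A bead at [x] on the first abacus forces beads at all [x - p * m], while its
     absence on the second one leaves only positions below [x] of that runner. *)
  have le_a : ((x %/ p).+1 <= count (fun y => y == x %[mod p]) (map (beta a N) (iota 0 N)))%N.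
    rewrite -size_filter -[X in (X <= _)%N](size_iota 0) -(size_map (fun m => x - p * m)%N).
    apply: uniq_leq_size => [|_ /mapP[m + ->]].
      rewrite map_inj_in_uniq ?iota_uniq // => m m'; rewrite !mem_iota /= !ltnS !leq_divRL //.
      by nia.
    rewrite mem_iota /= ltnS leq_divRL // mulnC => le_m.
    rewrite mem_filter; apply/andP; split.
      by rewrite -[X in _ == X %[mod _]](subnK le_m) [X in _ == X %[mod _]]addnC [X in (X + _)%N]mulnC modnMDl.
    by apply: (@core_beta_sub a N _ m) => //; rewrite subnK.
  have le_b : (count (fun y => y == x %[mod p]) (map (beta b N) (iota 0 N)) <= x %/ p)%N.
    rewrite -size_filter -[X in (_ <= X)%N](size_iota 1) -[X in (_ <= X)%N](size_map (fun m => x - p * m)%N).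
    apply: uniq_leq_size => [|y]; first by apply/filter_uniq/Ub; case: cb.
    rewrite mem_filter => /andP[/eqP Eyx yb]; have [le_xy|lt_yx] := leqP x y.
      have /dvdnP[m Em] : (p %| y - x)%N by rewrite -eqn_mod_dvd // Eyx.
      case/negP: xb; apply: (@core_beta_sub b N _ m) => //.
      by rewrite mulnC -Em subnKC.
    have /dvdnP[m Em] : (p %| x - y)%N by rewrite -eqn_mod_dvd ?(ltnW lt_yx) // Eyx.
    apply/mapP; exists m; last by lia.
    by rewrite mem_iota add1n ltnS leq_divRL // -Em; case: m Em => [|m]; lia.
  by move: le_a; rewrite count_class Eab -count_class ltnNge le_b.
have Eb : map (beta ga N) (iota 0 N) = map (beta de N) (iota 0 N).
  apply: (irr_sorted_eq tr irr); rewrite ?beta_sorted // => x.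
  by apply/idP/idP; apply: sub.
apply: partition_ext => // i; have [lt_i|le_i] := ltnP i N; last first.
  by rewrite !nth_default // (leq_trans _ le_i).
have := congr1 (fun s => nth 0%N s i) Eb.
by rewrite !(nth_map 0%N) ?size_iota // nth_iota // /beta => /addIn.
Qed.
End Cores.

Section CoresAndResidues.
Variables (F : fieldType) (p : nat).
Hypothesis charFp : p \in [pchar F].
Local Notation residues := (residues F).

Let p_gt0 : (0 < p)%N. Proof. exact/prime_gt0/(pcharf_prime charFp). Qed.

Lemma size_residues la : size (residues la) = sumn la.
Proof. by rewrite size_map size_nodes. Qed.

Lemma rim_hook_size la mu : removes_rim_hook p la mu -> (size mu <= size la)%N.
Proof.
case=> /andP[_ mu0] [s [_ _ _ Emu]]; rewrite leqNgt; apply: contra mu0 => lt_s.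
have := Emu (size la, 0%N); rewrite /in_diagram /= (nth_default _ (leqnn _)) /=.
by rewrite lt0n => /negbFE/eqP <-; apply: mem_nth.
Qed.

Lemma rim_hook_sumn la mu : removes_rim_hook p la mu -> sumn la = (sumn mu + p)%N.
Proof.
move=> /(rim_hook_residues charFp)/perm_size.
by rewrite size_cat !size_residues size_map size_iota.
Qed.

(** The invariants under removing rim hooks: the size modulo [p], the residues
    up to full sets of residues, and the runners of the abacus. *)
Lemma rim_hooks_reduce_inv la ga : is_partition la -> rim_hooks_reduce p la ga ->
  [/\ is_partition ga, (size ga <= size la)%N,
      exists2 v, sumn la = (sumn ga + v * p)%N &
        perm_eq (residues la) (residues ga ++ flatten (nseq v (prime_field F p)))
    & forall N, (size la <= N)%N -> forall x : F, runner la N x = runner ga N x].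
Proof.
move=> pl; elim=> [|mu nu _ [pm sm [v Ev perm_v] run] hook].
  by split=> //; exists 0%N; rewrite ?addn0 //= cats0.
have sn := rim_hook_size hook; split; first by case: hook.
- exact: leq_trans sn sm.
- exists v.+1; first by rewrite Ev (rim_hook_sumn hook) mulSn addnA.
  rewrite (perm_trans perm_v) //= catA perm_cat2r.
  exact: rim_hook_residues.
move=> N lN x; rewrite run //.
by rewrite (runner_hook charFp _ _ hook) // ?(leq_trans sn) ?(leq_trans sm).
Qed.

Lemma core_ex la : is_partition la -> exists ga, has_core p la ga.
Proof.
move: {2}(sumn la) (leqnn (sumn la)) => m; elim: m la => [|m IH] la le_m pl.
  exists la; split; first exact: rim_hooks_refl.
  by split=> // mu /rim_hook_sumn; lia.
have [[mu hook]|no_hook] := Classical_Prop.classic (exists mu, removes_rim_hook p la mu); last first.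
  exists la; split; first exact: rim_hooks_refl.
  by split=> // mu hook; apply: no_hook; exists mu.
have [|| ga [red core]] := IH mu; first by have := rim_hook_sumn hook; lia.
  by case: hook.
exists ga; split=> //; elim: red => [|nu nu' _ IHn hook']; last exact: rim_hooks_step hook'.
exact: rim_hooks_step (rim_hooks_refl _ _) hook.
Qed.

Lemma same_core_residues la mu ga : is_partition la -> is_partition mu ->
  has_core p la ga -> has_core p mu ga -> sumn la = sumn mu ->
  perm_eq (residues la) (residues mu).
Proof.
move=> pl pm [/(rim_hooks_reduce_inv pl)[_ _ [v Ev perm_v] _] _].
case=> /(rim_hooks_reduce_inv pm)[_ _ [w Ew perm_w] _] _ Elm.
have Evw : v = w.
  by apply/eqP; rewrite -(eqn_pmul2r p_gt0) -(eqn_add2l (sumn ga)) -Ev -Ew Elm.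
by rewrite (perm_trans perm_v) // Evw perm_sym.
Qed.

(** Residues determine the runners, and these are the same for a partition and
    its core. *)
Lemma residues_same_core la mu ga de : is_partition la -> is_partition mu ->
  has_core p la ga -> has_core p mu de ->
  perm_eq (residues la) (residues mu) -> ga = de.
Proof.
move=> pl pm [/(rim_hooks_reduce_inv pl)[_ sg _ rg] cg].
case=> /(rim_hooks_reduce_inv pm)[_ sd _ rd] cd perm_r.
pose N := (size la + size mu)%N.
have [lN mN] : (size la <= N)%N /\ (size mu <= N)%N by rewrite leq_addr leq_addl.
apply: (core_runner charFp cg cd (leq_trans sg lN) (leq_trans sd mN)) => x.
by rewrite -rg // -rd //; apply: (runner_residues charFp).
Qed.

(** Lengthening the first row by multiples of [p] does not change the core. *)
Lemma core_weight_ex ga v : is_core p ga ->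
  exists la, [/\ is_partition la, sumn la = (sumn ga + v * p)%N & has_core p la ga].
Proof.
move=> cg; have [pg _] := cg; pose f m i := (part ga i + (i == 0%N) * m)%N.
pose N := (size ga).+1.
have f_anti m i : (f m i.+1 <= f m i)%N.
  by rewrite /f; have := part_anti pg (leqnSn i); lia.
have f0 m i : (N <= i)%N -> f m i = 0%N.
  by move=> le_N; rewrite /f nth_default ?(ltnW le_N) //; case: i le_N.
have E0 : mkpart (f 0%N) N = ga.
  apply: partition_ext => // [|i]; first exact: mkpart_partition (f_anti _).
  by rewrite (part_mkpart (f_anti _) (f0 _)) /f; lia.
have hook m : removes_rim_hook p (mkpart (f (m.+1 * p)%N) N) (mkpart (f (m * p)%N) N).
  split; first exact: mkpart_partition (f_anti _).
  exists (row_strip 0 (part ga 0 + m * p) p); split.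
  - exact: size_row_strip.
  - apply: (@path_sorted _ _ (0%N, part ga 0 + m * p + p)%N).
    have step : rim_step (0%N, part ga 0 + m * p + p)%N (0%N, part ga 0 + m * p + p.-1)%N.
      by rewrite /rim_step /= -addnS prednK // eqxx orbT.
    by have /andP[] := path_row_strip step; rewrite prednK.
  - apply/allP=> -[r k]; rewrite mem_row_strip /= => /and3P[/eqP-> le_k lt_k].
    rewrite /in_rim /in_diagram !(part_mkpart (f_anti _) (f0 _)) /f /=.
    by have := part_anti pg (leqnSn 0); lia.
  case=> r k; rewrite /in_diagram !(part_mkpart (f_anti _) (f0 _)) mem_row_strip /f /=.
  by case: (r == 0%N) (eqVneq r 0%N) => -[-> //|_] /=; lia.
have red m : rim_hooks_reduce p (mkpart (f (m * p)%N) N) ga.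
  elim: m => [|m IH]; first by rewrite mul0n E0; apply: rim_hooks_refl.
  elim: IH => [|mu nu _ IHn hook']; last exact: rim_hooks_step hook'.
  exact: rim_hooks_step (rim_hooks_refl _ _) (hook m).
exists (mkpart (f (v * p)%N) N); split=> //; first exact: mkpart_partition (f_anti _).
elim: v => [|v IH]; first by rewrite mul0n E0 addn0.
by rewrite (rim_hook_sumn (hook v)) IH mulSn addnAC addnA.
Qed.

End CoresAndResidues.

Section SortedColumns.
Variables (F : fieldType) (n : nat).
Implicit Types (c : {ffun 'I_n -> 'I_n}).

(** In sorted columns, the point [k] fills the node given by the number of
    earlier points of its column and the number of earlier columns. *)
Lemma content_weight_residues c la : sorted_columns c -> sumn la = n ->
  (forall i, part la i = #|[set D | (i < colsize c D)%N]|) ->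
  perm_eq (codom (content_weight F c)) (residues F la).
Proof.
move=> sc sum_la Ela.
pose C (k : 'I_n) := [set c j | j : 'I_n in [pred j : 'I_n | (j < k)%N && (c j != c k)]].
pose R (k : 'I_n) := [set j : 'I_n | (j < k)%N && (c j == c k)].
pose node (k : 'I_n) := (#|R k|, #|C k|).
have CE k D : (D \in C k) = (D != c k) && [exists j : 'I_n, (j < k)%N && (c j == D)].
  apply/imsetP/andP => [[j]|[neq /existsP[j /andP[lt_jk /eqP Ej]]]].
    by rewrite inE => /andP[lt_jk neq] ->; split=> //; apply/existsP; exists j; rewrite lt_jk eqxx.
  by exists j; rewrite ?inE ?lt_jk ?Ej.
have lt_col (i j : 'I_n) : (i < j)%N -> c i != c j -> (#|C i| < #|C j|)%N.
  move=> lt_ij neq; have [_ cols] := sc i j (ltnW lt_ij) neq.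
  apply: proper_card; apply/properP; split.
    apply/subsetP=> D; rewrite !CE => /andP[neq_D /existsP[l /andP[lt_l /eqP El]]].
    apply/andP; split; last by apply/existsP; exists l; rewrite (ltn_trans lt_l lt_ij) El eqxx.
    apply/eqP => ED; have [|_ cols'] := sc l i (ltnW lt_l); first by rewrite El.
    by have := cols' j; rewrite El ED => /(_ erefl); rewrite ltnNge ltnW.
  exists (c i); last by rewrite CE eqxx.
  by rewrite CE neq; apply/existsP; exists i; rewrite lt_ij eqxx.
have lt_row (i j : 'I_n) : (i < j)%N -> c i = c j -> (#|R i| < #|R j|)%N.
  move=> lt_ij Eij; apply: proper_card; apply/properP; split.
    apply/subsetP=> l; rewrite !inE => /andP[lt_li /eqP->].
    by rewrite (ltn_trans lt_li lt_ij) Eij eqxx.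
  by exists i; rewrite !inE ?lt_ij ?Eij ?eqxx ?ltnn.
have inj_node : injective node.
  suff lt_node (i j : 'I_n) : (i < j)%N -> node i != node j.
    move=> i j E; case: (ltngtP i j) => [/lt_node|/lt_node|/val_inj//]; by rewrite E eqxx.
  move=> lt_ij; rewrite xpair_eqE negb_and; have [Eij|neq] := eqVneq (c i) (c j).
    by rewrite (ltn_eqF (lt_row _ _ lt_ij Eij)).
  by rewrite (ltn_eqF (lt_col _ _ lt_ij neq)) orbT.
have node_in k : node k \in nodes la.
  rewrite mem_nodes /in_diagram /= Ela.
  have -> : #|C k|.+1 = #|c k |: C k| by rewrite cardsU1 CE eqxx.
  apply/subset_leq_card/subsetP=> D; rewrite in_setU1 CE inE.
  have lt_k : (#|R k| < colsize c (c k))%N.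
    apply: proper_card; apply/properP; split.
      by apply/subsetP=> l; rewrite !inE => /andP[].
    by exists k; rewrite !inE ?ltnn ?eqxx.
  case/predU1P => [->//|/andP[neq /existsP[j /andP[lt_jk /eqP Ej]]]].
  apply: leq_trans lt_k _; rewrite -Ej; have [|//] := sc j k (ltnW lt_jk) _.
  by rewrite Ej.
rewrite (_ : codom _ = [seq content F (node k) | k <- enum 'I_n]) //.
rewrite (map_comp (content F) node); apply: perm_map.
have U : uniq (map node (enum 'I_n)) by rewrite map_inj_uniq ?enum_uniq.
apply: uniq_perm; rewrite ?nodes_uniq //.
have sub_n : {subset map node (enum 'I_n) <= nodes la} by move=> _ /mapP[k _ ->].
by have [|//] := uniq_min_size U sub_n; rewrite size_nodes size_map size_enum_ord sum_la.
Qed.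

(** The partition conjugate to the sorted list of column sizes. *)
Lemma column_partition_ex c : exists la, [/\ is_partition la, sumn la = n &
  forall i, part la i = #|[set D | (i < colsize c D)%N]|].
Proof.
pose f i := #|[set D | (i < colsize c D)%N]|.
have szn D : (colsize c D <= n)%N by rewrite -[X in (_ <= X)%N](card_ord n) max_card.
have f_anti i : (f i.+1 <= f i)%N.
  by apply/subset_leq_card/subsetP=> D; rewrite !inE => /ltnW.
have f0 i : (n <= i)%N -> f i = 0%N.
  by move=> le_n; apply/eqP; rewrite cards_eq0; apply/eqP/setP=> D; rewrite !inE ltnNge (leq_trans (szn D)).
exists (mkpart f n); split; first exact: mkpart_partition.
  rewrite sumn_mkpart /f.
  under eq_bigr do rewrite -sum1_card.
  rewrite (exchange_big_dep predT) //= -[RHS](card_ord n) -[RHS]sum1_card.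
  rewrite [RHS](partition_big c predT) //=; apply: eq_bigr => D _.
  under eq_bigl do rewrite inE.
  rewrite -(big_ord_widen n (fun _ => 1%N) (szn D)) sum1_card card_ord sum1dep_card.
  by apply: eq_card => k; rewrite !inE.
by move=> i; rewrite part_mkpart.
Qed.
End SortedColumns.

(** * Polytabloids are Jucys-Murphy eigenvectors *)

Section MatrixAction.
Variables (F : fieldType) (gT : finGroupType) (d : nat).
Variable rG : mx_representation F [set: gT]%G d.

Fact mx_act_linear g : linear (fun v : 'rV[F]_d => v *m rG g).
Proof. by move=> a u v; rewrite mulmxDl -scalemxAl. Qed.

Fact mx_act1 (v : 'rV[F]_d) : v *m rG 1%g = v.
Proof. by rewrite repr_mx1 mulmx1. Qed.

Fact mx_actM g h (v : 'rV[F]_d) : v *m rG (g * h)%g = (v *m rG g) *m rG h.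
Proof. by rewrite repr_mxM ?inE // mulmxA. Qed.

Definition mx_action : right_action gT 'rV[F]_d :=
  RightAction mx_act_linear mx_act1 mx_actM.
End MatrixAction.

Section Polytabloids.
Variables (F : fieldType) (la : seq nat).
Hypothesis part_la : is_partition la.
Local Notation m := (sumn la).
Implicit Types (t s g : 'S_m) (k x : 'I_m) (D : 'I_m) (rr : tabloid la).

Let row k := reshape_index la k.
Let col k := reshape_offset la k.

Lemma node_in k : (col k < part la (row k))%N.
Proof. exact/reshape_offsetP. Qed.

Lemma part_le_sumn i : (part la i <= m)%N.
Proof.
have [lt_i|le_i] := ltnP i (size la); last by rewrite nth_default.
by rewrite sumnE (big_nth 0%N) big_mkord (bigD1 (Ordinal lt_i)) //= leq_addr.
Qed.

Lemma size_le_sumn : (size la <= m)%N.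
Proof.
case/andP: part_la => _; elim: la => //= a s IH; rewrite inE negb_or => /andP[a0 /IH].
by case: a a0 => // a _; rewrite addSn ltnS => /leq_trans; apply; apply: leq_addl.
Qed.

Lemma row_lt k : (row k < m)%N.
Proof. exact: leq_trans (reshape_indexP (ltn_ord k)) size_le_sumn. Qed.

Lemma col_lt k : (col k < m)%N.
Proof. exact: leq_trans (node_in k) (part_le_sumn _). Qed.

Lemma node_inj k k' : row k = row k' -> col k = col k' -> k = k'.
Proof.
by move=> r c; apply/val_inj; rewrite /= -(reshape_indexK la k) -(reshape_indexK la k') -/(row k) r -/(col k) c.
Qed.

Lemma node_ex i j : (j < part la i)%N -> exists k, row k = i /\ col k = j.
Proof.
move=> lt_j; exists (Ordinal (flatten_indexP lt_j)).
by rewrite /row /col /= flatten_indexKl ?flatten_indexKr.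
Qed.

(** The column of the point [x] in the tableau [t]. *)
Definition point_column t : {ffun 'I_m -> 'I_m} := [ffun x => Ordinal (col_lt (t^-1 x)%g)].

Lemma colsize_gt t i D : (i < colsize (point_column t) D)%N = (D < part la i)%N.
Proof.
have -> : colsize (point_column t) D = #|[set k | col k == D]|.
  rewrite -(card_imset _ (@perm_inj _ t)); apply: eq_card => x; rewrite !inE ffunE.
  apply/eqP/imsetP => [Ex|[k + ->]]; last by rewrite inE permK => /eqP Ek; apply: val_inj.
  by exists (t^-1 x)%g; rewrite ?permKV // inE -Ex.
have [lt_D|le_D] := ltnP D (part la i).
  have /fin_all_exists[f fP] (a : 'I_i.+1) : exists k, row k = a /\ col k = D.
    apply: node_ex; apply: leq_trans lt_D (part_anti part_la _).
    by rewrite -ltnS.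
  rewrite -[X in (X <= _)%N](card_ord i.+1) -(card_imset predT (f := f)).
    by apply/subset_leq_card/subsetP=> _ /imsetP[a _ ->]; rewrite inE; apply/eqP; case: (fP a).
  by move=> a b Eab; apply/val_inj; have [[Ra _] [Rb _]] := (fP a, fP b); rewrite /= -Ra -Rb Eab.
apply/negbTE; rewrite -leqNgt.
have row_i k : k \in [set k | col k == D] -> (row k < i)%N.
  rewrite inE => /eqP Ek; rewrite ltnNge; apply/negP => le_i.
  have := node_in k; rewrite Ek ltnNge (leq_trans (part_anti part_la le_i)) //.
have -> : #|[set k | col k == D]| = size (map row (enum [set k | col k == D])).
  by rewrite size_map -cardE.
rewrite -[X in (_ <= X)%N](size_iota 0); apply: uniq_leq_size => [|_ /mapP[k + ->]].
  rewrite map_inj_in_uniq ?enum_uniq // => k k'; rewrite !mem_enum !inE => /eqP Ek /eqP Ek' E.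
  by apply: node_inj; rewrite // Ek Ek'.
by rewrite mem_enum mem_iota => /row_i.
Qed.

Lemma point_column_part t i :
  part la i = #|[set D | (i < colsize (point_column t) D)%N]|.
Proof.
under eq_finset do rewrite colsize_gt.
rewrite -sum1dep_card -(big_ord_widen m (fun _ => 1%N) (part_le_sumn i)).
by rewrite sum1_card card_ord.
Qed.

Lemma column_stabE t s :
  (s \in column_stab t) = [forall x, point_column t (s x) == point_column t x].
Proof.
rewrite inE; apply/forallP/forallP => H x.
  by have := H (t^-1 x)%g; rewrite permKV !ffunE -val_eqE.
by have := H (t x); rewrite !ffunE -val_eqE /= permK.
Qed.

Lemma polytabloid_antisym t :
  antisym (mx_action (tabloid_repr F la)) (point_column t) (polytabloid F t).
Proof.
move=> i j neq_ij Eij; rewrite /= polytabloidM; set g := tperm i j.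
have cg x : point_column t (g x) = point_column t x by rewrite /g; case: tpermP => [->|->|].
have ctg x : point_column (t * g)%g x = point_column t (g x).
  by rewrite !ffunE; apply: val_inj; rewrite /= invMg permM tpermV.
apply/rowP=> a; rewrite !mxE -sumrN (reindex_inj (mulgI g)) /=.
apply: eq_big => [s|s _].
  rewrite !column_stabE; apply/forallP/forallP => H x; have := H (g x).
    by rewrite !ctg !cg !permM tpermK.
  by rewrite !ctg !cg !permM.
by rewrite odd_permM odd_tperm neq_ij signr_addb expr1 mulN1r mulNr -!mulgA (mulgA g g) tperm2 mul1g.
Qed.

Lemma tabloid_mx_coef (v : 'rV[F]_#|{: tabloid la}|) g rr :
  (v *m tabloid_mx F g) 0 (enum_rank rr) = v 0 (enum_rank (tabloid_act rr g^-1%g)).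
Proof.
rewrite mxE (bigD1 (enum_rank (tabloid_act rr g^-1%g))) //= big1 ?addr0.
  by rewrite mxE !enum_rankK -tabloid_actM mulVg tabloid_act1 eqxx mulr1.
move=> a /negPf neq_a; rewrite mxE enum_rankK; case: eqP => [E|_]; last by rewrite mulr0.
by rewrite -E -tabloid_actM mulgV tabloid_act1 enum_valK eqxx in neq_a.
Qed.

(** In the tabloids of a polytabloid each point stays in its column, and so in
    a row that meets this column. *)
Lemma polytabloid_rows t rr : polytabloid F t 0 (enum_rank rr) != 0 ->
  forall x, (val rr x < colsize (point_column t) (point_column t x))%N.
Proof.
rewrite mxE => nz x; have [s /andP[ts /forallP of_s]] : exists s, (s \in column_stab t) && tabloid_of (t * s)%g rr.
  apply/existsP; apply: contraNT nz; rewrite negb_exists => /forallP no_s.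
  apply/eqP/big1 => s ts; have := no_s s; rewrite ts /= enum_rankK => /negPf->.
  by rewrite mulr0.
pose k := ((t * s)^-1 x)%g; have := of_s k; rewrite permKV => /eqP->.
rewrite column_stabE in ts; have /eqP := forallP ts (s^-1 x)%g; rewrite permKV => ->.
by rewrite colsize_gt ffunE /= -permM -invMg; apply: node_in.
Qed.

Lemma tabloid_of_ex t : exists rr, tabloid_of t rr.
Proof.
pose f : {ffun 'I_m -> 'I_m} := [ffun x => Ordinal (row_lt (t^-1 x)%g)].
have fP : is_tabloid f.
  apply/forallP=> i; rewrite -(card_ord (part la i)).
  have /fin_all_exists[h hP] (a : 'I_(part la i)) : exists k, row k = i /\ col k = a.
    exact: node_ex.
  have inj_h : injective (t \o h).
    by move=> a b /perm_inj E; apply/val_inj; have [[_ Ca] [_ Cb]] := (hP a, hP b); rewrite /= -Ca -Cb E.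
  rewrite -(card_imset predT inj_h); apply/eqP/eq_card => x; rewrite inE ffunE.
  apply/eqP/imsetP => [Ex|[a _ ->]]; last by apply/val_inj; rewrite /= permK; case: (hP a).
  have lt_c : (col (t^-1 x)%g < part la i)%N by rewrite -Ex; apply: node_in.
  exists (Ordinal lt_c) => //=; apply: (canRL (permKV t)).
  have [Ra Ca] := hP (Ordinal lt_c); apply: node_inj; rewrite ?Ra ?Ca //.
  by rewrite -Ex.
by exists (Sub f fP); apply/forallP=> k; rewrite SubK ffunE /= permK.
Qed.

Lemma polytabloid_neq0 t : polytabloid F t != 0.
Proof.
have [rr /forallP of_t] := tabloid_of_ex t.
apply/eqP=> /rowP/(_ (enum_rank rr)); rewrite !mxE (bigD1 1%g) /=; last first.
  by rewrite column_stabE; apply/forallP=> x; rewrite perm1.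
rewrite odd_perm1 mul1r mulg1 enum_rankK (_ : tabloid_of t rr); last exact/forallP.
rewrite big1 => [/eqP|s /andP[ts neq_s]]; first by rewrite addr0 oner_eq0.
case of_s: (tabloid_of _ _); rewrite ?mulr0 //; case/eqP: neq_s.
apply/permP=> x; rewrite perm1 -[x](permKV t); set k := (t^-1 x)%g.
have := forallP of_s k; rewrite permM => /eqP rs.
have := of_t (t^-1 (s (t k)))%g; rewrite permKV rs => /eqP r1.
apply: (canRL (permKV t)); apply: node_inj; first by rewrite /row -r1.
by move: ts; rewrite inE => /forallP/(_ k)/eqP.
Qed.

(** A Garnir element of a polytabloid is antisymmetric on more points than the
    rows they can occupy; a tabloid with two of them in one row gets a
    coefficient equal to its opposite. *)
Lemma polytabloid_garnir t k D : 2%:R != 0 :> F ->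
  point_column t k != D ->
  (colsize (point_column t) (point_column t k) <= colsize (point_column t) D)%N ->
  garnir (mx_action (tabloid_repr F la)) (point_column t) k D (polytabloid F t) = 0.
Proof.
move=> two_neq0 neq_D le_D; set w := garnir _ _ _ _ _.
have anti_w := antisym_garnir (@polytabloid_antisym t) neq_D.
set c := point_column t in neq_D le_D anti_w w *; set h := colsize c D in le_D.
pose S := [set x | move_to c k D x == D].
have cardS : #|S| = h.+1.
  rewrite -[RHS](_ : #|k |: [set x | c x == D]| = _); last by rewrite cardsU1 inE neq_D.
  by apply: eq_card => x; rewrite !inE !ffunE; case: (eqVneq x k) => //= _; rewrite eqxx.
have rows_t rr x : polytabloid F t 0 (enum_rank rr) != 0 -> x \in S -> (val rr x < h)%N.
  move=> /polytabloid_rows/(_ x) lt_r; rewrite inE ffunE.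
  case: (eqVneq x k) => [Ex _|_ /eqP Ex]; last by rewrite -/c Ex in lt_r.
  by apply: leq_trans lt_r _; rewrite Ex.
have rows_w rr x : w 0 (enum_rank rr) != 0 -> x \in S -> (val rr x < h)%N.
  move=> nz xS; rewrite ltnNge; apply: contra nz => ge_h.
  rewrite mxE [polytabloid _ _ _ _](_ : _ = 0) ?add0r; last first.
    by apply/eqP; apply: contraTT ge_h => nz; rewrite -ltnNge rows_t.
  rewrite mxE summxE big1 ?oppr0 // => j /eqP cj; rewrite tabloid_mx_coef tpermV.
  apply/eqP; apply: contraTT ge_h => nz; rewrite -ltnNge.
  have := rows_t _ (tperm j k x) nz; rewrite ffunE tpermV tpermK; apply.
  have moveE y : move_to c k D y = if y == k then D else c y by rewrite ffunE.
  move: xS; rewrite !inE !moveE; case: tpermP => [->|->|] //; rewrite ?eqxx ?cj ?eqxx //.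
  by case: ifP.
apply/rowP=> a; rewrite [in RHS]mxE -[a]enum_valK; set rr := enum_val a.
apply/eqP/negPn/negP => nz.
have [i [j [Si Sj neq_ij Eij]]] : exists i j, [/\ i \in S, j \in S, i != j & val rr i = val rr j].
  suff /existsP[i /andP[Si /existsP[j /and3P[Sj neq /eqP E]]]] :
      [exists i in S, exists j, [&& j \in S, i != j & val rr i == val rr j]] by exists i, j.
  apply: contraT => no_ij; suff : (#|S| <= h)%N by rewrite cardS ltnn.
  have inj_rr : {in S &, injective (val rr)}.
    move=> i j Si Sj E; apply/eqP; apply: contraNT no_ij => neq.
    by apply/existsP; exists i; rewrite Si; apply/existsP; exists j; rewrite Sj neq E eqxx.
  rewrite cardE -(size_map (fun x => val (val rr x))) -[X in (_ <= X)%N](size_iota 0).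
  apply: uniq_leq_size => [|_ /mapP[x + ->]].
    rewrite map_inj_in_uniq ?enum_uniq // => x y; rewrite !mem_enum => Sx Sy /val_inj.
    exact: inj_rr.
  by rewrite mem_enum mem_iota => /(rows_w _ _ nz).
have := anti_w i j neq_ij; rewrite -/w.
have -> : move_to c k D i = move_to c k D j by move: Si Sj; rewrite !inE => /eqP-> /eqP->.
move=> /(_ erefl)/rowP/(_ (enum_rank rr)); rewrite /= tabloid_mx_coef tpermV [in RHS]mxE.
have -> : tabloid_act rr (tperm i j) = rr.
  apply/val_inj/ffunP=> x; rewrite ffunE tpermV.
  by case: tpermP => [->|->|].
move/eqP; rewrite -addr_eq0 -mulr2n -mulr_natl mulf_eq0 (negPf two_neq0) /=.
by move=> E; rewrite E in nz.
Qed.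

(** The tableau is chosen with its entries increasing down the columns, one
    column after the other. *)
Lemma polytabloid_weight : 2%:R != 0 :> F -> exists t a,
  weight_vector (mx_action (tabloid_repr F la)) a (polytabloid F t) /\
  perm_eq (codom a) (residues F la).
Proof.
move=> two_neq0; have [q sq] := sort_columns [ffun k => Ordinal (col_lt k)].
pose t := (q^-1)%g; have Ec : point_column t = [ffun k => [ffun k => Ordinal (col_lt k)] (q k)].
  by apply/ffunP=> k; rewrite !ffunE invgK.
rewrite -Ec in sq; exists t, (content_weight F (point_column t)); split.
  apply: weight_of_garnir => // [|k D]; first exact: polytabloid_antisym.
  exact: polytabloid_garnir.
by apply: content_weight_residues => // i; apply: point_column_part.
Qed.

(** The image of a polytabloid in the Specht module is the required vector; the
    last condition says that it generates the module, since all polytabloids are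
    translates of one another. *)
Lemma specht_weight : 2%:R != 0 :> F -> exists (v : 'rV[F]_(\rank (specht_space F la))) a,
  [/\ weight_vector (mx_action (specht_repr F la)) a v,
      perm_eq (codom a) (residues F la), v != 0 &
      forall q (N : 'M_(_, q)), (forall g, v *m specht_repr F la g *m N = 0) -> N = 0].
Proof.
move=> two_neq0; have [t [a [wt res_a]]] := polytabloid_weight two_neq0.
pose U := specht_space F la.
have eU t' : (polytabloid F t' <= U)%MS.
  by apply: (sumsmx_sup t') => //; rewrite genmxE.
pose P := in_submod U 1%:M.
have inE W : in_submod U W = W *m P :> 'M_(_, _) by rewrite /P -in_submodE.
have actE g (v : 'rV_#|{: tabloid la}|) : (v <= U)%MS ->
    in_submod U (v *m tabloid_repr F la g) = in_submod U v *m specht_repr F la g.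
  by move=> vU; apply: in_submodJ.
exists (in_submod U (polytabloid F t)), a; split=> //.
- move=> k; transitivity (in_submod U (ract_ga (mx_action (tabloid_repr F la)) (jm F k) (polytabloid F t))).
    rewrite /ract_ga linear_sum; apply: eq_bigr => g _ /=.
    by rewrite linearZ /= actE.
  by rewrite wt linearZ.
- apply: contraNneq (polytabloid_neq0 t) => v0.
  by rewrite -(in_submodK (eU t)) v0 linear0.
move=> q N vN; have PN0 : (U <= kermx (P *m N))%MS.
  apply/sumsmx_subP=> t' _; rewrite genmxE; apply/sub_kermxP.
  rewrite mulmxA -inE -[t'](mulKVg t) -polytabloidM actE //.
have := sub_kermxP (submx_trans (val_submodP 1%:M) PN0).
by rewrite mulmxA -inE val_submodK mul1mx.
Qed.
End Polytabloids.

(** * Morita equivalence with a corner ring *)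

(** [iota] embeds [B] as the corner [e A e] of [A], [theta] is the compression
    of [A] to that corner, and the last field says that the ideal generated by
    [e] is all of [A]. *)
Record full_corner (A B : pzRingType) (J : finType) := FullCorner {
  fc_e : A;
  fc_iota : B -> A;
  fc_theta : A -> B;
  fc_a : J -> A;
  fc_b : J -> A;
  fc_iotaD : {morph fc_iota : x y / x + y};
  fc_iotaM : {morph fc_iota : x y / x * y};
  fc_iota1 : fc_iota 1 = fc_e;
  fc_thetaD : {morph fc_theta : x y / x + y};
  fc_thetaK : forall x, fc_iota (fc_theta x) = fc_e * x * fc_e;
  fc_iotaK : cancel fc_iota fc_theta;
  fc_full : \sum_j fc_a j * fc_e * fc_b j = 1 }.

Section Corner.
Variables (A B : pzRingType) (J : finType) (K : full_corner A B J).
Local Notation e := (fc_e K).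
Local Notation iota := (fc_iota K).
Local Notation theta := (fc_theta K).
Local Notation a := (fc_a K).
Local Notation b := (fc_b K).

Lemma fc_ee : e * e = e.
Proof. by rewrite -(fc_iota1 K) -(fc_iotaM K) mulr1. Qed.

Lemma fc_e_iota x : e * iota x = iota x.
Proof. by rewrite -(fc_iota1 K) -(fc_iotaM K) mul1r. Qed.

Lemma fc_iota_e x : iota x * e = iota x.
Proof. by rewrite -(fc_iota1 K) -(fc_iotaM K) mulr1. Qed.

Lemma fc_theta_corner x y : theta x * theta y = theta (x * e * y).
Proof.
apply: (can_inj (fc_iotaK K)); rewrite fc_iotaM !fc_thetaK !mulrA.
by rewrite -(mulrA (e * x) e e) fc_ee.
Qed.

Lemma fc_thetaMr x y : theta (y * iota x) = theta y * x.
Proof.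
apply: (can_inj (fc_iotaK K)).
by rewrite fc_iotaM !fc_thetaK -!mulrA fc_e_iota fc_iota_e.
Qed.

Lemma fc_theta1 : theta 1 = 1.
Proof.
by apply: (can_inj (fc_iotaK K)); rewrite fc_thetaK fc_iota1 mulr1 fc_ee.
Qed.

Lemma fc_iota0 : iota 0 = 0.
Proof. by apply: (@addrI _ (iota 0)); rewrite -fc_iotaD !addr0. Qed.

Lemma fc_theta0 : theta 0 = 0.
Proof. by apply: (@addrI _ (theta 0)); rewrite -fc_thetaD !addr0. Qed.

Lemma fc_theta_sum I (r : seq I) P (f : I -> A) :
  theta (\sum_(i <- r | P i) f i) = \sum_(i <- r | P i) theta (f i).
Proof. exact: (big_morph theta (fc_thetaD K) fc_theta0). Qed.

Lemma fc_full_mid x y : \sum_j x * a j * e * (b j * y) = x * y.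
Proof.
rewrite -[x in RHS]mulr1 -(fc_full K) mulr_sumr mulr_suml.
by apply: eq_bigr => j _; rewrite !mulrA.
Qed.

(** This is the relation behind the idempotency of the matrix of the
    [theta (b i * a j)] in [coord_pred]. *)
Lemma fc_theta_full x y : \sum_j theta (x * a j) * theta (b j * y) = theta (x * y).
Proof.
rewrite -[in RHS]fc_full_mid fc_theta_sum; apply: eq_bigr => j _.
by rewrite fc_theta_corner.
Qed.

Section CornerModule.
Variable U : lmodType A.

Definition corner_pred : {pred U} := fun u => e *: u == u.

Fact corner_zmod_closed : zmod_closed corner_pred.
Proof.
split=> [|u v /eqP Eu /eqP Ev]; first by rewrite unfold_in scaler0.
by rewrite unfold_in scalerBr Eu Ev.
Qed.

HB.instance Definition _ := GRing.isZmodClosed.Build U corner_pred corner_zmod_closed.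

Record corner := Corner { corner_val :> U; _ : corner_val \in corner_pred }.
HB.instance Definition _ := [isSub for corner_val].
HB.instance Definition _ := [Choice of corner by <:].
HB.instance Definition _ := [SubChoice_isSubZmodule of corner by <:].

Fact corner_scale_subproof x (u : corner) : iota x *: (u : U) \in corner_pred.
Proof. by rewrite unfold_in scalerA fc_e_iota. Qed.

Definition corner_scale x u := Corner (corner_scale_subproof x u).

Fact corner_scaleA x y u : corner_scale x (corner_scale y u) = corner_scale (x * y) u.
Proof. by apply: val_inj; rewrite /= scalerA fc_iotaM. Qed.
Fact corner_scale1 : left_id 1 corner_scale.
Proof. by move=> u; apply: val_inj; rewrite /= fc_iota1; apply/eqP; case: u. Qed.
Fact corner_scaleDr : right_distributive corner_scale +%R.
Proof. by move=> x u v; apply: val_inj; rewrite /= scalerDr. Qed.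
Fact corner_scaleDl u : {morph corner_scale^~ u : x y / x + y}.
Proof. by move=> x y; apply: val_inj; rewrite /= fc_iotaD scalerDl. Qed.

HB.instance Definition _ := GRing.Zmodule_isLmodule.Build B corner
  corner_scaleA corner_scale1 corner_scaleDr corner_scaleDl.
End CornerModule.

Section CornerMap.
Variables (U V : lmodType A) (f : {linear U -> V}).
Fact corner_map_subproof (u : corner U) : f (corner_val u) \in @corner_pred V.
Proof. by rewrite unfold_in -linearZ; case: u => u /= /eqP->. Qed.
Definition corner_map u : corner V := Corner (corner_map_subproof u).
Fact corner_map_linear : linear corner_map.
Proof. by move=> x u v; apply: val_inj; rewrite /= linearP. Qed.
HB.instance Definition _ := GRing.isLinear.Build B (corner U) (corner V) *:%R
  corner_map corner_map_linear.
End CornerMap.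

(** The module [A e (x) V] in coordinates: [x (x) v] is the family of the
    [(e b_i x) v], and these families are the fixed points of an idempotent
    matrix over [B]. *)
Section CoordinateModule.
Variable V : lmodType B.

Definition coord_act (x : A) (phi : {ffun J -> V}) : {ffun J -> V} :=
  [ffun i => \sum_j theta (b i * x * a j) *: phi j].

Lemma coord_actM x y phi : coord_act x (coord_act y phi) = coord_act (x * y) phi.
Proof.
apply/ffunP=> i; rewrite !ffunE.
under eq_bigr do rewrite ffunE scaler_sumr.
rewrite exchange_big; apply: eq_bigr => k _ /=.
under eq_bigr => j _ do rewrite scalerA -(mulrA (b j)).
by rewrite -scaler_suml fc_theta_full !mulrA.
Qed.

Lemma coord_actDr x phi psi : coord_act x (phi + psi) = coord_act x phi + coord_act x psi.
Proof.
apply/ffunP=> i; rewrite !ffunE -big_split; apply: eq_bigr => j _.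
by rewrite ffunE scalerDr.
Qed.

Lemma coord_actDl x y phi : coord_act (x + y) phi = coord_act x phi + coord_act y phi.
Proof.
apply/ffunP=> i; rewrite !ffunE -big_split; apply: eq_bigr => j _.
by rewrite mulrDr mulrDl fc_thetaD scalerDl.
Qed.

Definition coord_pred : {pred {ffun J -> V}} := fun phi => coord_act 1 phi == phi.

Fact coord_zmod_closed : zmod_closed coord_pred.
Proof.
have act0 : coord_act 1 0 = 0 by apply: (addrI (coord_act 1 0)); rewrite -coord_actDr !addr0.
split=> [|u v /eqP Eu /eqP Ev]; first by rewrite unfold_in act0.
rewrite unfold_in coord_actDr Eu; apply/eqP; congr (_ + _).
by apply: (addrI (coord_act 1 v)); rewrite -coord_actDr subrr act0 Ev subrr.
Qed.

HB.instance Definition _ :=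
  GRing.isZmodClosed.Build {ffun J -> V} coord_pred coord_zmod_closed.

Record coord := Coord { coord_val :> {ffun J -> V}; _ : coord_val \in coord_pred }.
HB.instance Definition _ := [isSub for coord_val].
HB.instance Definition _ := [Choice of coord by <:].
HB.instance Definition _ := [SubChoice_isSubZmodule of coord by <:].

Fact coord_scale_subproof x (u : coord) : coord_act x (coord_val u) \in coord_pred.
Proof. by rewrite unfold_in coord_actM mul1r. Qed.

Definition coord_scale x u := Coord (coord_scale_subproof x u).

Fact coord_scaleA x y u : coord_scale x (coord_scale y u) = coord_scale (x * y) u.
Proof. by apply: val_inj; rewrite /= coord_actM. Qed.
Fact coord_scale1 : left_id 1 coord_scale.
Proof. by move=> u; apply: val_inj; apply/eqP; case: u. Qed.
Fact coord_scaleDr : right_distributive coord_scale +%R.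
Proof. by move=> x u v; apply: val_inj; rewrite /= coord_actDr. Qed.
Fact coord_scaleDl u : {morph coord_scale^~ u : x y / x + y}.
Proof. by move=> x y; apply: val_inj; rewrite /= coord_actDl. Qed.

HB.instance Definition _ := GRing.Zmodule_isLmodule.Build A coord
  coord_scaleA coord_scale1 coord_scaleDr coord_scaleDl.
End CoordinateModule.

Section CoordinateMap.
Variables (V W : lmodType B) (f : {linear V -> W}).
Let fmap_ffun (phi : {ffun J -> V}) : {ffun J -> W} := [ffun i => f (phi i)].
Lemma coord_act_map x phi : coord_act x (fmap_ffun phi) = fmap_ffun (coord_act x phi).
Proof.
apply/ffunP=> i; rewrite !ffunE linear_sum; apply: eq_bigr => j _ /=.
by rewrite ffunE linearZ.
Qed.
Fact coord_map_subproof (u : coord V) : fmap_ffun (coord_val u) \in @coord_pred W.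
Proof. by rewrite unfold_in coord_act_map; case: u => u /= /eqP->. Qed.
Definition coord_map u : coord W := Coord (coord_map_subproof u).
Fact coord_map_linear : linear coord_map.
Proof.
move=> x u v; apply: val_inj => /=; rewrite coord_act_map.
by apply/ffunP=> i; rewrite !ffunE linearD.
Qed.
HB.instance Definition _ := GRing.isLinear.Build A (coord V) (coord W) *:%R
  coord_map coord_map_linear.
End CoordinateMap.

Definition corner_functor : functor A B.
Proof.
apply: (@Functor A B (fun U => corner U) (fun U V f => corner_map f)).
- by move=> U V f g fg u; apply: val_inj; apply: fg.
- by move=> U f f1 u; apply: val_inj; apply: f1.
by move=> U V W f g h hgf u; apply: val_inj; apply: hgf.
Defined.

Definition coord_functor : functor B A.
Proof.
apply: (@Functor B A (fun V => coord V) (fun V W f => coord_map f)).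
- by move=> V W f g fg u; apply: val_inj; apply/ffunP=> i; rewrite !ffunE.
- by move=> V f f1 u; apply: val_inj; apply/ffunP=> i; rewrite !ffunE.
by move=> U V W f g h hgf u; apply: val_inj; apply/ffunP=> i; rewrite !ffunE.
Defined.

Section Unit.
Variable U : lmodType A.

Fact unit_corner_subproof u j : e *: (b j *: u) \in @corner_pred U.
Proof. by rewrite unfold_in scalerA fc_ee. Qed.

Definition unit_corner u j : corner U := Corner (unit_corner_subproof u j).

Lemma coord_act_unit x u :
  coord_act x [ffun j => unit_corner u j] = [ffun j => unit_corner (x *: u) j].
Proof.
apply/ffunP=> i; rewrite !ffunE; apply: val_inj.
rewrite /= (big_morph (@corner_val U) (id1 := 0) (op1 := +%R)) //=.
transitivity (\sum_j (e * (b i * x * a j * e * b j)) *: u).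
  apply: eq_bigr => j _; rewrite ffunE /= fc_thetaK !scalerA !mulrA.
  by rewrite -(mulrA _ e e) fc_ee.
rewrite -scaler_suml -mulr_sumr scalerA scalerA.
have -> : \sum_j b i * x * a j * e * b j = b i * x by rewrite -[RHS]mulr1 -[RHS]fc_full_mid; apply: eq_bigr => j _; rewrite mulr1.
by rewrite mulrA.
Qed.

Fact unit_coord_subproof u : [ffun j => unit_corner u j] \in @coord_pred (corner U).
Proof. by rewrite unfold_in coord_act_unit scale1r. Qed.

Definition unit_map u : coord (corner U) := Coord (unit_coord_subproof u).

Fact unit_map_linear : linear unit_map.
Proof.
move=> x u v; apply: val_inj => /=; rewrite coord_act_unit.
by apply/ffunP=> i; rewrite !ffunE; apply: val_inj; rewrite /= !scalerDr.
Qed.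
HB.instance Definition _ := GRing.isLinear.Build A U (coord (corner U)) *:%R
  unit_map unit_map_linear.

Definition unit_inv (phi : coord (corner U)) : U := \sum_j a j *: corner_val (coord_val phi j).

Lemma unit_mapK : cancel unit_map unit_inv.
Proof.
move=> u; rewrite /unit_inv -[RHS]scale1r -(fc_full K) scaler_suml.
by apply: eq_bigr => j _; rewrite /= ffunE /= !scalerA.
Qed.

Lemma unit_invK : cancel unit_inv unit_map.
Proof.
move=> phi; apply: val_inj; apply/ffunP=> i; rewrite /= ffunE; apply: val_inj => /=.
rewrite /unit_inv !scaler_sumr; case: phi => phi /= /eqP Ephi.
rewrite -[in RHS]Ephi ffunE (big_morph (@corner_val U) (id1 := 0) (op1 := +%R)) //=.
apply: eq_bigr => j _; rewrite fc_thetaK mulr1 -(scalerA _ e).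
by case: (phi j) => u /= /eqP->; rewrite !scalerA !mulrA.
Qed.
End Unit.

Section Counit.
Variable V : lmodType B.

Fact counit_coord_subproof v : [ffun j => theta (b j) *: v] \in @coord_pred V.
Proof.
rewrite unfold_in; apply/eqP/ffunP=> i; rewrite !ffunE.
under eq_bigr => j _ do rewrite ffunE scalerA -(mulr1 (b j)).
by rewrite -scaler_suml fc_theta_full !mulr1.
Qed.

Definition counit_coord v : coord V := Coord (counit_coord_subproof v).

Lemma counit_corner_subproof v : counit_coord v \in @corner_pred (coord V).
Proof.
rewrite unfold_in; apply/eqP/val_inj/ffunP=> i; rewrite /= !ffunE.
under eq_bigr => j _ do rewrite ffunE scalerA -(mulr1 (b j)).
rewrite -scaler_suml fc_theta_full mulr1.
by rewrite -[in LHS](fc_iota1 K) fc_thetaMr mulr1.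
Qed.

Definition counit_map v : corner (coord V) := Corner (counit_corner_subproof v).

Fact counit_map_linear : linear counit_map.
Proof.
move=> x u v; apply: val_inj; apply: val_inj; apply/ffunP=> i; rewrite /= !ffunE.
under eq_bigr => j _ do rewrite ffunE scalerA -(mulr1 (b j)).
by rewrite -scaler_suml fc_theta_full mulr1 fc_thetaMr scalerDr scalerA.
Qed.
HB.instance Definition _ := GRing.isLinear.Build B V (corner (coord V)) *:%R
  counit_map counit_map_linear.

Definition counit_inv (u : corner (coord V)) : V :=
  \sum_j theta (a j) *: coord_val (corner_val u) j.

Lemma counit_mapK : cancel counit_map counit_inv.
Proof.
move=> v; rewrite /counit_inv -[RHS]scale1r -fc_theta1 -[1 in RHS]mulr1 -fc_theta_full.
rewrite scaler_suml; apply: eq_bigr => j _.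
by rewrite /= ffunE scalerA mul1r mulr1.
Qed.

Lemma counit_invK : cancel counit_inv counit_map.
Proof.
move=> u; apply: val_inj; apply: val_inj; apply/ffunP=> i; rewrite /= ffunE.
rewrite /counit_inv scaler_sumr; case: u => phi /= /eqP Ephi.
rewrite -[in RHS]Ephi /= ffunE; apply: eq_bigr => j _.
by rewrite scalerA fc_theta_corner.
Qed.
End Counit.

(** The functors are [U |-> e U] and [V |-> A e (x) V]; fullness of the
    idempotent makes [unit_map] bijective. *)
Theorem full_corner_morita : morita_equivalent A B.
Proof.
exists corner_functor, coord_functor; split.
  exists (fun U => unit_map (U := U)); split=> [U|U V f u].
    by exists (@unit_inv U); [apply: unit_mapK | apply: unit_invK].
  apply: val_inj; apply/ffunP=> i; rewrite /= !ffunE; apply: val_inj.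
  by rewrite /= !linearZ.
exists (fun V => counit_map (V := V)); split=> [V|V W f v].
  by exists (@counit_inv V); [apply: counit_mapK | apply: counit_invK].
by apply: val_inj; apply: val_inj; apply/ffunP=> i; rewrite /= !ffunE linearZ.
Qed.

(** The inverse of the isomorphism [z |-> z e] from the centre of [A] to the
    centre of the corner. *)
Definition corner_extend (z : B) : A := \sum_j a j * iota z * b j.

(** Both sides expand to the same double sum after inserting the decomposition
    of 1 on either side of [x]. *)
Lemma corner_extend_central z : (forall x, z * x = x * z) ->
  forall x, corner_extend z * x = x * corner_extend z.
Proof.
move=> cz x; transitivity (\sum_i \sum_j a i * iota (z * theta (b i * x * a j)) * b j).
  rewrite /corner_extend mulr_suml; apply: eq_bigr => i _.
  rewrite -(mulrA _ (b i)) -[X in _ * X = _]mulr1 -(fc_full K) !mulr_sumr.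
  apply: eq_bigr => j _; rewrite fc_iotaM fc_thetaK !mulrA.
  by rewrite -(mulrA (a i) _ e) fc_iota_e.
rewrite exchange_big /corner_extend mulr_sumr; apply: eq_bigr => j _ /=.
rewrite -[x in RHS]mul1r -(fc_full K) !mulr_suml; apply: eq_bigr => i _.
by rewrite cz fc_iotaM fc_thetaK !mulrA -(mulrA _ e (iota z)) fc_e_iota.
Qed.

Lemma corner_extend_e z : (forall x, z * x = x * z) -> corner_extend z * e = iota z.
Proof.
move=> cz; have ce := corner_extend_central cz e.
rewrite -fc_ee mulrA ce /corner_extend mulr_sumr mulr_suml.
transitivity (\sum_j iota (z * (theta (a j) * theta (b j)))); last first.
  under eq_bigr do rewrite fc_iotaM.
  rewrite -mulr_sumr; under eq_bigr do rewrite -[a _]mul1r -[b _]mulr1.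
  rewrite -(big_morph iota (fc_iotaD K) fc_iota0) fc_theta_full mulr1 fc_theta1.
  by rewrite fc_iota1 fc_iota_e.
apply: eq_bigr => j _; rewrite mulrA cz -(mulrA (theta _)) -cz fc_iotaM fc_iotaM !fc_thetaK.
by rewrite !mulrA -(mulrA _ e (iota z)) fc_e_iota -(mulrA _ (iota z) e) fc_iota_e.
Qed.

End Corner.

(** * The group algebra of the hyperoctahedral group *)

Section Wreath.
Variable n : nat.
Local Notation points := ('I_n + 'I_n)%type.
Local Notation G := (hyperoctahedral n).
Implicit Types (X Y chi psi : {set 'I_n}) (s t : 'S_n) (i k : 'I_n).

Definition symd X Y := [set i | (i \in X) (+) (i \in Y)].

Definition wreath_fun X s (x : points) : points :=
  match x with
  | inl i => if i \in X then inr (s i) else inl (s i)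
  | inr i => if i \in X then inl (s i) else inr (s i)
  end.

Fact wreath_fun_inj X s : injective (wreath_fun X s).
Proof.
by case=> i [] j /=; do 2?case: ifP => //; move=> Xi Xj [] /perm_inj Eij //;
  rewrite ?Eij // in Xi Xj *; rewrite Xi in Xj.
Qed.

(** The permutation moving indices by [s] and changing the bar exactly on [X]. *)
Definition wreath X s : {perm points} := perm (@wreath_fun_inj X s).

Lemma wreathM X s Y t :
  (wreath X s * wreath Y t)%g = wreath (symd X (s @^-1: Y)) (s * t)%g.
Proof.
apply/permP=> x; rewrite permM !permE.
by case: x => i /=; rewrite !inE; case: (i \in X) => /=; case: ifP => /=; rewrite permM.
Qed.

Lemma wreath1 : wreath set0 1%g = 1%g.
Proof. by apply/permP=> -[] i; rewrite permE /= !inE perm1 ?perm1. Qed.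

Lemma wreath_in X s : wreath X s \in G.
Proof.
apply/cent1P/permP=> x; rewrite !permM !permE /=.
by case: x => i /=; case: ifP.
Qed.

Lemma wreath_inj X s Y t : wreath X s = wreath Y t -> X = Y /\ s = t.
Proof.
move/permP=> E; have E1 i : wreath_fun X s (inl i) = wreath_fun Y t (inl i).
  by have := E (inl i); rewrite !permE.
by split; [apply/setP=> i | apply/permP=> i]; have := E1 i; rewrite /=;
  case: ifP; case: ifP => // _ _ [].
Qed.

Lemma wreath_decomp g : g \in G -> g = wreath [set i | is_barred (g (inl i))] (top_perm g).
Proof.
move=> Gg; apply/permP; case=> i; rewrite permE /= inE topE //; first by case: (g (inl i)).
by rewrite -/(bar_fun (inl i)) hyp_bar //; case: (g (inl i)).
Qed.

Definition wr (Xs : {set 'I_n} * 'S_n) : subg_of G := subg G (wreath Xs.1 Xs.2).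

Lemma val_wr Xs : sgval (wr Xs) = wreath Xs.1 Xs.2.
Proof. by rewrite /wr subgK ?wreath_in. Qed.

Lemma wr_bij : bijective wr.
Proof.
exists (fun g : subg_of G => ([set i | is_barred ((sgval g : {perm points}) (inl i))], top_perm (sgval g))) => [[X s]|g].
  by have := wreath_decomp (wreath_in X s); rewrite val_wr /= => /wreath_inj[<- <-].
by apply: subg_inj; rewrite /= val_wr -wreath_decomp // subgP.
Qed.

Lemma wrM X s Y t : (wr (X, s) * wr (Y, t))%g = wr (symd X (s @^-1: Y), (s * t)%g).
Proof. by apply: subg_inj; rewrite sgvalM ?inE // !val_wr wreathM. Qed.

Lemma wr1 : wr (set0, 1%g) = 1%g.
Proof. by apply: subg_inj; rewrite val_wr wreath1. Qed.

Variable F : fieldType.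
Local Notation A := (group_algebra F (subg_of G)).

(** The pairing between the base group and its characters, both indexed by
    subsets; it is symmetric. *)
Definition sgn X (chi : {set 'I_n}) : F := \prod_(i < n) (-1) ^+ ((i \in X) && (i \in chi)).

Lemma sgn_symdl X Y chi : sgn (symd X Y) chi = sgn X chi * sgn Y chi.
Proof.
rewrite -big_split; apply: eq_bigr => i _ /=; rewrite inE.
by case: (i \in X) (i \in Y) (i \in chi) => [] [] []; rewrite ?expr0 ?expr1 ?mulr1 ?mul1r ?mulrNN ?mulr1.
Qed.

Lemma sgnC X Y : sgn X Y = sgn Y X.
Proof. by apply: eq_bigr => i _; rewrite andbC. Qed.

Lemma sgn_preim s X chi : sgn (s @^-1: X) (s @^-1: chi) = sgn X chi.
Proof.
rewrite [RHS](reindex_inj (@perm_inj _ s)); apply: eq_bigr => i _.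
by rewrite !inE.
Qed.

Lemma sgn0 chi : sgn set0 chi = 1.
Proof. by apply: big1 => i _; rewrite inE. Qed.

Lemma sgn_sq X chi : sgn X chi * sgn X chi = 1.
Proof.
rewrite -sgn_symdl (_ : symd X X = set0) ?sgn0 //.
by apply/setP=> i; rewrite !inE addbb.
Qed.

Hypothesis two_neq0 : 2%:R != 0 :> F.

(** Translation by an element on which the character is -1 changes the sign of
    the sum. *)
Lemma sgn_orth chi : \sum_X sgn X chi = 2%:R ^+ n *+ (chi == set0).
Proof.
have [->|/set0Pn[i chi_i]] := eqVneq chi set0.
  under eq_bigr do rewrite sgnC sgn0.
  by rewrite sumr_const -cardsT -powersetT card_powerset cardsT card_ord -natrX mulr1n.
rewrite mulr0n; apply/eqP; move: (two_neq0); apply: contraNT => nz.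
set S := \sum_X _ in nz; have : S = - S.
  have symK : involutive (symd [set i]) by move=> X; apply/setP=> j; rewrite !inE addKb.
  rewrite {1}/S (reindex_inj (inv_inj symK)) -sumrN; apply: eq_bigr => X _ /=.
  rewrite sgn_symdl; suff -> : sgn [set i] chi = -1 by rewrite mulN1r.
  rewrite /sgn (bigD1 i) //= inE eqxx chi_i big1 ?mulr1 // => j /negPf ji.
  by rewrite inE ji.
move/eqP; rewrite -addr_eq0 -mulr2n -(mulr_natl S) mulf_eq0 => /orP[//|E0].
by rewrite E0 in nz.
Qed.

Lemma symd_eq0 X Y : (symd X Y == set0) = (X == Y).
Proof.
apply/eqP/eqP=> [/setP E|->]; last by apply/setP=> i; rewrite !inE addbb.
by apply/setP=> i; have := E i; rewrite !inE; case: (i \in X); case: (i \in Y).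
Qed.

Definition dflip X : A := delta (wr (X, 1%g)).
Definition dtop s : A := delta (wr (set0, s)).

(** The idempotent of the character of the base group that is -1 on the
    transposition [(i \bar i)] exactly for [i] in [chi]. *)
Definition idem chi : A := (2%:R ^+ n)^-1 *: \sum_X sgn X chi *: dflip X.

Lemma delta_wrM X s Y t Z u : symd X (s @^-1: Y) = Z -> (s * t)%g = u ->
  delta (wr (X, s)) * delta (wr (Y, t)) = delta (wr (Z, u)) :> A.
Proof. by move=> <- <-; rewrite -wrM deltaM. Qed.

Lemma dflipM X Y : dflip X * dflip Y = dflip (symd X Y).
Proof.
apply: delta_wrM; last exact: mulg1.
by congr symd; apply/setP=> i; rewrite inE perm1.
Qed.

Lemma dflip_dtop X s : dflip X * dtop s = delta (wr (X, s)).
Proof.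
apply: delta_wrM; last exact: mul1g.
by apply/setP=> i; rewrite !inE addbF.
Qed.

Lemma dtopM s t : dtop (s * t)%g = dtop s * dtop t.
Proof. by apply/esym/delta_wrM => //; apply/setP=> i; rewrite !inE. Qed.

Lemma dtop1 : dtop 1%g = 1.
Proof. by rewrite /dtop wr1 delta1. Qed.

Lemma dtop_dflip s X : dtop s * dflip X = dflip (s @^-1: X) * dtop s.
Proof.
rewrite dflip_dtop; apply: delta_wrM; last exact: mulg1.
by apply/setP=> i; rewrite !inE.
Qed.

Lemma idem_dflip chi X : idem chi * dflip X = sgn X chi *: idem chi.
Proof.
rewrite /idem -scalerAl scalerA mulrC -scalerA; congr (_ *: _).
rewrite mulr_suml scaler_sumr.
have symK : involutive (symd X) by move=> Y; apply/setP=> j; rewrite !inE addKb.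
rewrite [RHS](reindex_inj (inv_inj symK)); apply: eq_bigr => Y _ /=.
rewrite -scalerAl dflipM sgn_symdl scalerA mulrA sgn_sq mul1r.
by congr (_ *: dflip _); apply/setP=> j; rewrite !inE addbC.
Qed.

Lemma idemM chi psi : idem chi * idem psi = idem chi *+ (chi == psi).
Proof.
rewrite [idem psi]/idem -scalerAr mulr_sumr.
under eq_bigr do rewrite -scalerAr idem_dflip scalerA mulrC sgnC [sgn _ psi]sgnC -sgn_symdl sgnC.
rewrite -scaler_suml sgn_orth scalerA symd_eq0; case: eqP => _; last by rewrite mulr0 scale0r.
by rewrite !mulr1n mulVf ?scale1r // expf_neq0.
Qed.

Lemma idem_sum : \sum_chi idem chi = 1.
Proof.
rewrite /idem -scaler_sumr exchange_big /=.
under eq_bigr => X _ do [rewrite -scaler_suml; under eq_bigr do rewrite sgnC; rewrite sgn_orth].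
rewrite (bigD1 set0) //= eqxx big1 => [|X /negPf->]; last by rewrite scale0r.
by rewrite addr0 scalerA mulVf ?expf_neq0 // scale1r /dflip wr1 delta1.
Qed.

Lemma dtop_idem s chi : dtop s * idem chi = idem (s @^-1: chi) * dtop s.
Proof.
rewrite /idem -(scalerAr _ (dtop s)) -(scalerAl _ _ (dtop s)); congr (_ *: _).
rewrite mulr_suml mulr_sumr.
have inj_s : injective (fun X : {set 'I_n} => s @^-1: X).
  move=> X Y /setP E; apply/setP=> i; have := E (s^-1 i)%g.
  by rewrite !inE permKV.
rewrite [RHS](reindex_inj inj_s); apply: eq_bigr => X _ /=.
by rewrite -(scalerAr _ (dtop s)) -(scalerAl _ _ (dtop s)) dtop_dflip sgn_preim.
Qed.

End Wreath.

Section YoungCorner.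
Variables (a b n : nat) (En : (a + b)%N = n).
Implicit Types (k : 'I_n) (st : 'S_a * 'S_b).
Local Notation low := (low En).
Local Notation high := (high En).

Lemma split_low i : split (cast_ord (esym En) (low i)) = inl i.
Proof. by rewrite cast_ordK -[lshift b i]/(unsplit (inl i)) unsplitK. Qed.

Lemma split_high j : split (cast_ord (esym En) (high j)) = inr j.
Proof. by rewrite cast_ordK -[rshift a j]/(unsplit (inr j)) unsplitK. Qed.

Lemma low_high k : (exists i, k = low i) \/ (exists j, k = high j).
Proof.
have := splitK (cast_ord (esym En) k); case: (split _) => x /= Ex; [left | right];
  by exists x; apply: (can_inj (cast_ordK (esym En))); rewrite -Ex cast_ordK.
Qed.

Definition young_fun st k :=
  match split (cast_ord (esym En) k) with
  | inl i => low (st.1 i)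
  | inr j => high (st.2 j)
  end.

Lemma young_fun_low st i : young_fun st (low i) = low (st.1 i).
Proof. by rewrite /young_fun split_low. Qed.

Lemma young_fun_high st j : young_fun st (high j) = high (st.2 j).
Proof. by rewrite /young_fun split_high. Qed.

Lemma low_inj : injective low.
Proof. by move=> i j E; have := split_low i; rewrite E split_low => -[]. Qed.

Lemma high_inj : injective high.
Proof. by move=> i j E; have := split_high i; rewrite E split_high => -[]. Qed.

Lemma low_neq_high i j : low i <> high j.
Proof. by move=> E; have := split_low i; rewrite E split_high. Qed.

Fact young_fun_inj st : injective (young_fun st).
Proof.
move=> k l; case: (low_high k) => -[x ->]; case: (low_high l) => -[y ->];
  rewrite ?young_fun_low ?young_fun_high.
- by move/low_inj/perm_inj->.
- by move/low_neq_high.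
- by move/esym/low_neq_high.
by move/high_inj/perm_inj->.
Qed.

Definition young st : 'S_n := perm (@young_fun_inj st).

Lemma young_low st i : young st (low i) = low (st.1 i).
Proof. by rewrite permE young_fun_low. Qed.

Lemma young_high st j : young st (high j) = high (st.2 j).
Proof. by rewrite permE young_fun_high. Qed.

Lemma youngM st st' : young (st * st')%g = (young st * young st')%g.
Proof.
apply/permP=> k; rewrite permM; case: (low_high k) => -[x ->].
  by rewrite !young_low /= permM.
by rewrite !young_high /= permM.
Qed.

Lemma young1 : young 1%g = 1%g.
Proof.
apply/permP=> k; rewrite perm1; case: (low_high k) => -[x ->].
  by rewrite young_low /= perm1.
by rewrite young_high /= perm1.
Qed.

Lemma young_inj : injective young.
Proof.
move=> [s t] [s' t'] /permP E; congr (_, _); apply/permP=> x.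
  by have := E (low x); rewrite !young_low => /low_inj.
by have := E (high x); rewrite !young_high => /high_inj.
Qed.

(** As a character of the base group, this is the orbit representative whose
    stabilizer in the top group is a Young subgroup. *)
Definition upper (m : nat) : {set 'I_n} := [set k : 'I_n | (m <= k)%N].

Lemma low_upper i : (low i \in upper a) = false.
Proof. by rewrite inE /= leqNgt ltn_ord. Qed.

Lemma high_upper j : high j \in upper a.
Proof. by rewrite inE /= leq_addr. Qed.

Lemma young_upper st : young st @^-1: upper a = upper a.
Proof.
apply/setP=> k; rewrite inE; case: (low_high k) => -[x ->].
  by rewrite young_low !low_upper.
by rewrite young_high !high_upper.
Qed.

Lemma young_ex (s : 'S_n) : s @^-1: upper a = upper a -> exists st, s = young st.
Proof.
move/setP=> sU.
have /fin_all_exists[f fP] i : exists i', s (low i) = low i'.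
  case: (low_high (s (low i))) => -[x Ex]; first by exists x.
  by have := sU (low i); rewrite inE Ex high_upper low_upper.
have /fin_all_exists[g gP] j : exists j', s (high j) = high j'.
  case: (low_high (s (high j))) => -[x Ex]; last by exists x.
  by have := sU (high j); rewrite inE Ex high_upper low_upper.
have inj_f : injective f by move=> i j E; apply/low_inj/(@perm_inj _ s); rewrite !fP E.
have inj_g : injective g by move=> i j E; apply/high_inj/(@perm_inj _ s); rewrite !gP E.
exists (perm inj_f, perm inj_g); apply/permP=> k; case: (low_high k) => -[x ->].
  by rewrite young_low fP permE.
by rewrite young_high gP permE.
Qed.

(** This is how elements over Young permutations act on hyperoctahedral Specht
    modules, which are induced from joins. *)
Lemma wreath_young (Z : {set 'I_n}) st :
  wreath Z (young st) = join_perm En (wreath (low @^-1: Z) st.1, wreath (high @^-1: Z) st.2).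
Proof.
apply/permP=> x; rewrite !permE /join_fun /=.
case: x => k; case: (low_high k) => -[y ->] /=; rewrite ?split_low ?split_high ?young_low ?young_high permE /= inE;
  by case: ifP.
Qed.

Variable F : fieldType.
Hypothesis two_neq0 : 2%:R != 0 :> F.
Local Notation A := (group_algebra F (subg_of (hyperoctahedral n))).
Local Notation C := (group_algebra F ('S_a * 'S_b)%type).
Local Notation E := (idem F (upper a)).

Definition embed (y : C) : A := \sum_st y st *: dtop F (young st).

Lemma embedD y y' : embed (y + y') = embed y + embed y'.
Proof. by rewrite -big_split; apply: eq_bigr => st _; rewrite ffunE scalerDl. Qed.

Lemma embedZ c y : embed (c *: y) = c *: embed y.
Proof. by rewrite scaler_sumr; apply: eq_bigr => st _; rewrite ga_scaleE scalerA. Qed.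

Lemma embed0 : embed 0 = 0.
Proof. by apply: big1 => st _; rewrite ffunE scale0r. Qed.

Lemma embed_sum I r (P : pred I) (f : I -> C) :
  embed (\sum_(i <- r | P i) f i) = \sum_(i <- r | P i) embed (f i).
Proof. exact: (big_morph embed embedD embed0). Qed.

Lemma embed_delta st : embed (delta st) = dtop F (young st).
Proof.
rewrite /embed (bigD1 st) //= ffunE eqxx scale1r big1 ?addr0 // => st' /negPf neq.
by rewrite ffunE neq scale0r.
Qed.

Lemma embedM y y' : embed (y * y') = embed y * embed y'.
Proof.
rewrite {1}[y]ga_sum {1}[y']ga_sum mulr_suml embed_sum mulr_suml; apply: eq_bigr => g _.
rewrite mulr_sumr embed_sum mulr_sumr; apply: eq_bigr => h _.
rewrite -!scalerAl -!scalerAr !embedZ -deltaM embed_delta youngM dtopM.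
by [].
Qed.

Lemma embed1 : embed 1 = 1.
Proof. by rewrite -delta1 embed_delta young1 dtop1. Qed.

Lemma embed_idem y : embed y * E = E * embed y.
Proof.
rewrite mulr_suml mulr_sumr; apply: eq_bigr => st _.
by rewrite -scalerAl -[RHS]scalerAr dtop_idem young_upper.
Qed.

(** The coefficient of [E * embed y] at the top group element of [st] is [y st]
    divided by [2 ^ n]. *)
Lemma idem_embed_inj y y' : E * embed y = E * embed y' -> y = y'.
Proof.
have coef z st : (E * embed z) (wr (set0, young st)) = (2%:R ^+ n)^-1 * z st.
  rewrite /idem -scalerAl ga_scaleE; congr (_ * _).
  rewrite mulr_suml sum_ffunE (bigD1 set0) //= big1 ?addr0 => [|X X0].
    rewrite -scalerAl ga_scaleE sgn0 mul1r mulr_sumr sum_ffunE (bigD1 st) //= big1 ?addr0.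
      by rewrite -scalerAr ga_scaleE dflip_dtop ffunE eqxx mulr1.
    move=> st' neq; rewrite -scalerAr ga_scaleE dflip_dtop ffunE (bij_eq (wr_bij n)) xpair_eqE eqxx /=.
    by rewrite (inj_eq young_inj) eq_sym (negPf neq) mulr0.
  rewrite -scalerAl ga_scaleE mulr_sumr sum_ffunE big1 ?mulr0 // => st' _.
  rewrite -scalerAr ga_scaleE dflip_dtop ffunE (bij_eq (wr_bij n)) xpair_eqE eq_sym (negPf X0).
  by rewrite mulr0.
move=> Eyy; apply/ffunP=> st; have := coef y st; rewrite Eyy coef => /mulfI->//.
by rewrite invr_eq0 expf_neq0.
Qed.

(** The element representing [E * x * E] in the group algebra of the Young
    subgroup, see [compressK]. *)
Definition compress (x : A) : C :=
  [ffun st => \sum_X sgn F X (upper a) * x (wr (X, young st))].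

Lemma compressD x y : compress (x + y) = compress x + compress y.
Proof.
apply/ffunP=> st; rewrite !ffunE -big_split; apply: eq_bigr => X _ /=.
by rewrite ffunE mulrDr.
Qed.

Lemma wr_sum (x : A) : x = \sum_(s : 'S_n) \sum_(X : {set 'I_n}) x (wr (X, s)) *: (dflip F X * dtop F s).
Proof.
rewrite {1}[x]ga_sum (reindex (@wr n)) /=; last exact: onW_bij (wr_bij n).
rewrite exchange_big pair_big /=; apply: eq_bigr => -[X s] _ /=.
by rewrite dflip_dtop.
Qed.

Lemma idem_wr_idem (chi psi X : {set 'I_n}) (s : 'S_n) :
  idem F chi * (dflip F X * dtop F s) * idem F psi =
  sgn F X chi *: (idem F chi * dtop F s) *+ (chi == s @^-1: psi).
Proof.
rewrite mulrA idem_dflip -[X in X * _ = _]scalerAl -[LHS]scalerAl -mulrA dtop_idem mulrA idemM //.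
by case: eqP => _; rewrite ?mulr1n ?mulr0n // mul0r scaler0.
Qed.

(** Only the permutations fixing the character survive between two copies of
    [E], and those are the Young permutations by [young_ex]. *)
Lemma compressK x : E * x * E = E * embed (compress x).
Proof.
rewrite {1}[x]wr_sum mulr_sumr mulr_suml.
transitivity (\sum_(s in young @: setT) \sum_(X : {set 'I_n}) (x (wr (X, s)) * sgn F X (upper a)) *: (E * dtop F s)).
  rewrite [RHS]big_mkcond; apply: eq_bigr => s _; rewrite mulr_sumr mulr_suml.
  have -> : (s \in young @: setT) = (upper a == s @^-1: upper a).
    apply/imsetP/eqP => [[st _ ->]|/esym/young_ex[st ->]]; first by rewrite young_upper.
    by exists st.
  have termE X : E * (x (wr (X, s)) *: (dflip F X * dtop F s)) * E =
      (x (wr (X, s)) * sgn F X (upper a)) *: (E * dtop F s) *+ (upper a == s @^-1: upper a).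
    by rewrite -[X in X * E]scalerAr -[LHS]scalerAl idem_wr_idem // scalerMnr scalerA scalerMnr.
  under eq_bigr do rewrite termE.
  by case: eqP => _; [apply: eq_bigr => X _; rewrite mulr1n | apply: big1].
rewrite big_imset /=; last by move=> st st' _ _; apply: young_inj.
rewrite mulr_sumr (eq_bigl predT) => [|st]; last by rewrite inE.
apply: eq_bigr => st _; rewrite -scaler_suml -scalerAr ffunE; congr (_ *: _).
by apply: eq_bigr => X _; rewrite mulrC.
Qed.

Lemma compress_central (z : A) : central z -> central (compress z).
Proof.
move=> /centralP cz; apply/centralP => g h; rewrite !ffunE.
have inj_h : injective (fun X : {set 'I_n} => young h^-1%g @^-1: X).
  move=> X Y /setP Ex; apply/setP=> i; have := Ex ((young h^-1%g)^-1 i)%g.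
  by rewrite !inE permKV.
rewrite (reindex_inj inj_h); apply: eq_bigr => X _ /=.
rewrite -{1}(young_upper h^-1%g) sgn_preim; congr (_ * _).
rewrite -[RHS](cz _ (wr (set0, young h))); congr (z _).
apply: (mulgI (wr (set0, young h))); rewrite -[RHS]conjgC !wrM -!youngM -conjgC.
congr (wr (_, _)); apply/setP=> k; rewrite !inE addbF.
by rewrite -permM -youngM mulgV young1 perm1.
Qed.
End YoungCorner.

Section HyperoctahedralCorner.
Variables (F : fieldType) (n : nat).
Local Notation A := (group_algebra F (subg_of (hyperoctahedral n))).
Local Notation B :=
  (direct_sum (fun i : 'I_n.+1 => group_algebra F ('S_i * 'S_(n - i))%type)).
Implicit Types (i j : 'I_n.+1) (x : A) (y : B).

Lemma young_size i : (i + (n - i))%N = n.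
Proof. by rewrite subnKC // -ltnS. Qed.

Local Notation E i := (idem F (upper n i)).

Definition hyp_e : A := \sum_(i < n.+1) E i.
Definition hyp_iota y : A := \sum_(i < n.+1) E i * embed (young_size i) (y i).
Definition hyp_theta x : B := finfun (fun i : 'I_n.+1 => compress (young_size i) x).

Lemma card_upper m : (m <= n)%N -> #|upper n m| = (n - m)%N.
Proof.
move=> le_mn; have := cardsC (upper n m); rewrite card_ord.
suff -> : #|~: upper n m| = m by lia.
rewrite -sum1_card (eq_bigl (fun k : 'I_n => (k < m)%N)) => [|k]; last first.
  by rewrite !inE ltnNge.
by rewrite -(big_ord_widen n (fun _ => 1%N) le_mn) sum1_card card_ord.
Qed.

Lemma upper_eq i j : (upper n i == upper n j) = (i == j).
Proof.
apply/eqP/eqP=> [Eij|->//]; apply/val_inj; have := congr1 (fun X : {set 'I_n} => #|X|) Eij.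
have [li lj] : (i <= n)%N /\ (j <= n)%N by split; rewrite -ltnS ltn_ord.
by rewrite /= !card_upper // => ?; lia.
Qed.

(** Subsets of equal size are related by a permutation. *)
Lemma upper_transitive (chi : {set 'I_n}) : exists (s : 'S_n) i, s @^-1: upper n i = chi.
Proof.
pose i : 'I_n.+1 := inord (n - #|chi|).
have le_chi : (#|chi| <= n)%N by rewrite -[X in (_ <= X)%N](card_ord n) max_card.
have Ei : i = (n - #|chi|)%N :> nat by rewrite inordK // ltnS leq_subr.
have card_i : #|upper n i| = #|chi| by rewrite card_upper Ei ?leq_subr // subKn.
have [chi0|/set0Pn[k0 k0chi]] := eqVneq chi set0.
  exists 1%g, i; apply/setP=> k; rewrite chi0 !inE perm1.
  have : upper n i == set0 by rewrite -cards_eq0 card_i chi0 cards0.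
  by move/eqP/setP/(_ k); rewrite !inE.
pose h k := nth k0 (enum (upper n i)) (index k (enum chi)).
have ix k : k \in chi -> (index k (enum chi) < size (enum (upper n i)))%N.
  by move=> kc; rewrite -cardE card_i cardE index_mem mem_enum.
have inj_h : {in chi &, injective h}.
  move=> k l kc lc /eqP; rewrite nth_uniq ?enum_uniq ?ix // => /eqP E.
  by rewrite -(nth_index k0 (x := k) (s := enum chi)) ?mem_enum // E nth_index ?mem_enum.
have [s sh] := perm_extend inj_h; exists s, i; apply/esym/eqP; rewrite eqEcard.
rewrite card_preimset ?card_i ?leqnn ?andbT; last exact: perm_inj.
apply/subsetP=> k kc; rewrite inE sh // -mem_enum; apply: mem_nth; exact: ix.
Qed.

Hypothesis two_neq0 : 2%:R != 0 :> F.

Lemma hyp_idemM i j : E i * E j = E i *+ (i == j).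
Proof. by rewrite idemM // upper_eq. Qed.

Lemma idem_hyp_e i : E i * hyp_e = E i.
Proof.
rewrite /hyp_e mulr_sumr (bigD1 i) //= hyp_idemM eqxx big1 ?addr0 // => j ij.
by rewrite hyp_idemM eq_sym (negPf ij).
Qed.

Lemma idem_iota i y : E i * hyp_iota y = E i * embed (young_size i) (y i).
Proof.
rewrite /hyp_iota mulr_sumr (bigD1 i) //= mulrA hyp_idemM eqxx big1 ?addr0 // => j ij.
by rewrite mulrA hyp_idemM eq_sym (negPf ij) mul0r.
Qed.

Lemma hyp_iotaD : {morph hyp_iota : y y' / y + y'}.
Proof.
move=> y y'; rewrite /hyp_iota -big_split; apply: eq_bigr => i _ /=.
by rewrite ffunE embedD mulrDr.
Qed.

Lemma hyp_iotaM : {morph hyp_iota : y y' / y * y'}.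
Proof.
move=> y y'; rewrite {2}/hyp_iota mulr_suml; apply: eq_bigr => i _.
rewrite ffunE embedM mulrA -!embed_idem // -!mulrA idem_iota.
by rewrite mulrA embed_idem // -!mulrA mulrA.
Qed.

Lemma hyp_iota1 : hyp_iota 1 = hyp_e.
Proof. by apply: eq_bigr => i _; rewrite ffunE embed1 mulr1. Qed.

Lemma hyp_iota_inj : injective hyp_iota.
Proof.
move=> y y' Ey; apply/ffunP=> i; apply: (idem_embed_inj (En := young_size i) two_neq0).
by rewrite -!idem_iota Ey.
Qed.

Lemma hyp_thetaD : {morph hyp_theta : x x' / x + x'}.
Proof. by move=> x x'; apply/ffunP=> i; rewrite !ffunE compressD. Qed.

(** Different [i] and [j] belong to different orbits of the top group on the
    characters of the base group. *)
Lemma idem_neq_mul i j x : i != j -> E i * x * E j = 0.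
Proof.
move=> ij; rewrite [x]wr_sum mulr_sumr mulr_suml big1 // => s _.
rewrite mulr_sumr mulr_suml big1 // => X _.
rewrite -[X in X * _]scalerAr -[LHS]scalerAl idem_wr_idem //.
case: eqP => [Eij|_]; last by rewrite mulr0n scaler0.
have li : (i <= n)%N by rewrite -ltnS. have lj : (j <= n)%N by rewrite -ltnS.
have := congr1 (fun X : {set 'I_n} => #|X|) Eij; rewrite /= card_preimset; last exact: perm_inj.
rewrite !card_upper // => Enij; case/eqP: ij; apply/val_inj => /=; lia.
Qed.

Lemma hyp_thetaK x : hyp_iota (hyp_theta x) = hyp_e * x * hyp_e.
Proof.
rewrite {1}/hyp_e mulr_suml mulr_suml; apply: eq_bigr => i _.
rewrite [in RHS]/hyp_e [RHS]mulr_sumr [RHS](bigD1 i) //= [X in _ = _ + X]big1 ?addr0 => [|j ij]; last by rewrite idem_neq_mul // eq_sym.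
by rewrite ffunE (compressK (young_size i) two_neq0).
Qed.

Lemma hyp_e_iota y : hyp_e * hyp_iota y = hyp_iota y.
Proof.
rewrite {1}/hyp_e mulr_suml; apply: eq_bigr => i _; exact: idem_iota.
Qed.

Lemma hyp_iota_e y : hyp_iota y * hyp_e = hyp_iota y.
Proof. by rewrite -hyp_iota1 -hyp_iotaM mulr1. Qed.

Lemma hyp_iotaK : cancel hyp_iota hyp_theta.
Proof.
by move=> y; apply: hyp_iota_inj; rewrite hyp_thetaK hyp_e_iota hyp_iota_e.
Qed.

(** Fullness holds since every idempotent of the base group is conjugate to some
    [E i], and these idempotents add up to 1. *)
Lemma hyp_full_corner : exists K : full_corner A B {set 'I_n},
  [/\ fc_e K = hyp_e, fc_iota K = hyp_iota & fc_theta K = hyp_theta].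
Proof.
have /fin_all_exists[s /fin_all_exists[i si]] := upper_transitive.
have full : \sum_chi dtop F (s chi) * E (i chi) * hyp_e * dtop F (s chi)^-1 = 1.
  rewrite -(idem_sum n two_neq0); apply: eq_bigr => chi _.
  rewrite -(mulrA (dtop _ _)) idem_hyp_e dtop_idem -mulrA -dtopM mulgV dtop1 mulr1.
  by rewrite si.
by exists (FullCorner hyp_iotaD hyp_iotaM hyp_iota1 hyp_thetaD hyp_thetaK hyp_iotaK full).
Qed.

Lemma hyp_morita : morita_equivalent A B.
Proof. by have [K _] := hyp_full_corner; apply: full_corner_morita K. Qed.

End HyperoctahedralCorner.

(** * Weights of hyperoctahedral modules *)

Section PullAction.
Variables (F : fieldType) (T T' : finGroupType) (V : lmodType F).
Variables (f : T' -> T) (r : right_action T V).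
Hypotheses (f1 : f 1%g = 1%g) (fM : {morph f : g h / (g * h)%g}).

Fact pull_linear g : linear (fun v => r (f g) v).
Proof. exact: ract_linear. Qed.
Fact pull1 v : r (f 1%g) v = v. Proof. by rewrite f1 ract1. Qed.
Fact pullM g h v : r (f (g * h)%g) v = r (f h) (r (f g) v).
Proof. by rewrite fM ractM. Qed.
Definition pull_action : right_action T' V := RightAction pull_linear pull1 pullM.
End PullAction.

Section RegularAction.
Variables (F : fieldType) (T : finGroupType).
Local Notation A := (group_algebra F T).
Fact regular_linear g : linear (fun x : A => x * delta g).
Proof. by move=> c x y; rewrite mulrDl scalerAl. Qed.
Fact regular1 (x : A) : x * delta 1%g = x. Proof. by rewrite delta1 mulr1. Qed.
Fact regularM g h (x : A) : x * delta (g * h)%g = x * delta g * delta h.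
Proof. by rewrite deltaM mulrA. Qed.
Definition regular_action : right_action T A := RightAction regular_linear regular1 regularM.

Lemma ract_regular a x : ract_ga regular_action a x = x * a.
Proof.
rewrite {2}[a]ga_sum mulr_sumr; apply: eq_bigr => g _ /=.
by rewrite scalerAr.
Qed.
End RegularAction.

Section Weights.
Variables (F : fieldType) (n : nat).
Local Notation gT := (subg_of (hyperoctahedral n)).
Local Notation A := (group_algebra F gT).

Lemma wr_top1 a b (En : (a + b)%N = n) : wr (set0, young En 1%g) = 1%g.
Proof. by rewrite young1 wr1. Qed.

Lemma wr_topM a b (En : (a + b)%N = n) (g h : 'S_a * 'S_b) :
  wr (set0, young En (g * h)%g) = (wr (set0, young En g) * wr (set0, young En h))%g.
Proof. by rewrite wrM -youngM; congr (wr (_, _)); apply/setP=> k; rewrite !inE. Qed.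

Section Action.
Variables (a b : nat) (En : (a + b)%N = n) (V : lmodType F) (r : right_action gT V).

Definition young_action : right_action ('S_a * 'S_b)%type V :=
  pull_action r (wr_top1 En) (wr_topM En).

Fact pairl1 : ((1, 1) : 'S_a * 'S_b)%g = 1%g. Proof. by []. Qed.
Fact pairlM : {morph (fun s : 'S_a => (s, 1%g) : 'S_a * 'S_b) : g h / (g * h)%g}.
Proof. by move=> g h; congr (_, _); rewrite /= mulg1. Qed.
Fact pairrM : {morph (fun t : 'S_b => (1%g, t) : 'S_a * 'S_b) : g h / (g * h)%g}.
Proof. by move=> g h; congr (_, _); rewrite /= mulg1. Qed.

Definition low_action : right_action 'S_a V := pull_action young_action pairl1 pairlM.
Definition high_action : right_action 'S_b V := pull_action young_action pairl1 pairrM.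

(** The vector [v] affords the character of the base group that is -1 on the
    last [b] coordinates, and Jucys-Murphy eigenvalues [ra], [rb] (up to order)
    for the two factors of the Young subgroup fixing this character. *)
Definition is_weight v (ra rb : seq F) :=
  [/\ forall X, r (wr (X, 1%g)) v = sgn F X (upper n a) *: v,
      exists2 wa, weight_vector low_action wa v & perm_eq (codom wa) ra &
      exists2 wb, weight_vector high_action wb v & perm_eq (codom wb) rb].

Lemma young_actionE s t v : young_action (s, t) v = high_action t (low_action s v).
Proof.
rewrite /= -ractM -wr_topM; congr (r (wr (_, young En _)) v).
by congr (_, _); rewrite /= ?mulg1 ?mul1g.
Qed.

Lemma low_highC s t v :
  low_action s (high_action t v) = high_action t (low_action s v).
Proof.
rewrite -young_actionE /= -ractM -wr_topM; congr (r (wr (_, young En _)) v).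
by congr (_, _); rewrite /= ?mulg1 ?mul1g.
Qed.

Hypothesis two_neq0 : 2%:R != 0 :> F.

Lemma weight_idem v : (forall X, r (wr (X, 1%g)) v = sgn F X (upper n a) *: v) ->
  ract_ga r (idem F (upper n a)) v = v.
Proof.
move=> vX; rewrite /idem ract_gaZ ract_ga_sum.
under eq_bigr do rewrite ract_gaZ ract_delta vX scalerA sgn_sq.
rewrite -scaler_suml sumr_const -cardsT -powersetT card_powerset cardsT card_ord.
by rewrite scalerA natrX mulVf ?scale1r // expf_neq0.
Qed.

Lemma ract_embed y v : ract_ga r (embed En y) v = ract_ga young_action y v.
Proof.
rewrite /embed ract_ga_sum; apply: eq_bigr => st _.
by rewrite ract_gaZ ract_delta.
Qed.

(** The second factor is summed last, so that the first one may be replaced by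
    scalars depending on [t]. *)
Lemma ract_young y v :
  ract_ga young_action y v = \sum_t high_action t (ract_ga low_action [ffun s => y (s, t)] v).
Proof.
under eq_bigr do rewrite /ract_ga linear_sum /=.
rewrite exchange_big pair_big; apply: eq_bigr => -[s t] _.
rewrite /= ffunE linearZ; congr (_ *: _); exact: young_actionE.
Qed.

Lemma ract_central_weight z v : central z ->
  (forall X, r (wr (X, 1%g)) v = sgn F X (upper n a) *: v) ->
  ract_ga r z v = ract_ga young_action (compress En z) v.
Proof.
move=> cz vX; have Ev := weight_idem vX; rewrite -ract_embed.
have Ez : idem F (upper n a) * z * idem F (upper n a) = idem F (upper n a) * z.
  by rewrite -mulrA cz mulrA idemM // eqxx mulr1n.
by rewrite -{1}Ev -[in RHS]Ev -!ract_gaM -compressK // Ez.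
Qed.
End Action.

Hypothesis two_neq0 : 2%:R != 0 :> F.

(** Central elements act on weight vectors by scalars that only depend on the
    multisets [ra] and [rb]: the scalar for the first factor is a class function
    on the second factor, and both are handled by [centre_jm]. *)
Lemma central_scalar a b (En : (a + b)%N = n) (V V' : lmodType F)
    (r : right_action gT V) (r' : right_action gT V') v v' ra rb (z : A) :
  is_weight En r v ra rb -> v != 0 -> is_weight En r' v' ra rb -> central z ->
  exists c, ract_ga r z v = c *: v /\ ract_ga r' z v' = c *: v'.
Proof.
case=> vX [wa wav wa_ra] [wb wbv wb_rb] nz [v'X [wa' wav' wa'_ra] [wb' wb'v wb'_rb]] cz.
rewrite !(ract_central_weight En two_neq0) // !ract_young.
set y := compress En z; have cy : central y by apply: compress_central.
pose yt t : group_algebra F 'S_a := [ffun s => y (s, t)].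
have cyt t : central (yt t).
  apply/centralP=> g h; rewrite ![yt t _]ffunE -(proj1 (centralP y) cy (g, t) (h, 1%g)).
  by rewrite !conjgE; congr (y (_, _)); rewrite /= ?invg1 ?mul1g ?mulg1.
have /fin_all_exists[f fP] t : exists f, sympoly f /\ yt t = jm_eval f.
  by have [f sf Ef] := centre_jm (cyt t); exists f.
pose P : group_algebra F 'S_b := [ffun t => poly_eval (f t) wa].
have actP (W : lmodType F) (q : right_action gT W) w wq :
    weight_vector (low_action En q) wq w -> perm_eq (codom wq) (codom wa) ->
    \sum_t high_action En q t (ract_ga (low_action En q) [ffun s => y (s, t)] w) =
    ract_ga (high_action En q) P w.
  move=> wqw wq_wa; apply: eq_bigr => t _; rewrite -/(yt t).
  have [sft ->] := fP t; rewrite (weight_jm_eval _ wqw) linearZ ffunE.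
  by rewrite (poly_eval_sym sft wq_wa).
rewrite (actP _ _ v wa) // (actP _ _ v' wa') //; last by rewrite (perm_trans wa'_ra) // perm_sym.
have cP : central P.
  apply/centralP=> g h; rewrite ![P _]ffunE.
  have Eyt : yt (g ^ h)%g = yt g.
    apply/ffunP=> s; rewrite ![yt _ _]ffunE -(proj1 (centralP y) cy (s, g) (1%g, h)).
    by rewrite !conjgE; congr (y (_, _)); rewrite /= ?invg1 ?mul1g ?mulg1.
  have [[sg Eg] [sgh Egh]] := (fP g, fP (g ^ h)%g).
  have := weight_jm_eval (f (g ^ h)%g) wav; rewrite -Egh Eyt Eg (weight_jm_eval _ wav).
  move/eqP; rewrite -subr_eq0 -scalerBl scaler_eq0 (negPf nz) orbF subr_eq0.
  by move/eqP.
have [f' sf' EP] := centre_jm cP; exists (poly_eval f' wb).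
rewrite EP (weight_jm_eval _ wbv) (weight_jm_eval _ wb'v); split=> //.
by rewrite (poly_eval_sym sf' (_ : perm_eq (codom wb') (codom wb))) // (perm_trans wb'_rb) // perm_sym.
Qed.

End Weights.

Section SeparatingPolynomials.
Variables (F : fieldType) (n : nat).
Hypothesis n_gt1 : (1 < n)%N.

Let e0 : 'I_n := Ordinal (ltnW n_gt1).
Let e1 : 'I_n := Ordinal n_gt1.

(** The exponent vector of the product of the variables outside [J]; having the
    exponent 1 available needs at least two variables. *)
Definition square_free (J : {set 'I_n}) : expts n := [ffun i => if i \in J then e0 else e1].

(** Up to sign, the elementary symmetric polynomial of degree [n - k]. *)
Definition elementary (k : nat) : {ffun expts n -> F} :=
  [ffun E => \sum_(J : {set 'I_n} | (#|J| == k) && (square_free J == E)) (-1) ^+ (n - k)].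

Lemma elementary_sym k : sympoly (elementary k).
Proof.
move=> p E; rewrite !ffunE.
have inj_p : injective (fun J : {set 'I_n} => p @^-1: J).
  move=> X Y /setP Exy; apply/setP=> i; have := Exy (p^-1 i)%g.
  by rewrite !inE permKV.
rewrite (reindex_inj inj_p); apply: eq_bigl => J.
rewrite card_preimset; last exact: perm_inj.
congr (_ && _); apply/eqP/eqP => /ffunP E1; apply/ffunP=> i.
  by have := E1 (p^-1 i)%g; rewrite !ffunE inE permKV.
by rewrite !ffunE -E1 ffunE inE.
Qed.

Lemma poly_eval_elementary k (a : 'I_n -> F) :
  poly_eval (elementary k) a = (\prod_i ('X - (a i)%:P))`_k.
Proof.
have -> : \prod_i ('X - (a i)%:P) =
    \sum_(J : {set 'I_n}) ((-1) ^+ (n - #|J|) * \prod_i a i ^+ square_free J i) *: 'X^#|J|.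
  rewrite bigA_distr; apply: eq_bigr => J _.
  transitivity (\prod_i (if i \in J then 'X else (-1)%:P * (a i)%:P)).
    by apply: eq_bigr => i _; rewrite polyCN mulN1r.
  rewrite (bigID (mem J)) /= [X in X * _](eq_bigr (fun _ => 'X)); last by move=> i ->.
  rewrite prodr_const [X in _ * X](eq_bigr (fun i => (-1)%:P * (a i)%:P)); last by move=> i /negPf->.
  rewrite big_split /= prodr_const (eq_card (B := mem (~: J))) => [|i]; last by rewrite !inE.
  rewrite -!rmorphXn /= -rmorph_prod -polyCM mulrC mul_polyC; congr (_ *: _).
  have -> : #|~: J| = (n - #|J|)%N by have := cardsC J; rewrite card_ord; lia.
  congr (_ * _); rewrite [RHS](bigID (mem J)) /= [X in _ = X * _]big1 ?mul1r => [|i iJ].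
    by apply: eq_bigr => i /negPf iJ; rewrite ffunE iJ expr1.
  by rewrite ffunE iJ expr0.
rewrite coef_sum /poly_eval.
under eq_bigr do rewrite ffunE mulr_suml.
rewrite (exchange_big_dep (fun J : {set 'I_n} => #|J| == k)) /=; last by move=> E J _ /andP[].
rewrite big_mkcond; apply: eq_bigr => J _; rewrite coefZ coefXn eq_sym.
case: eqP => [Ek|_]; last by rewrite mulr0.
by rewrite (big_pred1 (square_free J)) ?mulr1 ?Ek // => E; rewrite eq_sym.
Qed.

(** The elementary symmetric polynomials are the coefficients of the monic
    polynomial with the given roots. *)
Lemma sympoly_separate (a b : 'I_n -> F) :
  (forall f, sympoly f -> poly_eval f a = poly_eval f b) -> perm_eq (codom a) (codom b).
Proof.
move=> E; apply: prod_XsubC_eq; rewrite !big_image /=.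
apply/polyP=> k; rewrite -!poly_eval_elementary.
by apply: E; apply: elementary_sym.
Qed.
End SeparatingPolynomials.

Section IdealWeights.
Variables (F : fieldType) (n : nat).
Local Notation gT := (subg_of (hyperoctahedral n)).
Local Notation A := (group_algebra F gT).
Hypothesis two_neq0 : 2%:R != 0 :> F.

Lemma weight_cast a b a' b' (En : (a + b)%N = n) (En' : (a' + b')%N = n)
    (V : lmodType F) (r : right_action gT V) v ra rb :
  a = a' -> is_weight En r v ra rb -> is_weight En' r v ra rb.
Proof.
move=> Ea; have Eb : b = b' by apply: (@addnI a); rewrite En Ea En'.
by subst a' b'; rewrite (eq_irrelevance En' En).
Qed.

(** In the right ideal of [e], the top group moves some character of the base
    group to a standard one; then [antisym_weight_ex] is applied to the two
    factors of the Young subgroup in turn, the second time within the vectors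
    found the first time. *)
Lemma ideal_weight (e : A) : e != 0 ->
  exists la mu (En : (sumn la + sumn mu)%N = n) (x : A),
    [/\ is_partition la, is_partition mu, x != 0, exists y, x = e * y &
      is_weight En (regular_action F gT) x (residues F la) (residues F mu)].
Proof.
move=> nz_e; have [chi nz_chi] : exists chi, e * idem F chi != 0.
  apply/existsP; apply: contraNT nz_e; rewrite negb_exists => /forallP all0.
  rewrite -[e]mulr1 -(idem_sum n two_neq0) mulr_sumr big1 // => chi _.
  by apply/eqP; have := all0 chi; rewrite negbK.
have [s [i si]] := upper_transitive chi; have En := young_size i.
pose x0 := e * (dtop F s * idem F (upper n i)).
have nz0 : x0 != 0.
  have E0 : e * idem F chi = x0 * dtop F s^-1%g.
    by rewrite /x0 dtop_idem si -!mulrA -dtopM mulgV dtop1 mulr1.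
  by apply: contraNneq nz_chi; rewrite E0 => ->; rewrite mul0r.
pose P0 (x : A) := (exists y, x = e * y) /\
  forall X, x * dflip F X = sgn F X (upper n i) *: x.
have P0lin c (u v : A) : P0 u -> P0 v -> P0 (c *: u + v).
  move=> [[yu Eu] uX] [[yv Ev] vX]; split.
    by exists (c *: yu + yv); rewrite mulrDr -scalerAr -Eu -Ev.
  by move=> X; rewrite mulrDl -scalerAl uX vX scalerDr !scalerA mulrC.
have P0young g (v : A) : P0 v -> P0 (young_action En (regular_action F gT) g v).
  move=> [[y ->] vX]; split.
    by exists (y * delta (wr (set0, young En g))); rewrite /= mulrA.
  move=> X /=; rewrite -mulrA -/(dtop F _) dtop_dflip mulrA vX -scalerAl.
  by rewrite -{1}(young_upper En g) sgn_preim.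
have P0x0 : P0 x0.
  split; first by exists (dtop F s * idem F (upper n i)).
  by move=> X; rewrite /x0 -!mulrA idem_dflip -!scalerAr.
have [c1 [sc1 [v1 [P0v1 anti1] nz1] wt1]] :=
  antisym_weight_ex (r := low_action En (regular_action F gT)) P0lin
    (fun g v => P0young _ v) (ex_intro2 _ _ x0 P0x0 nz0).
pose P1 (x : A) := P0 x /\ antisym (low_action En (regular_action F gT)) c1 x.
have P1lin c (u v : A) : P1 u -> P1 v -> P1 (c *: u + v).
  move=> [P0u au] [P0v av]; split; first exact: P0lin.
  by move=> k l kl Ekl; rewrite ract_linear au // av // scalerN opprD.
have P1high t (v : A) : P1 v -> P1 (high_action En (regular_action F gT) t v).
  move=> [P0v av]; split; first exact: P0young.
  move=> k l kl Ekl; by rewrite low_highC av // ractN.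
have [c2 [sc2 [v [P1v anti2] nz] wt2]] :=
  antisym_weight_ex (r := high_action En (regular_action F gT)) P1lin P1high
    (ex_intro2 _ _ v1 (conj P0v1 anti1) nz1).
have [la [pl sl El]] := column_partition_ex c1.
have [mu [pm sm Em]] := column_partition_ex c2.
have En' : (sumn la + sumn mu)%N = n by rewrite sl sm.
exists la, mu, En', v; case: (P1v) => -[Ev vX] _; split=> //.
apply: (weight_cast (En := En)) (esym sl) _; split=> //.
  exists (content_weight F c1); last exact: content_weight_residues.
  by apply: wt1; case: P1v.
exists (content_weight F c2); last exact: content_weight_residues.
exact: wt2.
Qed.
End IdealWeights.

(** * Blocks and central characters *)

Section Blocks.
Variables (F : fieldType) (T : finGroupType).
Local Notation A := (group_algebra F T).
Implicit Types (e f g y z : A).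

(** The first [#|T| + 1] powers of [y] are linearly dependent. *)
Lemma annihilating_poly y : exists2 P : {poly F}, P != 0 & horner_alg y P = 0.
Proof.
pose N := #|T|; pose M : 'M[F]_(N.+1, N) := \matrix_(i, j) (y ^+ i) (enum_val j).
have : kermx M != 0.
  rewrite kermx_eq0 /row_free; apply/eqP=> rM.
  by have := rank_leq_col M; rewrite rM ltnn.
case/rowV0Pn=> u /sub_kermxP uM nz_u.
exists (\poly_(i < N.+1) u 0 (inord i)).
  apply: contraNneq nz_u => /polyP P0; apply/eqP/rowP=> i.
  by have := P0 i; rewrite coef_poly ltn_ord inord_val coef0 mxE.
apply/ffunP=> x; have /rowP/(_ (enum_rank x)) := uM; rewrite mxE [RHS]mxE ffunE => <-.
rewrite poly_def linear_sum sum_ffunE; apply: eq_bigr => i _.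
by rewrite linearZ /= rmorphXn /= horner_algX mulr_algl ga_scaleE inord_val mxE enum_rankK.
Qed.

Lemma horner_alg_central y P : central y -> central (horner_alg y P).
Proof.
move=> cy x; elim/poly_ind: P => [|P c IH]; first by rewrite rmorph0 mulr0 mul0r.
rewrite rmorphD rmorphM /= horner_algX horner_algC mulrDl mulrDr -mulrA cy mulrA IH mulrA.
by rewrite -scalerAl -scalerAr mul1r mulr1.
Qed.

Lemma ract_horner (V : lmodType F) (r : right_action T V) v y a P :
  ract_ga r y v = a *: v -> ract_ga r (horner_alg y P) v = P.[a] *: v.
Proof.
move=> ya; elim/poly_ind: P => [|P c IH].
  by rewrite rmorph0 ract_ga0 horner0 scale0r.
rewrite rmorphD rmorphM /= horner_algX horner_algC ract_gaD ract_gaM IH linearZ /= ya.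
by rewrite ract_gaZ ract_ga1 hornerMXaddC scalerDl scalerA.
Qed.

Lemma central_idempotentM f g : central_idempotent f -> central_idempotent g ->
  central_idempotent (f * g).
Proof.
move=> [cf ff] [cg gg]; split=> [x|]; first by rewrite -mulrA cg mulrA cf mulrA.
by rewrite mulrA -(mulrA f) cg mulrA ff -mulrA gg.
Qed.

Lemma central_idempotent1B f : central_idempotent f -> central_idempotent (1 - f).
Proof.
move=> [cf ff]; split=> [x|]; first by rewrite mulrBl mulrBr mul1r mulr1 cf.
by rewrite mulrBr mulr1 mulrBl mul1r ff subrr subr0.
Qed.

Lemma block_split e f : block_idempotent e -> central_idempotent f ->
  e * f = 0 \/ e * (1 - f) = 0.
Proof.
move=> [ce _ prim] cf; have c1f := central_idempotent1B cf.
apply: prim; rewrite -?mulrDr ?subrKC ?mulr1 //; try exact: central_idempotentM.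
case: (ce) (cf) (c1f) => [ec _] [fc ff] _.
by rewrite mulrA -(mulrA e) -ec !mulrA -!mulrA mulrBr mulr1 ff subrr !mulr0.
Qed.

(** If a central element took two values on modules of one block, a polynomial
    in it would be an idempotent splitting the block. *)
Lemma block_scalar e y (V V' : lmodType F) (r : right_action T V)
    (r' : right_action T V') v v' a b :
  block_idempotent e -> central y -> v != 0 -> v' != 0 ->
  ract_ga r e v = v -> ract_ga r' e v' = v' ->
  ract_ga r y v = a *: v -> ract_ga r' y v' = b *: v' -> a = b.
Proof.
move=> block_e cy nz nz' ev ev' yv yv'; apply/eqP; apply: contraT => neq_ab.
have [P nzP yP] := annihilating_poly y.
have root_of (W : lmodType F) (q : right_action T W) w c : w != 0 ->
    ract_ga q y w = c *: w -> root P c.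
  move=> nzw /(ract_horner P); rewrite yP ract_ga0 => /esym/eqP.
  by rewrite scaler_eq0 (negPf nzw) orbF.
have Pa := root_of _ _ _ _ nz yv; have Pb := root_of _ _ _ _ nz' yv'.
have [m [Q]] := multiplicity_XsubC P a; rewrite nzP /= => Qa EP.
have m_gt0 : (0 < m)%N.
  by case: m EP => // EP; move: Pa; rewrite EP expr0 mulr1 (negPf Qa).
have /Bezout_eq1_coprimepP[[u w] /= uw] : coprimep Q (('X - a%:P) ^+ m).
  by apply: coprimep_expr; rewrite coprimep_XsubC.
pose f := horner_alg y (u * Q).
have cf : central_idempotent f.
  split; first exact: horner_alg_central.
  apply/eqP; rewrite -subr_eq0 -rmorphM -rmorphB /=.
  have -> : u * Q * (u * Q) - u * Q = - (u * w * P).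
    by rewrite -[X in _ - X]mulr1 -mulrBr -[1]uw opprD addrA subrr add0r EP; ring.
  by rewrite rmorphN rmorphM /= yP mulr0 oppr0.
(* The factor [Q] kills the generalized eigenspaces other than that of [a], while
   [u * Q] is 1 modulo a power of ['X - a%:P]. *)
have uQa : (u * Q).[a] = 1.
  rewrite -[u * Q](addrK (w * ('X - a%:P) ^+ m)) uw hornerD hornerN hornerM hornerC.
  by rewrite horner_exp hornerXsubC subrr expr0n eqn0Ngt m_gt0 mulr0 subr0.
have Qb : root Q b.
  by move: Pb; rewrite EP rootM -(prednK m_gt0) root_exp_XsubC eq_sym (negPf neq_ab) orbF.
have uQb : (u * Q).[b] = 0 by rewrite hornerM (rootP Qb) mulr0.
have fv : ract_ga r f v = v by rewrite (ract_horner _ yv) uQa scale1r.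
have fv' : ract_ga r' f v' = 0 by rewrite (ract_horner _ yv') uQb scale0r.
case: (block_split block_e cf) => E0.
  by case/eqP: nz; rewrite -fv -{1}ev -ract_gaM E0 ract_ga0.
case/eqP: nz'; have := ract_gaM r' e (1 - f) v'.
by rewrite E0 ract_ga0 ev' ract_gaD ract_ga1 -scaleN1r ract_gaZ fv' scaler0 addr0.
Qed.

(** Each of the two idempotents is split by the other one, and the vector shows
    which part is zero. *)
Lemma block_uniq e e' (V : lmodType F) (r : right_action T V) v :
  block_idempotent e -> block_idempotent e' -> v != 0 ->
  ract_ga r e v = v -> ract_ga r e' v = v -> e = e'.
Proof.
move=> be be' nz ev e'v; have [ce _ _] := be; have [ce' _ _] := be'.
have half f g : block_idempotent f -> central_idempotent g ->
    ract_ga r f v = v -> ract_ga r g v = v -> f = f * g.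
  move=> bf cg fv gv; case: (block_split bf cg) => [E0|/eqP].
    by case/eqP: nz; rewrite -gv -fv -ract_gaM E0 ract_ga0.
  by rewrite mulrBr mulr1 subr_eq0 => /eqP.
have E' := half _ _ be' ce e'v ev; case: ce => ec _.
by rewrite (half _ _ be ce' ev e'v) ec -E'.
Qed.

(** Multiplication by [a] in the regular representation; its rank is the
    dimension of the ideal generated by a central [a]. *)
Definition regular_mx (a : A) : 'M[F]_#|T| :=
  \matrix_(i, j) (delta (enum_val i) * a) (enum_val j).

Lemma regular_mxM a b : regular_mx (a * b) = regular_mx a *m regular_mx b.
Proof.
apply/matrixP=> i j; rewrite !mxE mulrA [delta _ * a]ga_sum mulr_suml sum_ffunE.
rewrite (reindex (@enum_val T predT)) /=; last exact: onW_bij (enum_val_bij T).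
by apply: eq_bigr => k _; rewrite !mxE -scalerAl ga_scaleE.
Qed.

Lemma regular_mx_eq0 a : regular_mx a = 0 -> a = 0.
Proof.
move=> /matrixP E; apply/ffunP=> x; have := E (enum_rank 1%g) (enum_rank x).
by rewrite !mxE !enum_rankK delta1 mul1r ffunE.
Qed.

(** A vector on which the centre acts by scalars is fixed by one block
    idempotent, namely one generating an ideal of least dimension. *)
Lemma block_ex (V : lmodType F) (r : right_action T V) v : v != 0 ->
  (forall z, central z -> exists c, ract_ga r z v = c *: v) ->
  exists2 e, block_idempotent e & ract_ga r e v = v.
Proof.
move=> nz scal.
suff H m e : (\rank (regular_mx e) <= m)%N -> central_idempotent e -> ract_ga r e v = v ->
    exists2 e, block_idempotent e & ract_ga r e v = v.
  apply: (H _ 1 (leqnn _)); last exact: ract_ga1.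
  by split=> [x|]; rewrite ?mul1r ?mulr1.
elim: m e => [|m IH] e le_m ce ev.
  case/eqP: nz; rewrite -ev (_ : e = 0) ?ract_ga0 //; apply: regular_mx_eq0.
  by apply/eqP; rewrite -mxrank_eq0 -leqn0.
have [[f [g [[cf cg fg0 Ee] nzf nzg]]]|no] := Classical_Prop.classic (exists f g,
    [/\ [/\ central_idempotent f, central_idempotent g, f * g = 0 & e = f + g], f <> 0 & g <> 0]); last first.
  exists e => //; split=> // [E0|f g cf cg fg0 Ee].
    by case/eqP: nz; rewrite -ev E0 ract_ga0.
  apply: Classical_Prop.NNPP => /Classical_Prop.not_or_and[nzf nzg]; apply: no.
  by exists f, g.
have drop f' g' : central_idempotent f' -> central_idempotent g' -> f' * g' = 0 ->
    e = f' + g' -> g' <> 0 -> (\rank (regular_mx f') <= m)%N.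
  move=> [cf' ff'] [cg' gg'] fg' Ee' nzg'; rewrite -ltnS; apply: leq_trans le_m.
  have sfe : (regular_mx f' <= regular_mx e)%MS.
    have -> : f' = f' * e by rewrite Ee' mulrDr ff' fg' addr0.
    by rewrite regular_mxM submxMl.
  rewrite ltn_neqAle mxrankS // andbT; apply/negP => /eqP Er; apply: nzg'.
  have /submxP[W EW] : (regular_mx e <= regular_mx f')%MS.
    by rewrite -(geq_leqif (mxrank_leqif_sup sfe)) Er.
  apply: regular_mx_eq0; have -> : g' = e * g' by rewrite Ee' mulrDl fg' gg' add0r.
  by rewrite regular_mxM EW -mulmxA -regular_mxM fg' (_ : regular_mx 0 = 0) ?mulmx0 //;
    apply/matrixP=> i j; rewrite !mxE mulr0 ffunE.
have gf0 : g * f = 0 by case: cg => -> _.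
have [c fv] := scal f (proj1 cf).
have : c * c = c.
  have := ract_gaM r f f v; rewrite (proj2 cf) fv linearZ /= fv scalerA => /eqP.
  by rewrite -subr_eq0 -scalerBl scaler_eq0 (negPf nz) orbF subr_eq0 => /eqP.
move/eqP; rewrite -subr_eq0 -{3}[c]mulr1 -mulrBr mulf_eq0 subr_eq0 => /orP[/eqP c0|/eqP c1].
  apply: (IH g) => //; first by apply: drop gf0 _ nzf; rewrite // addrC.
  by rewrite -[RHS]ev Ee ract_gaD fv c0 scale0r add0r.
apply: (IH f) => //; first exact: drop fg0 Ee nzg.
by rewrite fv c1 scale1r.
Qed.
End Blocks.

(** * The weight vector of a hyperoctahedral Specht module *)

(** The vectors [f i] span the space of all row vectors; this form of the
    condition is stable under tensor products and induction. *)
Definition spanning (F : fieldType) (I : Type) d (f : I -> 'rV[F]_d) : Prop :=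
  forall q (N : 'M_(d, q)), (forall i, f i *m N = 0) -> N = 0.

Section RowTensor.
Variables (F : fieldType) (d1 d2 : nat).
Implicit Types (u : 'rV[F]_d1) (w : 'rV[F]_d2).

Definition row_tensor u w : 'rV[F]_(d1 * d2) := tprod u w.

(** The matrix [tprod u w] has an additional block with no rows below [trow u w]. *)
Lemma row_tensorE u w : row_tensor u w = trow u w.
Proof.
apply/rowP=> j; rewrite /row_tensor /= (_ : usubmx (u : 'M_(1 + 0, d1)) = u); last first.
  by apply/rowP=> k; rewrite mxE; congr (u _ _); apply: val_inj.
by rewrite mxE (_ : split _ = inl 0) //; case: splitP => // k _; rewrite [k]ord1.
Qed.

Definition row_tensorl w u := row_tensor u w.

Lemma row_tensor_linearl w : linear (row_tensorl w).
Proof. by move=> c u u'; rewrite /row_tensorl !row_tensorE -!trowbE linearP. Qed.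

Lemma row_tensor_linearr u : linear (row_tensor u).
Proof. by move=> c w w'; rewrite !row_tensorE linearP. Qed.

HB.instance Definition _ w :=
  GRing.isLinear.Build F 'rV[F]_d1 'rV[F]_(d1 * d2) *:%R (row_tensorl w) (row_tensor_linearl w).
HB.instance Definition _ u :=
  GRing.isLinear.Build F 'rV[F]_d2 'rV[F]_(d1 * d2) *:%R (row_tensor u) (row_tensor_linearr u).

Lemma row_tensorM u w (A : 'M_d1) (B : 'M_d2) :
  row_tensor u w *m tprod A B = row_tensor (u *m A) (w *m B).
Proof. by rewrite /row_tensor tprodE. Qed.
End RowTensor.

Section RowTensorTheory.
Variable F : fieldType.

(** Peeling off one coordinate of [u] at a time splits [N] into blocks of
    rows. *)
Lemma row_tensor_spans d1 d2 q (N : 'M[F]_(d1 * d2, q)) :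
  (forall u w, row_tensor u w *m N = 0) -> N = 0.
Proof.
elim: d1 N => [|d IH] N N0; first by apply: flatmx0.
pose N' : 'M_(d2 + d * d2, q) := N.
have {}N0 (u : 'rV[F]_(1 + d)) (w : 'rV[F]_d2) : row_mx (lsubmx u 0 0 *: w) (trow (rsubmx u) w) *m N' = 0.
  by have := N0 u w; rewrite row_tensorE.
rewrite -[N]/N' -[N']vsubmxK (_ : usubmx N' = 0); last first.
  apply/row_matrixP=> i; rewrite rowE row0.
  have := N0 (row_mx 1%:M 0) (delta_mx 0 i).
  rewrite -[N' in LHS]vsubmxK mul_row_col row_mxKl row_mxKr !mxE scale1r.
  by rewrite -trowbE linear0 mul0mx addr0.
rewrite (_ : dsubmx N' = 0) ?col_mx0 //; apply: IH => u w.
have := N0 (row_mx 0 u) w; rewrite -[N' in LHS]vsubmxK mul_row_col row_mxKl row_mxKr mxE.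
by rewrite scale0r mul0mx add0r row_tensorE.
Qed.

Lemma spanning_linear I d (f : I -> 'rV[F]_d) q (h : {linear 'rV[F]_d -> 'rV[F]_q}) :
  spanning f -> (forall i, h (f i) = 0) -> forall u, h u = 0.
Proof.
move=> sf f0 u; rewrite -mul_rV_lin1 (_ : lin1_mx h = 0) ?mulmx0 //.
by apply: sf => i; rewrite mul_rV_lin1.
Qed.

Lemma spanning_tensor I J d1 d2 (f : I -> 'rV[F]_d1) (g : J -> 'rV[F]_d2) :
  spanning f -> spanning g -> spanning (fun ij => row_tensor (f ij.1) (g ij.2)).
Proof.
move=> sf sg q N N0; apply: row_tensor_spans => u w.
apply: (spanning_linear (h := mulmxr N \o row_tensorl w) sf) => i.
apply: (spanning_linear (h := mulmxr N \o row_tensor (f i)) sg) => j.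
exact: (N0 (i, j)).
Qed.

Lemma row_tensor_neq0 d1 d2 (u : 'rV[F]_d1) (w : 'rV[F]_d2) :
  u != 0 -> w != 0 -> row_tensor u w != 0.
Proof.
have left_inv d (v : 'rV[F]_d) : v != 0 -> exists K, v *m K = 1%:M.
  by move=> nzv; apply/row_freeP; rewrite /row_free rank_rV nzv.
move=> /left_inv[K uK] /left_inv[L wL]; apply/eqP=> E0.
have := tprodE u K w L; rewrite uK wL tprod1 (E0 : tprod u w = 0) mul0mx.
by move=> /matrixP/(_ (Ordinal (isT : 0 < 1 * 1)%N) 0)/eqP; rewrite !mxE oner_eq0.
Qed.
End RowTensorTheory.

Section InducedRow.
Variables (F : fieldType) (gT : finGroupType) (H G : {group gT}) (d : nat).
Variable rH : mx_representation F H d.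
Hypothesis sHG : H \subset G.
Local Notation rep := (coset_rep (H := H) (G := G)).

(** The embedding [u |-> u (x) x] of the inducing module in the induced one. *)
Definition induced_row (x : gT) : 'M[F]_(d, \sum_(j < #|G : H|) d) :=
  \mxrow_(j < #|G : H|)
    (let h := (x * (rep j)^-1)%g in if h \in H then rH h else 0).

Lemma induced_rowM x g : x \in G -> g \in G ->
  induced_row x *m induced_repr rH sHG g = induced_row (x * g)%g.
Proof.
move=> Gx Gg; rewrite /= mul_mxrow_mxblock; apply: eq_mxrow => k.
have [j Hj] := coset_rep_ex H Gx.
rewrite (bigD1 j) //= Hj big1 ?addr0 => [|j' neq_j]; last first.
  case: ifP => [Hj'|_]; last by rewrite mul0mx.
  case/negP: neq_j; apply/eqP/(@coset_rep_inj _ H G).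
  by move: (groupM (groupVr Hj') Hj); rewrite !invMg invgK -!mulgA mulKg.
have -> : (x * g * (rep k)^-1 = x * (rep j)^-1 * (rep j * g * (rep k)^-1))%g.
  by rewrite !mulgA mulgKV.
rewrite (groupMl _ Hj); case: ifP => Hk; last by rewrite mulmx0.
by rewrite -repr_mxM.
Qed.

Lemma induced_rowH h x : h \in H -> induced_row (h * x)%g = rH h *m induced_row x.
Proof.
move=> Hh; rewrite /induced_row mul_mxrow; apply: eq_mxrow => k /=.
rewrite -mulgA (groupMl _ Hh). case: ifP => Hk; last by rewrite mulmx0.
by rewrite -repr_mxM.
Qed.

Lemma induced_row_spans q (N : 'M_(_, q)) :
  (forall x, x \in G -> induced_row x *m N = 0) -> N = 0.
Proof.
move=> N0; rewrite -[N]submxcolK; apply/mxcolP=> j; rewrite mxcolK submxcol0.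
have := N0 _ (coset_rep_in sHG j); rewrite -{1}[N]submxcolK mul_mxrow_mxcol.
rewrite (bigD1 j) //= mulgV group1 repr_mx1 mul1mx big1 ?addr0 // => k neq_k.
case: ifP => [Hk|_]; last by rewrite mul0mx.
by move: neq_k; rewrite (coset_rep_inj Hk) eqxx.
Qed.

Lemma induced_row_inj (u : 'rV_d) : u *m induced_row 1%g = 0 -> u = 0.
Proof.
have [j Hj] := coset_rep_ex H (group1 G).
rewrite mul_mxrow => /(congr1 (fun M => submxrow M j)).
rewrite mxrowK submxrow0 /= Hj => /(congr1 (mulmx^~ (rH (1 * (rep j)^-1)^-1%g))).
by rewrite mul0mx -mulmxA -repr_mxM ?groupV // mulgV repr_mx1 mulmx1.
Qed.

Lemma spanning_induced (v : 'rV_d) : spanning (fun h : subg_of H => v *m rH (sgval h)) ->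
  spanning (fun g : subg_of G => v *m induced_row 1%g *m induced_repr rH sHG (sgval g)).
Proof.
move=> sv q N N0; apply: induced_row_spans => x Gx; apply: sv => h.
have Hh : sgval h \in H := valP h; have Gh := subsetP sHG _ Hh.
have := N0 (subg G (sgval h * x)%g); rewrite subgK ?groupM //.
by rewrite -(mulmxA v) induced_rowM ?group1 ?groupM // mul1g induced_rowH // !mulmxA.
Qed.
End InducedRow.

Section SubgAction.
Variables (F : fieldType) (gT : finGroupType) (G : {group gT}) (d : nat).
Variable rG : mx_representation F G d.

Definition subg_act (g : subg_of G) (v : 'rV[F]_d) := v *m rG (sgval g).

Fact subg_act_linear g : linear (subg_act g).
Proof. by move=> c u v; rewrite /subg_act mulmxDl scalemxAl. Qed.
Fact subg_act1 v : subg_act 1%g v = v.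
Proof. by rewrite /subg_act repr_mx1 mulmx1. Qed.
Fact subg_actM g h v : subg_act (g * h)%g v = subg_act h (subg_act g v).
Proof. by rewrite /subg_act repr_mxM ?(valP g) ?(valP h) // mulmxA. Qed.

Definition subg_action : right_action (subg_of G) 'rV[F]_d :=
  RightAction subg_act_linear subg_act1 subg_actM.

Lemma ract_subg e v : ract_ga subg_action e v = v *m \sum_g e g *: rG (sgval g).
Proof. by rewrite mulmx_sumr; apply: eq_bigr => g _; rewrite scalemxAr. Qed.

(** A central element acting as the identity on a generator acts so on the
    whole module. *)
Lemma lies_in_block_generator v e : central e ->
  spanning (fun g : subg_of G => v *m rG (sgval g)) ->
  lies_in_block rG e <-> ract_ga subg_action e v = v.
Proof.
move=> ce sv; rewrite ract_subg; split=> [->|ev]; first by rewrite mulmx1.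
apply/eqP; rewrite -subr_eq0; apply/eqP; apply: sv => g.
rewrite mulmxBr mulmx1; apply/eqP; rewrite subr_eq0; apply/eqP.
have := ract_gaM subg_action (delta g) e v.
by rewrite -ce ract_gaM !ract_delta !ract_subg ev.
Qed.
End SubgAction.

Section WreathFactors.
Variable n : nat.
Implicit Types (X : {set 'I_n}) (s : 'S_n).

Lemma top_wreath X s : top_perm (wreath X s) = s.
Proof. by have [] := wreath_inj (wreath_decomp (wreath_in X s)). Qed.

Lemma bar_sign_wreath X s : bar_sign (wreath X s) = #|X|.
Proof.
have [EX _] := wreath_inj (wreath_decomp (wreath_in X s)).
by rewrite {2}EX -sum1dep_card big_mkcond /=; apply: eq_bigr => i _; case: is_barred.
Qed.

(** This matches the module on which every [(i \bar i)] of the second factor acts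
    as -1. *)
Lemma sgn_upper (F : fieldType) a b (En : (a + b)%N = n) X :
  sgn F X (upper n a) = (-1) ^+ #|high En @^-1: X|.
Proof.
rewrite /sgn -expr_sum; congr (_ ^+ _).
have -> : #|high En @^-1: X| = #|X :&: upper n a|.
  rewrite -(card_imset _ (@high_inj _ _ _ En)); apply: eq_card => k; rewrite inE.
  apply/imsetP/andP => [[j + ->]|[kX ku]]; first by rewrite inE high_upper.
  case: (low_high En k) kX ku => -[j ->]; first by rewrite low_upper.
  by exists j; rewrite ?inE.
rewrite -sum1_card [RHS]big_mkcond; apply: eq_bigr => i _ /=; rewrite in_setI.
by case: ifP.
Qed.
End WreathFactors.

Lemma weight_vector_morph (F : fieldType) m (V W : lmodType F) (r : right_action 'S_m V)
    (q : right_action 'S_m W) (f : {linear V -> W}) a v :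
  (forall g u, f (r g u) = q g (f u)) -> weight_vector r a v -> weight_vector q a (f v).
Proof.
move=> fr av k; rewrite -linearZ -av linear_sum; apply: eq_bigr => g _.
by rewrite [RHS]linearZ_LR fr.
Qed.

Section HypSpechtWeight.
Variables (F : fieldType) (la mu : seq nat) (n : nat) (En : (sumn la + sumn mu)%N = n).
Local Notation a := (sumn la).
Local Notation b := (sumn mu).

Let inner := outer_tensor_repr (inflation_repr (specht_repr F la))
  (prod_repr (ntilde_repr b F) (inflation_repr (specht_repr F mu))).
Let rH := transport_repr (join_injm En) inner.

Lemma join_in_young s t : s \in hyperoctahedral a -> t \in hyperoctahedral b ->
  join_perm En (s, t) \in hyp_young En.
Proof. by move=> Gs Gt; apply: mem_morphim; rewrite ?in_setT //; apply/setXP. Qed.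

Lemma join_reprE s t : s \in hyperoctahedral a -> t \in hyperoctahedral b ->
  rH (join_perm En (s, t)) = inner (s, t).
Proof.
move=> Gs Gt; rewrite -[LHS]/(inner (invm (join_injm En) (join_perm En (s, t)))).
by rewrite invmE ?inE.
Qed.

Lemma inner_tensor u w s t :
  row_tensor u (row_tensor 1%:M w) *m inner (s, t) =
  row_tensor (u *m specht_repr F la (top_perm s))
    (row_tensor ((-1) ^+ bar_sign t)%:M (w *m specht_repr F mu (top_perm t))).
Proof. by rewrite [LHS]row_tensorM row_tensorM mul1mx. Qed.

(** The middle factor belongs to the one-dimensional module on which the second
    base group acts by signs. *)
Definition hyp_vector u w := row_tensor u (row_tensor 1%:M w) *m induced_row (hyperoctahedral n) rH 1%g.

(** The element lies in the subgroup from which the module is induced, by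
    [wreath_young], so the vector stays in the inducing module. *)
Lemma hyp_vector_act u w Z st :
  hyp_vector u w *m hyp_specht_repr F En (wreath Z (young En st)) =
  sgn F Z (upper n a) *:
    hyp_vector (u *m specht_repr F la st.1) (w *m specht_repr F mu st.2).
Proof.
rewrite /hyp_vector -mulmxA induced_rowM ?group1 ?wreath_in // mul1g.
rewrite -[wreath Z _]mulg1 wreath_young induced_rowH ?join_in_young ?wreath_in //.
rewrite join_reprE ?wreath_in // mulmxA inner_tensor !top_wreath bar_sign_wreath.
by rewrite (sgn_upper F En) -scalemx1 -[row_tensor (_ *: _) _]/(row_tensorl _ _) linearZ linearZ scalemxAl.
Qed.

Lemma hyp_specht_weight : 2%:R != 0 :> F -> is_partition la -> is_partition mu ->
  exists v, [/\ v != 0,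
    is_weight En (subg_action (hyp_specht_repr F En)) v (residues F la) (residues F mu) &
    spanning (fun g : subg_of (hyperoctahedral n) => v *m hyp_specht_repr F En (sgval g))].
Proof.
move=> two_neq0 /(specht_weight)/(_ two_neq0)[u [wa [wau res_a nzu su]]].
move=> /(specht_weight)/(_ two_neq0)[w [wb [wbw res_b nzw sw]]].
exists (hyp_vector u w); split.
- apply: contraNneq (row_tensor_neq0 nzu (row_tensor_neq0 (matrix_nonzero1 F 0) nzw)).
  by move/induced_row_inj => ->.
- split=> [X||].
  + rewrite /= /subg_act val_wr -(young1 En) hyp_vector_act /=.
    by rewrite !repr_mx1 !mulmx1.
  + exists wa => //.
    pose f := mulmxr (induced_row (hyperoctahedral n) rH 1%g) \o row_tensorl (row_tensor 1%:M w).
    apply: (weight_vector_morph (f := f)) wau => g u'.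
    rewrite /= /subg_act val_wr [RHS]hyp_vector_act sgn0 scale1r /=.
    by rewrite repr_mx1 mulmx1.
  + exists wb => //.
    pose f := mulmxr (induced_row (hyperoctahedral n) rH 1%g) \o (row_tensor u \o row_tensor 1%:M).
    apply: (weight_vector_morph (f := f)) wbw => g w'.
    rewrite /= /subg_act val_wr [RHS]hyp_vector_act sgn0 scale1r /=.
    by rewrite repr_mx1 mulmx1.
apply: spanning_induced => q N N0.
have s1 : spanning (fun _ : unit => 1%:M : 'rV[F]_1).
  by move=> q' M /(_ tt); rewrite mul1mx.
apply: (spanning_tensor su (spanning_tensor s1 sw)) => -[g [[] h]] /=.
have := N0 (subg _ (join_perm En (wreath set0 g, wreath set0 h))).
by rewrite subgK ?join_in_young ?wreath_in // join_reprE ?wreath_in // inner_tensor !top_wreath bar_sign_wreath cards0.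
Qed.
End HypSpechtWeight.

(** * Separating the blocks *)

(** For a single point all exponents below the number of points are zero, and
    eigenvalues are not separated by symmetric polynomials; here the partitions
    themselves agree. *)
Lemma small_partition la la' : is_partition la -> is_partition la' ->
  sumn la = sumn la' -> (sumn la <= 1)%N -> la = la'.
Proof.
have small l : is_partition l -> (sumn l <= 1)%N -> l = nseq (sumn l) 1%N.
  case: l => [|x [|y l]] //; rewrite /is_partition !inE /=.
    by rewrite addn0 => nz le1; have -> : x = 1%N by lia.
  by rewrite !negb_or => /and4P[_ nx ny _] le1; lia.
by move=> pl pl' E le1; rewrite (small _ pl) // (small _ pl') -E.
Qed.

Section Separation.
Variables (F : fieldType) (n : nat).
Hypothesis two_neq0 : 2%:R != 0 :> F.
Local Notation gT := (subg_of (hyperoctahedral n)).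
Local Notation A := (group_algebra F gT).
Implicit Types (i j : 'I_n.+1) (e z : A).

Section Lift.
Variables (a b : nat) (En : (a + b)%N = n).

Definition lift_low (x : group_algebra F 'S_a) : group_algebra F ('S_a * 'S_b)%type :=
  [ffun st => x st.1 *+ (st.2 == 1%g)].
Definition lift_high (x : group_algebra F 'S_b) : group_algebra F ('S_a * 'S_b)%type :=
  [ffun st => x st.2 *+ (st.1 == 1%g)].

Lemma lift_low_central x : central x -> central (lift_low x).
Proof.
move=> /centralP cx; apply/centralP=> -[g g'] [h h'].
have -> : ((g, g') ^ (h, h'))%g = (g ^ h, g' ^ h')%g by [].
by rewrite !ffunE /= cx conjg_eq1.
Qed.

Lemma lift_high_central x : central x -> central (lift_high x).
Proof.
move=> /centralP cx; apply/centralP=> -[g g'] [h h'].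
have -> : ((g, g') ^ (h, h'))%g = (g ^ h, g' ^ h')%g by [].
by rewrite !ffunE /= cx conjg_eq1.
Qed.

Variables (V : lmodType F) (r : right_action gT V).

Lemma ract_lift_low x v :
  ract_ga (young_action En r) (lift_low x) v = ract_ga (low_action En r) x v.
Proof.
rewrite ract_young (bigD1 1%g) // big1 => [|t /andP[_ nt1]].
  rewrite [LHS]addr0 ract1 (_ : [ffun s => _] = x) //.
  by apply/ffunP=> s; rewrite !ffunE eqxx mulr1n.
rewrite (_ : [ffun s => _] = 0) ?ract_ga0 ?linear0 //.
by apply/ffunP=> s; rewrite !ffunE /= (negPf nt1) mulr0n.
Qed.

Lemma ract_lift_high x v :
  ract_ga (young_action En r) (lift_high x) v = ract_ga (high_action En r) x v.
Proof.
rewrite ract_young; apply: eq_bigr => t _.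
rewrite (_ : [ffun s => _] = x t *: delta 1%g :> group_algebra F 'S_a).
  by rewrite ract_gaZ ract_delta ract1 linearZ.
by apply/ffunP=> s; rewrite ga_scaleE !ffunE /= mulr_natr eq_sym.
Qed.
End Lift.

(** A central element of one summand of the corner, extended by zero to the
    other summands, is the compression of a central element. *)
Lemma central_lift i (x : group_algebra F ('S_i * 'S_(n - i))%type) : central x ->
  exists z : A, [/\ central z,
    forall ra rb (V : lmodType F) (r : right_action gT V) v,
      is_weight (young_size i) r v ra rb ->
      ract_ga r z v = ract_ga (young_action (young_size i) r) x v &
    forall j ra rb (V : lmodType F) (r : right_action gT V) v,
      j != i -> is_weight (young_size j) r v ra rb -> ract_ga r z v = 0].
Proof.
move=> cx; have [K [Ke Ki _]] := hyp_full_corner n two_neq0.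
pose y : direct_sum (fun i : 'I_n.+1 => group_algebra F ('S_i * 'S_(n - i))%type) :=
  finfun (dfwith (fun j => 0 : group_algebra F ('S_j * 'S_(n - j))%type) x).
have cy u : y * u = u * y.
  apply/ffunP=> j; rewrite !ffunE; case: (eqVneq i j) u => [<-|neq_ij] u.
    by rewrite dfwith_in cx.
  by rewrite dfwith_out // mulr0 mul0r.
have act j ra rb (V : lmodType F) (r : right_action gT V) v :
    is_weight (young_size j) r v ra rb -> ract_ga r (corner_extend K y) v =
    ract_ga (young_action (young_size j) r) (y j) v.
  case=> vX _ _; have Ev := weight_idem two_neq0 vX.
  rewrite -ract_embed -{1}Ev -[in RHS]Ev -!ract_gaM; congr (ract_ga r _ v).
  rewrite -{1}(idem_hyp_e two_neq0) -mulrA -Ke -(corner_extend_central K cy).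
  by rewrite (corner_extend_e K cy) Ki idem_iota.
exists (corner_extend K y); split; first exact: corner_extend_central.
  by move=> ra rb V r v wv; rewrite (act _ _ _ _ _ _ wv) ffunE dfwith_in.
move=> j ra rb V r v neq_ji wv.
by rewrite (act _ _ _ _ _ _ wv) ffunE dfwith_out ?ract_ga0 // eq_sym.
Qed.

Section TwoVectors.
Variables (e : A) (V V' : lmodType F) (r : right_action gT V) (r' : right_action gT V').
Variables (v : V) (v' : V').
Hypotheses (block_e : block_idempotent e) (nz_v : v != 0) (nz_v' : v' != 0).
Hypotheses (ev : ract_ga r e v = v) (ev' : ract_ga r' e v' = v').

(** Separated by the identity element of one summand. *)
Lemma block_index i j ra rb ra' rb' :
  is_weight (young_size i) r v ra rb -> is_weight (young_size j) r' v' ra' rb' -> i = j.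
Proof.
move=> wv wv'; apply/eqP/negPn/negP => neq_ij.
have c1 : central (1 : group_algebra F ('S_i * 'S_(n - i))%type).
  by move=> x; rewrite mul1r mulr1.
have [z [cz zP z0]] := central_lift c1.
have zv : ract_ga r z v = 1 *: v.
  by rewrite (zP _ _ _ _ _ wv) ract_ga1 scale1r.
have zv' : ract_ga r' z v' = 0 *: v'.
  by rewrite scale0r (z0 _ _ _ _ _ _ _ wv') // eq_sym.
have /eqP := block_scalar block_e cz nz_v nz_v' ev ev' zv zv'.
by rewrite oner_eq0.
Qed.

(** Separated by symmetric polynomials in the Jucys-Murphy elements of either
    factor. *)
Lemma block_weights i ra rb ra' rb' :
  is_weight (young_size i) r v ra rb -> is_weight (young_size i) r' v' ra' rb' ->
  ((1 < i)%N -> perm_eq ra ra') /\ ((1 < n - i)%N -> perm_eq rb rb').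
Proof.
move=> wv wv'; have [_ [wa wav a_ra] [wb wbv b_rb]] := wv.
have [_ [wa' wav' a_ra'] [wb' wbv' b_rb']] := wv'.
have perm_tr (s t s' t' : seq F) : perm_eq s t -> perm_eq s' t' -> perm_eq s s' -> perm_eq t t'.
  by move=> st s't' ss'; rewrite perm_sym in st; apply: perm_trans st (perm_trans ss' s't').
split=> gt1.
  apply: perm_tr a_ra a_ra' _; apply: (sympoly_separate gt1) => f sf.
  have [z [cz zP _]] := central_lift (lift_low_central (b := (n - i)%N) (sympoly_central sf)).
  have zv := zP _ _ _ _ _ wv; have zv' := zP _ _ _ _ _ wv'.
  rewrite ract_lift_low (weight_jm_eval _ wav) in zv.
  rewrite ract_lift_low (weight_jm_eval _ wav') in zv'.
  exact: block_scalar block_e cz nz_v nz_v' ev ev' zv zv'.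
apply: perm_tr b_rb b_rb' _; apply: (sympoly_separate gt1) => f sf.
have [z [cz zP _]] := central_lift (lift_high_central (a := i) (sympoly_central sf)).
have zv := zP _ _ _ _ _ wv; have zv' := zP _ _ _ _ _ wv'.
rewrite ract_lift_high (weight_jm_eval _ wbv) in zv.
rewrite ract_lift_high (weight_jm_eval _ wbv') in zv'.
exact: block_scalar block_e cz nz_v nz_v' ev ev' zv zv'.
Qed.

Lemma block_partitions la mu la' mu' (En : (sumn la + sumn mu)%N = n)
    (En' : (sumn la' + sumn mu')%N = n) :
  is_partition la -> is_partition mu -> is_partition la' -> is_partition mu' ->
  is_weight En r v (residues F la) (residues F mu) ->
  is_weight En' r' v' (residues F la') (residues F mu') ->
  [/\ sumn la = sumn la', perm_eq (residues F la) (residues F la') &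
      perm_eq (residues F mu) (residues F mu')].
Proof.
move=> pl pm pl' pm' wv wv'.
have lt_i : (sumn la < n.+1)%N by rewrite -En; lia.
have lt_j : (sumn la' < n.+1)%N by rewrite -En'; lia.
have {}wv := weight_cast (young_size (Ordinal lt_i)) (erefl : _ = nat_of_ord (Ordinal lt_i)) wv.
have {}wv' := weight_cast (young_size (Ordinal lt_j)) (erefl : _ = nat_of_ord (Ordinal lt_j)) wv'.
have /(congr1 (@nat_of_ord _)) /= Ell := block_index wv wv'.
have wv'' := weight_cast (young_size (Ordinal lt_i)) (esym Ell : _ = nat_of_ord (Ordinal lt_i)) wv'.
have [ra rb] := block_weights wv wv''; split=> //.
  have [gt1|le1] := ltnP 1 (sumn la); first exact: ra.
  by rewrite (small_partition pl pl').
have [gt1|le1] := ltnP 1 (sumn mu).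
  by apply: rb; rewrite /= -{1}En addKn.
by rewrite (small_partition pm pm') //; lia.
Qed.
End TwoVectors.
End Separation.

(** * Labelling the blocks *)

Definition fits_label (p : nat) (l : block_label) (la mu : seq nat) : Prop :=
  (sumn la = (sumn l.1.1 + l.1.2 * p)%N /\ has_core p la l.1.1) /\
  (sumn mu = (sumn l.2.1 + l.2.2 * p)%N /\ has_core p mu l.2.1).

Definition block_of_label (F : fieldType) (p n : nat) (l : block_label)
    (e : group_algebra F (subg_of (hyperoctahedral n))) : Prop :=
  block_idempotent e /\
  forall la mu (En : (sumn la + sumn mu)%N = n), is_partition la -> is_partition mu ->
    fits_label p l la mu -> lies_in_block (hyp_specht_repr F En) e.

Lemma weight_perm (F : fieldType) n a b (En : (a + b)%N = n) (V : lmodType F)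
    (r : right_action (subg_of (hyperoctahedral n)) V) v ra rb ra' rb' :
  perm_eq ra ra' -> perm_eq rb rb' -> is_weight En r v ra rb -> is_weight En r v ra' rb'.
Proof.
move=> pa pb [vX [wa wav a_ra] [wb wbv b_rb]]; split=> //.
  by exists wa => //; apply: perm_trans a_ra pa.
by exists wb => //; apply: perm_trans b_rb pb.
Qed.

Section Labels.
Variables (F : fieldType) (p n : nat).
Hypotheses (charFp : p \in [pchar F]) (two_neq0 : 2%:R != 0 :> F).
Local Notation gT := (subg_of (hyperoctahedral n)).
Local Notation A := (group_algebra F gT).
Implicit Types (e : A) (l : block_label) (la mu : seq nat).

(** Central elements act by equal scalars on two weight vectors for the same
    residues, so these lie in the same blocks. *)
Lemma same_block a b (En : (a + b)%N = n) (V V' : lmodType F) (r : right_action gT V)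
    (r' : right_action gT V') v v' ra rb e :
  central e -> is_weight En r v ra rb -> is_weight En r' v' ra rb -> v != 0 ->
  ract_ga r e v = v -> ract_ga r' e v' = v'.
Proof.
move=> ce wv wv' nz; have [c [-> ->]] := central_scalar two_neq0 wv nz wv' ce.
move/eqP; rewrite -{2}[v]scale1r -subr_eq0 -scalerBl scaler_eq0 (negPf nz) orbF subr_eq0.
by move=> /eqP->; rewrite scale1r.
Qed.

Lemma same_residues_block la mu la' mu' (En : (sumn la + sumn mu)%N = n)
    (En' : (sumn la' + sumn mu')%N = n) (V : lmodType F) (r : right_action gT V) v e :
  is_partition la' -> is_partition mu' -> sumn la = sumn la' ->
  perm_eq (residues F la) (residues F la') -> perm_eq (residues F mu) (residues F mu') ->
  is_weight En r v (residues F la) (residues F mu) -> v != 0 -> central e ->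
  ract_ga r e v = v -> lies_in_block (hyp_specht_repr F En') e.
Proof.
move=> pl pm Ell rl rm wv nz ce ev.
have [v' [nz' wv' sv']] := hyp_specht_weight En' two_neq0 pl pm.
rewrite (lies_in_block_generator ce sv').
exact: same_block ce (weight_perm rl rm (weight_cast En' Ell wv)) wv' nz ev.
Qed.

Lemma fits_label_ex l : is_block_label p n l -> exists la mu,
  [/\ is_partition la, is_partition mu, (sumn la + sumn mu)%N = n & fits_label p l la mu].
Proof.
case=> cl1 cl2 El.
have [la [pl sl cl]] := core_weight_ex charFp l.1.2 cl1.
have [mu [pm sm cm]] := core_weight_ex charFp l.2.2 cl2.
by exists la, mu; split=> //; rewrite sl sm -El addnA.
Qed.

Lemma fits_label_same l la mu la' mu' : is_partition la -> is_partition mu ->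
  is_partition la' -> is_partition mu' -> fits_label p l la mu -> fits_label p l la' mu' ->
  [/\ sumn la = sumn la', perm_eq (residues F la) (residues F la') &
      perm_eq (residues F mu) (residues F mu')].
Proof.
move=> pl pm pl' pm' [[sl cl] [sm cm]] [[sl' cl'] [sm' cm']]; split.
- by rewrite sl sl'.
- by apply: (same_core_residues charFp pl pl' cl cl'); rewrite sl sl'.
- by apply: (same_core_residues charFp pm pm' cm cm'); rewrite sm sm'.
Qed.

(** One Specht module with the given label determines the block; the others have
    the same residues. *)
Lemma block_of_label_ex l : is_block_label p n l -> exists e, block_of_label p l e.
Proof.
move=> /fits_label_ex[la [mu [pl pm En fl]]].
have [v [nz wv sv]] := hyp_specht_weight En two_neq0 pl pm.
have [z cz|e be ev] := block_ex nz (r := subg_action (hyp_specht_repr F En)).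
  by have [c [cv _]] := central_scalar two_neq0 wv nz wv cz; exists c.
exists e; split=> // la' mu' En' pl' pm' fl'; have [[ce _] _ _] := be.
have [Ell rl rm] := fits_label_same pl pm pl' pm' fl fl'.
exact: same_residues_block wv nz ce ev.
Qed.

(** Agreement of the residues, from [block_partitions], determines the cores. *)
Lemma same_block_label e la mu la' mu' (En : (sumn la + sumn mu)%N = n)
    (En' : (sumn la' + sumn mu')%N = n) ga de ga' de' : block_idempotent e ->
  is_partition la -> is_partition mu -> is_partition la' -> is_partition mu' ->
  lies_in_block (hyp_specht_repr F En) e -> lies_in_block (hyp_specht_repr F En') e ->
  has_core p la ga -> has_core p mu de -> has_core p la' ga' -> has_core p mu' de' ->
  [/\ sumn la = sumn la', ga = ga' & de = de'].
Proof.
move=> be pl pm pl' pm' le le' cl cm cl' cm'; have [[ce _] _ _] := be.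
have [v [nz wv sv]] := hyp_specht_weight En two_neq0 pl pm.
have [v' [nz' wv' sv']] := hyp_specht_weight En' two_neq0 pl' pm'.
move/(lies_in_block_generator ce sv): le => ev; move/(lies_in_block_generator ce sv'): le' => ev'.
have [Ell rl rm] := block_partitions two_neq0 be nz nz' ev ev' pl pm pl' pm' wv wv'.
by split=> //; [exact: (residues_same_core charFp pl pl' cl cl' rl) | exact: (residues_same_core charFp pm pm' cm cm' rm)].
Qed.

(** The ideal of the block contains a weight vector with the residues of some pair
    of partitions; the cores and weights of these give the label. *)
Lemma label_of_block e : block_idempotent e -> exists2 l, is_block_label p n l &
  forall e', block_of_label p l e' -> e' = e.
Proof.
move=> be; have [[ce ee] nze _] := be.
have [la [mu [En [x [pl pm nzx [y Ex] wx]]]]] := ideal_weight two_neq0 (introN eqP nze).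
have [ga cl] := core_ex charFp pl; have [de cm] := core_ex charFp pm.
have [_ _ [v sl _] _] := rim_hooks_reduce_inv charFp pl (proj1 cl).
have [_ _ [w sm _] _] := rim_hooks_reduce_inv charFp pm (proj1 cm).
exists ((ga, v), (de, w)).
  by split; [exact: (proj2 cl) | exact: (proj2 cm) | rewrite /= -addnA -sl -sm].
move=> e' [be' le']; have {le'} := le' _ _ En pl pm (conj (conj sl cl) (conj sm cm)).
have [[ce' _] _ _] := be'; have [v' [nz' wv' sv']] := hyp_specht_weight En two_neq0 pl pm.
move/(lies_in_block_generator ce' sv') => ev'.
apply: (block_uniq be' be nzx (same_block ce' wv' wx nz' ev')).
by rewrite ract_regular -ce Ex mulrA ee.
Qed.
End Labels.

Theorem proposition2p11 (F : fieldType) (p n : nat)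
    (charFp : p \in [pchar F]) (odd_p : odd p) (n_gt0 : (0 < n)%N) :
  morita_equivalent
    (group_algebra F (subg_of (hyperoctahedral n)))
    (direct_sum (fun i : 'I_n.+1 => group_algebra F ('S_i * 'S_(n - i))%type))
  /\
  (exists B : block_label -> group_algebra F (subg_of (hyperoctahedral n)),
     [/\ forall l : block_label, is_block_label p n l -> block_idempotent (B l),
         forall e : group_algebra F (subg_of (hyperoctahedral n)),
           block_idempotent e -> exists2 l, is_block_label p n l & B l = e,
         forall l l' : block_label, is_block_label p n l ->
           is_block_label p n l' -> B l = B l' -> l = l' &
         forall (ga : seq nat) (v : nat) (de : seq nat) (w : nat),
           is_block_label p n ((ga, v), (de, w)) ->
         forall (la mu : seq nat) (En : (sumn la + sumn mu)%N = n),
           is_partition la -> is_partition mu ->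
           (lies_in_block (hyp_specht_repr F En) (B ((ga, v), (de, w))) <->
            (sumn la = (sumn ga + v * p)%N /\ has_core p la ga) /\
            (sumn mu = (sumn de + w * p)%N /\ has_core p mu de))]).
Proof.
have pr_p := pcharf_prime charFp.
have two_neq0 : 2%:R != 0 :> F.
  rewrite -(dvdn_pcharf charFp); apply: contraL odd_p => /prime_nt_dvdP-> //.
  by apply: contraTneq pr_p => ->.
split; first exact: hyp_morita.
pose B l : group_algebra F (subg_of (hyperoctahedral n)) :=
  ClassicalEpsilon.epsilon (inhabits 0) (block_of_label p l).
have BP l : is_block_label p n l -> block_of_label p l (B l).
  by move=> /(block_of_label_ex charFp two_neq0)/(ClassicalEpsilon.epsilon_spec (inhabits 0)).
exists B; split=> [l /BP[]|e be|l l' bl bl' EB|ga v de w bl la mu En pl pm] //.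
- have [l bl le] := label_of_block charFp two_neq0 be.
  by exists l => //; apply/le/BP.
- have [be inB] := BP _ bl; have [_ inB'] := BP _ bl'.
  have [la [mu [pl pm En fl]]] := fits_label_ex charFp bl.
  have [la' [mu' [pl' pm' En' fl']]] := fits_label_ex charFp bl'.
  have := inB' _ _ En' pl' pm' fl'; rewrite -EB => {inB'}le'.
  have [[sl cl] [sm cm]] := fl; have [[sl' cl'] [sm' cm']] := fl'.
  have [Ell Ega Ede] := same_block_label charFp two_neq0 be pl pm pl' pm'
    (inB _ _ En pl pm fl) le' cl cm cl' cm'.
  have Emm : sumn mu = sumn mu' by apply: (@addnI (sumn la)); rewrite En Ell En'.
  have p_gt0 := prime_gt0 pr_p.
  move: Ell Emm; rewrite sl sl' sm sm' -Ega -Ede.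
  move=> /addnI/eqP; rewrite eqn_pmul2r // => /eqP Ev /addnI/eqP.
  rewrite eqn_pmul2r // => /eqP Ew.
  by case: l l' Ega Ede Ev Ew {bl bl' EB be inB fl fl' le' sl cl sm cm sl' cl' sm' cm'}
    => [[? ?] [? ?]] [[? ?] [? ?]] /= -> -> -> ->.
have [be inB] := BP _ bl; split=> [le|]; last exact: inB.
have [la0 [mu0 [pl0 pm0 En0 fl0]]] := fits_label_ex charFp bl.
have [[/= sl0 cl0] [/= sm0 cm0]] := fl0.
have [ga' cl] := core_ex charFp pl; have [de' cm] := core_ex charFp pm.
have [Ell Ega Ede] := same_block_label charFp two_neq0 be pl0 pm0 pl pm
  (inB _ _ En0 pl0 pm0 fl0) le cl0 cm0 cl cm.
rewrite Ega Ede; split; split=> //; first by rewrite -Ega -Ell.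
by apply: (@addnI (sumn la)); rewrite En -Ede -sm0 -Ell.
Qed.
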